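(* There is an algorithm which, given a history-deterministic generalised coBüchi automaton $\mathcal{A}$ with state set $Q$, input alphabet $\Sigma$ and $k$ output colours, computes, in time polynomial in $|Q|+|\Sigma|+k$, a history-deterministic generalised coBüchi automaton $\mathcal{B}$ with $\mathcal{L}(\mathcal{B})=\mathcal{L}(\mathcal{A})$ whose number of states is minimal among all history-deterministic generalised coBüchi automata recognising $\mathcal{L}(\mathcal{A})$.
   Context: An automaton is a tuple $\mathcal{A}=(Q,\Sigma,q_{\mathrm{init}},\Delta,\Gamma,\mathrm{col},W)$ with finite state set $Q$, finite input alphabet $\Sigma$, initial state $q_{\mathrm{init}}$, transitions $\Delta\subseteq Q\times\Sigma\times Q$, output alphabet $\Gamma$, a labelling of transitions $\mathrm{col}:\Delta\to\Gamma$, and acceptance condition $W\subseteq\Gamma^\omega$ (acceptance is on transitions). A run on $w=a_1a_2\cdots\in\Sigma^\omega$ is a sequence of transitions $(q_0,a_1,q_1)(q_1,a_2,q_2)\cdots\in\Delta^\omega$ with $q_0=q_{\mathrm{init}}$; it is accepting if the sequence of labels $\mathrm{col}(q_{i-1},a_i,q_i)$ lies in $W$. $\mathcal{L}(\mathcal{A})$ is the set of words with an accepting run. For a finite set $C$ of $k$ output colours, a generalised coBüchi automaton has $\Gamma=2^C$ and $W=\{x\in\Gamma^\omega : \text{some colour } c\in C \text{ belongs to only finitely many letters of } x\}$. A resolver for $\mathcal{A}$ is a function $\sigma:\Sigma^+\to\Delta$ such that for every $w=a_0a_1\cdots\in\Sigma^\omega$, the sequence $\sigma(a_0)\sigma(a_0a_1)\sigma(a_0a_1a_2)\cdots$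 is a run on $w$, and it is accepting whenever $w\in\mathcal{L}(\mathcal{A})$. $\mathcal{A}$ is history-deterministic if it has a resolver. The number of states is $|Q|$. *)

(* Defs.v *)
From mathcomp Require Import all_boot.
Set Implicit Arguments. Unset Strict Implicit. Unset Printing Implicit Defensive.

(* Generalised coBuchi automata over the input alphabet 'I_m,          *)
(* with state set 'I_nQ and colour set C = 'I_nC (k = nC colours).     *)
(* Output alphabet Gamma = 2^C, labels are given by col on transitions.*)

Definition trans_t (nQ m : nat) : finType := ('I_nQ * 'I_m * 'I_nQ)%type.

Record gcb (m : nat) := GCB {
  nQ : nat;
  nC : nat;
  qinit : 'I_nQ;
  delta : {set trans_t nQ m};
  col : trans_t nQ m -> {set 'I_nC}
}.

Definition tsrc n m (t : trans_t n m) : 'I_n := t.1.1.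
Definition tletter n m (t : trans_t n m) : 'I_m := t.1.2.
Definition ttgt n m (t : trans_t n m) : 'I_n := t.2.

Definition is_run m (A : gcb m) (w : nat -> 'I_m)
  (r : nat -> trans_t (nQ A) m) : Prop :=
  tsrc (r 0) = qinit A /\
  forall i, r i \in delta A /\ tletter (r i) = w i /\ tsrc (r i.+1) = ttgt (r i).
Arguments is_run {m} A w r.

Definition accepting_run m (A : gcb m) (r : nat -> trans_t (nQ A) m) : Prop :=
  exists c : 'I_(nC A), exists N, forall i, N <= i -> c \notin @col m A (r i).
Arguments accepting_run {m} A r.

Definition accepts m (A : gcb m) (w : nat -> 'I_m) : Prop :=
  exists r, is_run A w r /\ accepting_run A r.

Definition prefix m (w : nat -> 'I_m) (n : nat) : seq 'I_m := mkseq w n.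

(* sigma is a resolver (only its values on nonempty words matter) *)
Definition resolver m (A : gcb m) (sigma : seq 'I_m -> trans_t (nQ A) m) : Prop :=
  forall w : nat -> 'I_m,
    let r := fun i => sigma (prefix w i.+1) in
    is_run A w r /\ (accepts A w -> accepting_run A r).
Arguments resolver {m} A sigma.

Definition history_deterministic m (A : gcb m) : Prop :=
  exists sigma, resolver A sigma.

(* Encoding of automata as strings over {1,2} (1 = 'a', 2 = 'b').      *)
(* A natural number n is written a^n b; booleans as 0/1.               *)

Definition enc_nat (n : nat) : seq nat := rcons (nseq n 1) 2.

Definition encode m (A : gcb m) : seq nat :=
  enc_nat (nQ A) ++ enc_nat m ++ enc_nat (nC A) ++ enc_nat (qinit A) ++
  flatten [seq enc_nat (t \in delta A) ++
               (if t \in delta A then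
                  flatten [seq enc_nat (c \in @col m A t) | c <- enum 'I_(nC A)]
                else [::])
          | t <- enum (trans_t (nQ A) m)].

(* Deterministic single-tape Turing machines (bi-infinite tape).       *)
(* Tape alphabet 'I_ng.+3 : 0 = blank, 1 and 2 = the encoding symbols. *)
(* delta = None means halt.  Move: true = right, false = left.         *)

Record TM := MkTM {
  ns : nat;
  ng : nat;
  tm_delta : 'I_ns.+1 -> 'I_ng.+3 -> option ('I_ns.+1 * 'I_ng.+3 * bool)
}.

(* configuration: state, reversed left part of tape, tape from head rightwards *)
Definition config (M : TM) := ('I_(ns M).+1 * seq 'I_(ng M).+3 * seq 'I_(ng M).+3)%type.

Definition blank (M : TM) : 'I_(ng M).+3 := ord0.

Definition step (M : TM) (c : config M) : config M :=
  let: (s, L, R) := c in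
  match tm_delta s (head (blank M) R) with
  | None => c
  | Some (s', w, true) => (s', w :: L, behead R)
  | Some (s', w, false) => (s', behead L, head (blank M) L :: w :: behead R)
  end.

Definition halted (M : TM) (c : config M) : bool :=
  let: (s, L, R) := c in
  if tm_delta s (head (blank M) R) is None then true else false.

Definition run_steps (M : TM) (t : nat) (c : config M) : config M := iter t (@step M) c.

Definition init_config (M : TM) (x : seq nat) : config M :=
  (ord0, [::], [seq (inord n : 'I_(ng M).+3) | n <- x]).

Definition output (M : TM) (c : config M) : seq nat :=
  let: (_, _, R) := c in
  map (@nat_of_ord _) (take (find (fun g : 'I_(ng M).+3 => g == blank M) R) R).

Definition computes_within (M : TM) (x : seq nat) (t : nat) (y : seq nat) : Prop :=
  halted (run_steps t (init_config M x)) /\ output (run_steps t (init_config M x)) = y.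

(* Main.v *)
(* A pair of a state [q] and a colour [c] is viewed as a promise that the run from [q] avoids [c].
   A simulation game with nested fixpoints decides language inclusion between states, because a
   resolver that loses it could be led along an accepted word while seeing every colour infinitely
   often. Keep only the transitions to language-maximal successors and, for each colour, the recurrent
   part of the edges avoiding it. Comparing the pairs by simulation of these recurrent graphs, every
   maximal pair [t] spans a family of states on which the promise can be kept deterministically.

   The lower bound: the same escape argument shows that every equivalent history-deterministic
   automaton contains a copy of each family, so each of its language classes has at least as many
   states as the largest family has inequivalent members there. The upper bound: all families can be
   superposed on one set of states, by matching ranks inside each language class, if every maximal
   pair becomes a colour; a resolver follows the oldest run of a family that is still alive.

   All these objects are finite relations obtained by polynomially many first-order updates. They are
   computed by a nested-loop program over relations, which is compiled to a while program on counters
   pointing into an array, and then to a Turing machine whose cells carry the marks of the counters. *)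

Require Import Defs.
From mathcomp Require Import all_boot.
From mathcomp Require Import boolp.
From mathcomp Require Import zify.
Set Implicit Arguments. Unset Strict Implicit. Unset Printing Implicit Defensive.

(** States can be saved because the number of colours of the result is free: if each family has a
    colour of its own, families can share states, and there are only |Q| * (k + 1) pairs. A language
    class then needs the maximum over the families and not their sum, which is why construction and
    lower bound meet class by class. The obstacle is that resolvers are arbitrary functions of the
    history, possibly with infinite memory, and that a word may be accepted through any colour. A
    resolver that never commits to a colour is defeated on a single infinite word; so it commits
    after some finite history, and minimising a set of states that can only shrink then turns
    commitment into recurrence. Resolvers occur in the correctness proofs only. The algorithm
    computes fixpoints, which is sound and complete because simulation and inclusion coincide when
    the right-hand side is history-deterministic. The program never tests for convergence: the input
    length L bounds the numbers of states, letters and colours, so a fixpoint over pairs of states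
    is iterated L^2 times. *)

Notation prefix := Defs.prefix.

(** * Least and greatest fixpoints on finite sets *)

Section Fixpoints.
Variable T : finType.
Implicit Types (F : {set T} -> {set T}) (X Y : {set T}).

Definition monotone F := {homo F : X Y / X \subset Y}.
Definition lfp F := iter #|T| F set0.
Definition gfp F := iter #|T| F setT.

Lemma iter_lfp F k : monotone F -> #|T| <= k -> iter k F set0 = lfp F.
Proof. by move=> mF /subnK <-; rewrite iterD [iter #|T| F set0]/(fixset F) fixsetKn. Qed.

Lemma lfpK F : monotone F -> F (lfp F) = lfp F.
Proof. exact: fixsetK. Qed.

Lemma funsetC_monotone F : monotone F -> monotone (funsetC F).
Proof. exact: funsetC_mono. Qed.

Lemma iter_funsetC F k : iter k F setT = ~: iter k (funsetC F) set0.
Proof. by elim: k => [|k IH] /=; rewrite ?setC0 // /funsetC setCK -IH. Qed.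

Lemma gfpE F : gfp F = ~: lfp (funsetC F).
Proof. exact: iter_funsetC. Qed.

Lemma iter_gfp F k : monotone F -> #|T| <= k -> iter k F setT = gfp F.
Proof.
by move=> mF le; rewrite gfpE iter_funsetC iter_lfp //; apply: funsetC_monotone.
Qed.

Lemma gfpK F : monotone F -> F (gfp F) = gfp F.
Proof.
by move=> mF; rewrite gfpE -{2}(lfpK (funsetC_monotone mF)) /funsetC setCK.
Qed.

Lemma gfp_sub F X : monotone F -> X \subset F X -> X \subset gfp F.
Proof.
move=> mF sX; rewrite /gfp; elim: #|T| => [|k IH] /=; first exact: subsetT.
exact: subset_trans sX (mF _ _ IH).
Qed.

Lemma lfp_monotone F F' : monotone F' -> (forall X, F X \subset F' X) -> lfp F \subset lfp F'.
Proof.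
move=> mF le; rewrite /lfp; elim: #|T| => [|k IH] /=; first exact: subxx.
exact: subset_trans (le _) (mF _ _ IH).
Qed.

Lemma gfp_monotone F F' : monotone F' -> (forall X, F X \subset F' X) -> gfp F \subset gfp F'.
Proof.
move=> mF le; rewrite /gfp; elim: #|T| => [|k IH] /=; first exact: subxx.
exact: subset_trans (le _) (mF _ _ IH).
Qed.

(** [P] may be any proposition, such as an inclusion of languages; deciding it classically turns it
    into a post-fixed point. *)
Lemma gfp_coind F (P : T -> Prop) : monotone F ->
  (forall x, P x -> x \in F [set y | `[< P y >]]) -> forall x, P x -> x \in gfp F.
Proof.
move=> mF H x Px; have /subsetP: [set y | `[< P y >]] \subset gfp F.
  by apply: gfp_sub => //; apply/subsetP => y; rewrite inE => /asboolP /H.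
by apply; rewrite inE; apply/asboolP.
Qed.

(** A member of least cardinality cannot shrink any further. This serves for sets of reachable
    states and of surviving candidates. *)
Lemma decreasing_stable (S : nat -> {set T}) N :
  (forall i, N <= i -> S i.+1 \subset S i) ->
  exists2 M, N <= M & forall i, M <= i -> S i = S M.
Proof.
move=> dec.
have le i j : N <= i -> i <= j -> S j \subset S i.
  move=> Ni /subnK <-; elim: (j - i) => [|k IH]; first exact: subxx.
  by apply: subset_trans (dec _ _) IH; lia.
have ex : exists n, `[< exists2 M, N <= M & #|S M| = n >].
  by exists #|S N|; apply/asboolP; exists N.
case: (ex_minnP ex) => n /asboolP[M NM cM] min.
exists M => // i Mi; apply/eqP; rewrite eqEcard (le _ _ NM Mi) cM.
by apply: min; apply/asboolP; exists i => //; apply: leq_trans Mi.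
Qed.

End Fixpoints.

(** * Infinite words as limits of finite ones *)

Section Limits.
Variable X : Type.

(** Nonempty extensions force the lengths to infinity, so the stages are prefixes of one infinite
    sequence. *)
Lemma limit_seq (h x : nat -> seq X) :
  (forall n, h n.+1 = h n ++ x n) -> (forall n, x n <> [::]) ->
  (forall n, n <= size (h n)) /\ exists f, forall n, mkseq f (size (h n)) = h n.
Proof.
move=> hS xN.
have szh n : n <= size (h n).
  elim: n => // n IH; rewrite hS size_cat.
  by case: (x n) (xN n) => //= a s _; lia.
split=> //.
have [x0 _] : exists y : X, True by case: (x 0) (xN 0) => // a; exists a.
exists (fun i => nth x0 (h i.+1) i) => n.
have mono i j : i <= j -> exists s, h j = h i ++ s.
  move=> /subnK <-; elim: (j - i) => [|k [s IH]]; first by exists [::]; rewrite cats0.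
  by rewrite addSn hS IH; exists (s ++ x (k + i)); rewrite catA.
apply: (@eq_from_nth _ x0); rewrite size_mkseq // => i ilt; rewrite nth_mkseq //.
have [le|/ltnW le] := leqP i.+1 n.
  by case: (mono _ _ le) => s ->; rewrite nth_cat szh.
by case: (mono _ _ le) => s ->; rewrite nth_cat ilt.
Qed.

End Limits.

Section Words.
Variable m : nat.
Implicit Types (w v : nat -> 'I_m) (u x : seq 'I_m).

Definition wcons (a : 'I_m) v : nat -> 'I_m := fun i => if i is j.+1 then v j else a.
Definition wcat u v := foldr wcons v u.

Lemma prefixS w n : prefix w n.+1 = rcons (prefix w n) (w n).
Proof. exact: mkseqS. Qed.

Lemma size_prefix w n : size (prefix w n) = n. Proof. exact: size_mkseq. Qed.

Lemma prefix_wcat u v n : prefix (wcat u v) (size u + n) = u ++ prefix v n.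
Proof.
elim: u => [//|a u IH] /=; rewrite addSn -IH /prefix /mkseq /= -(addn0 1) iotaDl -map_comp.
by congr (_ :: _); apply: eq_map => i.
Qed.

Lemma wcat_cat u x v : wcat (u ++ x) v = wcat u (wcat x v).
Proof. exact: foldr_cat. Qed.

Lemma wcat_prefix w n : wcat (prefix w n) (fun i => w (n + i)) = w.
Proof.
apply: functional_extensionality_dep.
elim: n => // n IH i; rewrite prefixS -cats1 wcat_cat -[RHS]IH.
congr wcat; apply: functional_extensionality_dep => -[|j] //=; first by rewrite addn0.
by rewrite addnS.
Qed.

End Words.

Arguments col {m g}.

(** * Resolvers as strategies from an arbitrary state *)

Section Resolvers.
Variable m : nat.
Variable A : gcb m.
Notation Q := 'I_(nQ A).
Implicit Types (w v : nat -> 'I_m) (u x : seq 'I_m) (s : nat -> Q) (q : Q).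

Definition irun w s := forall i, (s i, w i, s i.+1) \in delta A.
Definition fin_col w s := exists c N, forall i, N <= i -> c \notin col (s i, w i, s i.+1).
Definition Lq q w := exists s, [/\ s 0 = q, irun w s & fin_col w s].
Definition traj (T : seq 'I_m -> Q) w : nat -> Q := fun i => T (prefix w i).

(* A resolver seen as the state reached after each finite history, starting from an arbitrary state. *)
Definition sres q (T : seq 'I_m -> Q) :=
  [/\ T [::] = q, (forall u a, (T u, a, T (rcons u a)) \in delta A)
    & forall w, Lq q w -> fin_col w (traj T w)].
Definition hd q := exists T, sres q T.

Lemma fin_col_shift w s n :
  fin_col w s <-> fin_col (fun i => w (n + i)) (fun i => s (n + i)).
Proof.
split=> -[c [N H]]; exists c.
  by exists N => i Ni; rewrite addnS; apply: H; lia.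
exists (n + N) => i Ni; have -> : i = n + (i - n) by lia.
by rewrite -addnS; apply: H; lia.
Qed.

Lemma acceptsE w : accepts A w <-> Lq (qinit A) w.
Proof.
split.
  case=> r [[r0 rS] [c [N H]]].
  have E i : r i = (tsrc (r i), w i, tsrc (r i.+1)).
    have [_ [e1 ->]] := rS i; rewrite -e1.
    by case: (r i) => -[? ?] ?.
  exists (fun i => tsrc (r i)); split=> //.
  - by move=> i; rewrite -E; case: (rS i).
  - by exists c, N => i /H; rewrite -E.
case=> s [s0 sr [c [N H]]]; exists (fun i => (s i, w i, s i.+1)); split.
  by split=> // i; split.
by exists c, N.
Qed.

Lemma Lq_cons q a q' v : (q, a, q') \in delta A -> Lq q' v -> Lq q (wcons a v).
Proof.
move=> d [s [s0 sr sf]]; exists (fun i => if i is j.+1 then s j else q); split=> //.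
  by case=> [|i] /=; rewrite ?s0 //; apply: sr.
by apply/(fin_col_shift _ _ 1).
Qed.

(** A resolver loses no word: the inclusion that does not hold for arbitrary transitions is
    witnessed by its own run on the whole word. *)
Lemma sres_cons q T a : sres q T ->
  sres (T [:: a]) (fun u => T (a :: u)) /\ forall v, Lq (T [:: a]) v <-> Lq q (wcons a v).
Proof.
move=> [T0 Td Ta].
have E v : Lq (T [:: a]) v -> Lq q (wcons a v).
  by apply: Lq_cons; rewrite -T0; apply: Td.
have trE v i : traj T (wcons a v) i.+1 = traj (fun u => T (a :: u)) v i.
  by rewrite /traj -[wcons a v]/(wcat [:: a] v) -add1n -[1]/(size [:: a]) prefix_wcat.
have F v : Lq q (wcons a v) -> fin_col v (traj (fun u => T (a :: u)) v).
  move=> /Ta /(fin_col_shift _ _ 1) [c [N H]]; exists c, N => i /H.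
  by rewrite !add1n !trE.
split; last first.
  move=> v; split; first exact: E.
  move=> /F f; exists (traj (fun u => T (a :: u)) v); split=> // i.
  by rewrite /traj prefixS; apply: (Td (a :: _)).
by split=> [//|u b|w /E /F //]; apply: (Td (a :: u)).
Qed.

Lemma sres_cat u q T : sres q T ->
  sres (T u) (fun x => T (u ++ x)) /\ forall v, Lq (T u) v <-> Lq q (wcat u v).
Proof.
elim: u q T => [|a u IH] q T H; first by case: (H) => -> *.
have [/IH[H1 H2] H3] := sres_cons a H.
by split=> // v; rewrite H2 H3.
Qed.

Lemma traj_irun q T w : sres q T -> irun w (traj T w).
Proof. by move=> [_ Td _] i; rewrite /traj prefixS. Qed.

Lemma sres_Lq q T w : sres q T -> (Lq q w <-> fin_col w (traj T w)).
Proof.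
move=> H; split; first by case: H => _ _; apply.
move=> f; exists (traj T w); split=> //; last exact: traj_irun H.
by case: H.
Qed.

Lemma hd_of_history_deterministic : history_deterministic A -> hd (qinit A).
Proof.
case=> sigma H.
pose T u := if u is [::] then qinit A else ttgt (sigma u).
have wE (u : seq 'I_m) a : exists w, prefix w (size u).+1 = rcons u a.
  exists (fun i => nth a (rcons u a) i); rewrite -(size_rcons u a); exact: mkseq_nth.
have run w : forall i, sigma (prefix w i.+1) = (T (prefix w i), w i, T (prefix w i.+1)).
  move=> i; have [[r0 rS] _] := H w.
  have [_ [<- _]] := rS i.
  have -> : T (prefix w i) = tsrc (sigma (prefix w i.+1)).
    case: i => [|i]; first by rewrite r0.
    by have [_ [_ ->]] := rS i; rewrite /T prefixS; case: (prefix w i).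
  have -> : T (prefix w i.+1) = ttgt (sigma (prefix w i.+1)).
    by rewrite /T prefixS; case: (prefix w i).
  by case: (sigma _) => -[? ?] ?.
exists T; split=> // [u a|w].
  have [w wu] := wE u a.
  have wu1 : prefix w (size u) = u /\ w (size u) = a.
    by move: wu; rewrite prefixS => /rcons_inj[].
  have [[_ rS] _] := H w; have [+ _] := rS (size u).
  by rewrite run wu wu1.1 wu1.2.
move=> /acceptsE acc; have [_ /(_ acc) [c [N h]]] := H w.
by exists c, N => i /h; rewrite run.
Qed.

Lemma history_deterministic_of_hd (a0 : 'I_m) : hd (qinit A) -> history_deterministic A.
Proof.
case=> T H; have [T0 Td Ta] := H.
(* [a0] is only the default of [last]; on a nonempty word the transition is read off the states
   before and after its last letter. *)
pose sigma u := (T (take (size u).-1 u), last a0 u, T u).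
exists sigma => w r.
have rE i : r i = (traj T w i, w i, traj T w i.+1).
  rewrite /r /sigma prefixS size_rcons last_rcons /traj -prefixS /= size_prefix.
  by rewrite prefixS -cats1 take_size_cat ?size_prefix.
split; last first.
  move=> /acceptsE /Ta [c [N h]]; exists c, N => i /h; by rewrite rE.
split; first by rewrite rE /tsrc /traj /= T0.
by move=> i; rewrite !rE; split=> //; apply: traj_irun H _.
Qed.

End Resolvers.

(** * Labelled graphs and their recurrent parts *)

Section Graphs.
Variables (m : nat) (V : finType).
Implicit Types (g : V -> 'I_m -> V -> bool) (p q : V) (h : seq ('I_m * V)).

Fixpoint gpath g p h := if h is (a, q) :: h' then g p a q && gpath g q h' else true.
Definition gword h : seq 'I_m := [seq x.1 | x <- h].
Definition gend p h := last p [seq x.2 | x <- h].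
Definition walk g (w : nat -> 'I_m) (s : nat -> V) := forall i, g (s i) (w i) (s i.+1).

Lemma gpath_cat g p h h' : gpath g p (h ++ h') = gpath g p h && gpath g (gend p h) h'.
Proof. by elim: h p => [//|[a q] h IH] p /=; rewrite IH andbA. Qed.

Lemma gend_cat p h h' : gend p (h ++ h') = gend (gend p h) h'.
Proof. by rewrite /gend map_cat last_cat. Qed.

Lemma gword_cat h h' : gword (h ++ h') = gword h ++ gword h'.
Proof. exact: map_cat. Qed.

(** [gpath] keeps the visited vertices, which the limit construction needs; [wrun] and [wacc] forget
    them and fix only the word. *)
Fixpoint wrun g p (x : seq 'I_m) q :=
  if x is a :: x' then [exists r, g p a r && wrun g r x' q] else p == q.
Fixpoint wacc g p (x : seq 'I_m) :=
  if x is a :: x' then [exists r, g p a r && wacc g r x'] else true.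
Definition erel g : rel V := fun p q => [exists a, g p a q].
(** The edges inside strongly connected components. *)
Definition rg g p a q := g p a q && connect (erel g) q p.

Lemma wrunP g p x q :
  reflect (exists h, [/\ gpath g p h, gword h = x & gend p h = q]) (wrun g p x q).
Proof.
elim: x p => [|a x IH] p /=.
  apply: (iffP eqP) => [->|[[|h hs] [_ ]]]; by [exists [::]|].
apply: (iffP existsP) => [[r /andP[gr /IH[h [h1 h2 h3]]]]|[[|[b r] h] [//= /andP[gr h1] [<- h2] h3]]].
  by exists ((a, r) :: h); split=> //=; rewrite ?gr // h2.
by exists r; rewrite gr; apply/IH; exists h.
Qed.

Lemma waccP g p x : reflect (exists q, wrun g p x q) (wacc g p x).
Proof.
elim: x p => [|a x IH] p /=; first by apply: ReflectT; exists p.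
apply: (iffP existsP) => [[r /andP[gr /IH[q hq]]]|[q /existsP[r /andP[gr hr]]]].
  by exists q; apply/existsP; exists r; rewrite gr.
by exists r; rewrite gr; apply/IH; exists q.
Qed.

Lemma wrun_cat g p x y q :
  wrun g p (x ++ y) q = [exists r, wrun g p x r && wrun g r y q].
Proof.
apply/idP/existsP.
  elim: x p => [|a x IH] p /=; first by exists p; rewrite eqxx.
  case/existsP=> r /andP[gr /IH[r' /andP[h1 h2]]]; exists r'; rewrite h2 andbT.
  by apply/existsP; exists r; rewrite gr.
case=> r /andP[]; elim: x p => [|a x IH] p /=; first by move/eqP->.
case/existsP=> r' /andP[gr /IH h1] /h1 h2; apply/existsP; exists r'; by rewrite gr.
Qed.

Lemma wrun1 g p a q : wrun g p [:: a] q = g p a q.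
Proof.
apply/existsP/idP => [[r /andP[h /eqP <-]]//|h]; by exists q; rewrite h /= eqxx.
Qed.

Lemma wrun_rcons g p x a q :
  wrun g p (rcons x a) q = [exists r, wrun g p x r && g r a q].
Proof. by rewrite -cats1 wrun_cat; apply: eq_existsb => r; rewrite wrun1. Qed.

Lemma wacc_cat g p x y : wacc g p (x ++ y) = [exists r, wrun g p x r && wacc g r y].
Proof.
apply/waccP/existsP => [[q]|[r /andP[h /waccP[q h']]]].
  rewrite wrun_cat => /existsP[r /andP[h1 h2]]; exists r; rewrite h1; apply/waccP; by exists q.
by exists q; rewrite wrun_cat; apply/existsP; exists r; rewrite h.
Qed.

Lemma wacc_prefix g p x y : wacc g p (x ++ y) -> wacc g p x.
Proof. by rewrite wacc_cat => /existsP[r /andP[h _]]; apply/waccP; exists r. Qed.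

Lemma wacc_rcons g p x a : wacc g p (rcons x a) -> wacc g p x.
Proof. by rewrite -cats1; apply: wacc_prefix. Qed.

Lemma wrun_wacc g p x q : wrun g p x q -> wacc g p x.
Proof. by move=> h; apply/waccP; exists q. Qed.

Lemma sub_wrun g g' p x q : (forall p a q, g p a q -> g' p a q) -> wrun g p x q -> wrun g' p x q.
Proof.
move=> sg; elim: x p => [//|a x IH] p /= /existsP[r /andP[/sg h /IH h']].
by apply/existsP; exists r; rewrite h.
Qed.

Lemma connect_wrunP g p q : reflect (exists x, wrun g p x q) (connect (erel g) p q).
Proof.
apply: (iffP idP) => [/connectP[h ph ->]|[x]].
  elim: h p ph => [|r h IH] p /=; first by exists [::]; rewrite /= eqxx.
  case/andP=> /existsP[a gr] /IH[x hx]; exists (a :: x); apply/existsP; exists r; by rewrite gr.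
elim: x p => [|a x IH] p /=; first by move/eqP->.
case/existsP=> r /andP[gr /IH]; apply: connect_trans; apply: connect1; apply/existsP; by exists a.
Qed.

Lemma sub_rg g p a q : rg g p a q -> g p a q.
Proof. by case/andP. Qed.

Lemma rg_return g p x q : wrun (rg g) p x q -> connect (erel g) q p.
Proof.
elim: x p => [|a x IH] p /=; first by move/eqP->.
by case/existsP=> r /andP[/andP[gr rp] /IH]; move/connect_trans; apply.
Qed.

Lemma gpath_wrun g p h : gpath g p h -> wrun g p (gword h) (gend p h).
Proof. by move=> H; apply/wrunP; exists h. Qed.

End Graphs.

(** * Diagonalising against a resolver *)

Section Escape.
Variables (m : nat) (V : finType) (g : V -> 'I_m -> V -> bool) (p : V).
Variables (A : gcb m) (q : 'I_(nQ A)) (T : seq 'I_m -> 'I_(nQ A)).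
Hypothesis HT : sres q T.
Hypothesis Hacc : forall w s, s 0 = p -> walk g w s -> Lq q w.

Definition hits (u x : seq 'I_m) (d : 'I_(nC A)) := exists x1 a x2,
  x = x1 ++ a :: x2 /\ d \in col (T (u ++ x1), a, T (rcons (u ++ x1) a)).

Lemma hits_catl u x y d : hits u x d -> hits u (x ++ y) d.
Proof.
case=> x1 [a [x2 [-> h]]]; exists x1, a, (x2 ++ y); by rewrite -catA.
Qed.

Lemma hits_catr u x y d : hits (u ++ x) y d -> hits u (x ++ y) d.
Proof.
case=> x1 [a [x2 [-> h]]]; exists (x ++ x1), a, x2; by rewrite catA [u ++ _]catA.
Qed.

(* If every finite walk in [Inv] extends inside [Inv] so as to see any prescribed colour, then
   cycling through the colours yields an accepted word on which the resolver is rejecting. *)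
Lemma no_escape (Inv : seq ('I_m * V) -> Prop) h0 :
  (forall h, Inv h -> gpath g p h) -> Inv h0 ->
  (forall h, Inv h -> exists2 x, x <> [::] & Inv (h ++ x)) ->
  (forall h d, Inv h -> exists2 x, Inv (h ++ x) & hits (gword h) (gword x) d) -> False.
Proof.
move=> Ip I0 Ine Ihit.
have all_hit h : Inv h -> exists x, [/\ x <> [::], Inv (h ++ x) &
    forall d, hits (gword h) (gword x) d].
  move=> Ih.
  (* The colours are treated one after the other; a colour once met stays met in longer
     extensions. *)
  have [x [Ix Hx]] : exists x, Inv (h ++ x) /\
      forall d, d \in enum 'I_(nC A) -> hits (gword h) (gword x) d.
    elim: (enum _) => [|d l [x [Ix Hx]]]; first by exists [::]; rewrite cats0.
    have [y Iy Hy] := Ihit _ d Ix; exists (x ++ y); rewrite catA; split=> // d'.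
    rewrite inE gword_cat => /orP[/eqP->|/Hx]; last exact: hits_catl.
    by apply: hits_catr; rewrite -gword_cat.
  have [y yN Iy] := Ine _ Ix; exists (x ++ y); rewrite catA; split=> //.
    by case: (x).
  by move=> d; rewrite gword_cat; apply/hits_catl/Hx; rewrite mem_enum.
have /choice[nxt Hnxt] : forall h, exists x, Inv h -> [/\ x <> [::], Inv (h ++ x) &
    forall d, hits (gword h) (gword x) d].
  move=> h; have [/all_hit[x Hx]|N] := pselect (Inv h); first by exists x.
  by exists [::].
(* The limit of these extensions is an infinite walk, so its word belongs to the language of [q] by
   [Hacc], although every block meets all colours. *)
pose H n := iter n (fun h => h ++ nxt h) h0.
have IH n : Inv (H n) by elim: n => //= n /Hnxt[].
have [szH [f Hf]] := @limit_seq _ H (fun n => nxt (H n)) (fun=> erefl)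
  (fun n => let: And3 a _ _ := Hnxt _ (IH n) in a).
pose w i := (f i).1; pose s i := if i is j.+1 then (f j).2 else p.
have pw n : prefix w (size (H n)) = gword (H n) by rewrite -[in RHS](Hf n) /gword /mkseq -map_comp.
have sE i : gend p (mkseq f i) = s i.
  by case: i => [//|i]; rewrite /gend mkseqS map_rcons last_rcons.
have wk : walk g w s.
  move=> i; have := Ip _ (IH i.+1); rewrite -(Hf i.+1) -(subnKC (szH i.+1)).
  rewrite /mkseq iotaD map_cat gpath_cat => /andP[+ _].
  rewrite -/(mkseq f i.+1) mkseqS -cats1 gpath_cat => /andP[_].
  by rewrite sE /w /=; case: (f i) => b r; rewrite andbT.
(* The resolver must avoid some [d] from time [N] on, but block number [N] starts after at least [N]
   letters and meets [d]. *)
have [_ _ /(_ w (Hacc (erefl : s 0 = p) wk)) [d [N Hd]]] := HT.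
have [_ _ /(_ d) [x1 [a [x2 [e hd]]]]] := Hnxt _ (IH N).
have pw' : prefix w (size (gword (H N) ++ x1)).+1 = rcons (gword (H N) ++ x1) a.
  have := pw N.+1; rewrite -[H N.+1]/(H N ++ nxt (H N)) gword_cat e catA -cat_rcons.
  move/(congr1 (take (size (gword (H N) ++ x1)).+1)).
  rewrite -{2}(size_rcons _ a) take_size_cat // => <-.
  rewrite /prefix /mkseq -map_take take_iota; congr map; congr iota.
  have -> : size (H N ++ nxt (H N)) = size (gword (H N) ++ gword (nxt (H N))).
    by rewrite -gword_cat /gword size_map.
  by rewrite e !size_cat /=; lia.
move: pw'; rewrite prefixS => /rcons_inj [e1 e2].
have /Hd : N <= size (gword (H N) ++ x1).
  by rewrite size_cat /gword size_map; have := szH N; lia.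
by rewrite /traj prefixS e1 e2 hd.
Qed.

Definition sg (E : 'I_(nQ A) -> 'I_m -> 'I_(nQ A) -> bool) (d : 'I_(nC A)) r a r' :=
  E r a r' && (d \notin col (r, a, r')).

Lemma nohit_wrun (E : 'I_(nQ A) -> 'I_m -> 'I_(nQ A) -> bool) d u x : (forall u a, E (T u) a (T (rcons u a))) -> ~ hits u x d ->
  wrun (sg E d) (T u) x (T (u ++ x)).
Proof.
move=> ET; elim: x u => [|a x IH] u nh /=; first by rewrite cats0.
apply/existsP; exists (T (rcons u a)); apply/andP; split.
  rewrite /sg ET; apply/negP => hc; apply: nh; exists [::], a, x; by rewrite cats0.
by rewrite -cat_rcons; apply: IH => H; apply: nh; rewrite -cat1s; apply: hits_catr; rewrite cats1.
Qed.

(* A loop of [g] at [p] can be traversed so that afterwards the resolver reads all recurrent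
   words of [p] along recurrent edges avoiding one fixed colour. *)
Lemma recurrent_capture (E : 'I_(nQ A) -> 'I_m -> 'I_(nQ A) -> bool) : (forall u a, E (T u) a (T (rcons u a))) ->
  (exists x, x <> [::] /\ wrun g p x p) ->
  exists z d, wrun g p z p /\ forall x a, wacc (rg g) p (rcons x a) ->
    rg (sg E d) (T (z ++ x)) a (T (rcons (z ++ x) a)).
Proof.
move=> ET [l [lN /wrunP[l' [gl wl el]]]].
pose Loop h := gpath g p h /\ gend p h = p.
have LoopC h h' : Loop h -> Loop h' -> Loop (h ++ h').
  by move=> [g1 e1] [g2 e2]; split; rewrite ?gpath_cat ?gend_cat ?g1 e1.
(* If every loop could be followed by a loop meeting any given colour, [no_escape] would apply with
   loops as the invariant. So after some loop [z] a colour [d] is never met again on loops. *)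
have [z [d [Lz Hz]]] : exists z d, Loop z /\ forall x, Loop x -> ~ hits (gword z) (gword x) d.
  apply: contrapT => N.
  apply: (@no_escape Loop [::]) => [h []|//|h Lh|h d Lh].
  - by [].
  - exists l'; last by apply: LoopC.
    by move=> e; apply: lN; rewrite -wl e.
  - apply: contrapT => N'; apply: N; exists h, d; split=> // x Lx hx.
    by apply: N'; exists x => //; apply: LoopC.
(* The set of states reachable without [d] can only shrink along further loops; a loop [x] is chosen
   that makes it smallest. *)
pose R (h : seq ('I_m * V)) := [set r | connect (erel (sg E d)) (T (gword h)) r].
have ex : exists n, `[< exists2 x, Loop x & #|R (z ++ x)| = n >].
  by exists #|R (z ++ [::])|; apply/asboolP; exists [::].
case: (ex_minnP ex) => n /asboolP[x Lx cx] min.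
exists (gword (z ++ x)), d; split; first by case: (LoopC _ _ Lz Lx) => h1 {2}<-; apply: gpath_wrun.
(* Only loops are known to avoid [d]; a word of the recurrent part can be completed to a loop by
   some [y']. *)
move=> y a /waccP[r hr]; have [y' hy'] : exists y', wrun g r y' p.
  by apply/connect_wrunP; apply: rg_return hr.
have Lh : exists2 h, Loop h & gword h = rcons y a ++ y'.
  have /wrunP[h1 [H1 H2 H3]] := sub_wrun (@sub_rg _ _ g) hr.
  have /wrunP[h2 [H4 H5 H6]] := hy'.
  exists (h1 ++ h2); last by rewrite gword_cat H2 H5.
  by split; rewrite ?gpath_cat ?gend_cat ?H1 H3.
case: Lh => h Lh wh.
have nh : ~ hits (gword (z ++ x)) (gword h) d.
  move=> H; apply: (Hz (x ++ h)); first exact: LoopC.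
  by rewrite gword_cat; apply: hits_catr; rewrite -gword_cat.
have W : wrun (sg E d) (T (gword (z ++ x))) (gword h) (T (gword (z ++ x) ++ gword h)).
  exact: nohit_wrun.
(* By minimality the state after the loop reaches all that the state before it reached, in
   particular that state itself. *)
have back : connect (erel (sg E d)) (T (gword (z ++ x) ++ gword h)) (T (gword (z ++ x))).
  have sub : R (z ++ (x ++ h)) \subset R (z ++ x).
    apply/subsetP => r'; rewrite !inE catA gword_cat; apply: connect_trans.
    by apply/connect_wrunP; exists (gword h).
  have : R (z ++ (x ++ h)) == R (z ++ x).
    rewrite eqEcard sub cx; apply: min; apply/asboolP; exists (x ++ h) => //; exact: LoopC.
  move/eqP/setP/(_ (T (gword (z ++ x)))); rewrite !inE connect0 catA gword_cat => ->.
  by [].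
have nh1 : ~ hits (gword (z ++ x)) (rcons y a) d.
  by move=> H; apply: nh; rewrite wh; apply: hits_catl.
rewrite /rg; set t := gword (z ++ x) in nh nh1 W back *.
apply/andP; split.
  rewrite /sg ET; apply/negP => hc; apply: nh1; exists y, a, [::]; by rewrite cats1.
have W1 : wrun (sg E d) (T t) y (T (t ++ y)).
  by apply: nohit_wrun => // H; apply: nh1; rewrite -cats1; apply: hits_catl.
have W2 : wrun (sg E d) (T (rcons (t ++ y) a)) y' (T (t ++ gword h)).
  rewrite wh rcons_cat catA; apply: nohit_wrun => // H.
  by apply: nh; rewrite wh; apply: hits_catr.
apply: connect_trans (connect_trans back _); apply/connect_wrunP; by [exists y'|exists y].
Qed.

End Escape.

(** * Language inclusion as a nested fixpoint *)

Section Simulation.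
Variables (m : nat) (A : gcb m).
Notation Q := 'I_(nQ A).
Notation C := 'I_(nC A).
Implicit Types (X Y Z : {set Q * Q}) (c d : C) (p q : Q).

(* One round of the game where the left player claims that its run avoids [c] from now on and the
   right player claims the same for [d]: seeing [c] restarts the game in [X], and abandoning [d]
   must lead to [Y]. *)
Definition Phi X Y c d Z : {set Q * Q} :=
  [set pq | [forall a, forall p', ((pq.1, a, p') \in delta A) ==>
     [exists q', ((pq.2, a, q') \in delta A) &&
        (if c \in col (pq.1, a, p') then (p', q') \in X
         else ((d \notin col (pq.2, a, q')) && ((p', q') \in Z)) || ((p', q') \in Y))]]].

(** From the outside in: [X] restarts the game when the claim of the left player is refuted, the
    intersection lets that player choose the claim, the least fixpoint [Y] makes the changes of
    answer finitely many, the union chooses the answer, and [Z] is keeping it forever. *)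
Definition simZ X Y c d := gfp (Phi X Y c d).
Definition simYF X c Y := \bigcup_d simZ X Y c d.
Definition simY X c := lfp (simYF X c).
Definition simXF X := \bigcap_c simY X c.
Definition sim := gfp simXF.

Lemma PhiP X Y c d Z p q : reflect
  (forall a p', (p, a, p') \in delta A -> exists q', (q, a, q') \in delta A /\
     if c \in col (p, a, p') then is_true ((p', q') \in X)
     else (d \notin col (q, a, q') /\ (p', q') \in Z) \/ (p', q') \in Y)
  ((p, q) \in Phi X Y c d Z).
Proof.
rewrite inE /=; apply: (iffP forallP) => [H a p' dp|H a].
  have /forallP/(_ p')/implyP/(_ dp)/existsP[q' /andP[dq h]] := H a.
  exists q'; split=> //; case: ifP h => // _ /orP[/andP[]|]; by [left|right].
apply/forallP => p'; apply/implyP => /H[q' [dq h]]; apply/existsP; exists q'; rewrite dq /=.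
by case: ifP h => // _ [[-> ->]|->] //; rewrite orbT.
Qed.

Lemma Phi_sub X X' Y Y' c d Z Z' : X \subset X' -> Y \subset Y' -> Z \subset Z' ->
  Phi X Y c d Z \subset Phi X' Y' c d Z'.
Proof.
move=> /subsetP sX /subsetP sY /subsetP sZ; apply/subsetP => -[p q] /PhiP H; apply/PhiP => a p' dp.
have [q' [dq h]] := H a p' dp; exists q'; split=> //.
by case: ifP h => [_ /sX|_ [[? /sZ]|/sY]]; auto.
Qed.

Lemma Phi_mono X Y c d : monotone (Phi X Y c d).
Proof. by move=> Z Z'; apply: Phi_sub. Qed.

Lemma simZ_sub X X' Y Y' c d : X \subset X' -> Y \subset Y' -> simZ X Y c d \subset simZ X' Y' c d.
Proof. by move=> sX sY; apply: gfp_monotone => [|Z]; [apply: Phi_mono|apply: Phi_sub]. Qed.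

Lemma simYF_mono X c : monotone (simYF X c).
Proof.
move=> Y Y' sY; apply/bigcupsP => d _; apply: (bigcup_max d) => //; exact: simZ_sub.
Qed.

Lemma simXF_mono : monotone simXF.
Proof.
move=> X X' sX; apply/bigcapsP => c _; apply: (bigcap_min c) => //.
apply: lfp_monotone => [|Y]; first exact: simYF_mono.
apply/bigcupsP => d _; apply: (bigcup_max d) => //; exact: simZ_sub.
Qed.

(** The stage of the least fixpoint is a rank: the number of changes of answer still allowed. *)
Definition simYi c i := iter i (simYF sim c) set0.

(** Memory of the right player: its state, the colour that it supposes the left run to avoid, its
    rank, and the colour that it tries to avoid itself. *)
Record gmem := Mem { mq : Q; mc : C; mi : nat; md : C }.
Definition minv p (x : gmem) := (p, mq x) \in simZ sim (simYi (mc x) (mi x)) (mc x) (md x).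

Lemma sim_minv p q c : (p, q) \in sim -> exists x, [/\ mq x = q, mc x = c & minv p x].
Proof.
rewrite /sim -(gfpK simXF_mono) => /bigcapP/(_ c isT); rewrite /simY /lfp.
rewrite -/sim -/(simYi c _); elim: #|_| => [|i IH]; first by rewrite inE.
by case/bigcupP=> d _ h; exists (Mem q c i d).
Qed.

Lemma simYi_minv p q c i : (p, q) \in simYi c i ->
  exists x, [/\ mq x = q, mc x = c, mi x < i & minv p x].
Proof. by case: i => [|i]; rewrite ?inE // => /bigcupP[d _ h]; exists (Mem q c i d). Qed.

(** The left player does not announce its claim. The right player guesses it, and passes to the next
    colour in cyclic order when the guess is refuted. *)
Definition mstep p (x : gmem) a p' (x' : gmem) :=
  [/\ (mq x, a, mq x') \in delta A, minv p' x' &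
   if mc x \in col (p, a, p') then mc x' = ordS (mc x)
   else mc x' = mc x /\ (mi x' < mi x \/
        [/\ mi x' = mi x, md x' = md x & md x \notin col (mq x, a, mq x')])].

Lemma mstep_ex p x a p' : minv p x -> (p, a, p') \in delta A -> exists x', mstep p x a p' x'.
Proof.
case: x => q c i d; rewrite /minv /mstep /= => + dp.
rewrite /simZ -(gfpK (Phi_mono _ _ _ _)) => /PhiP/(_ a p' dp) [q' [dq]].
case: ifP => hc.
  by case/(@sim_minv _ _ (ordS c)) => x' [eq ec hx]; exists x'; rewrite eq.
case=> [[hd hz]|/simYi_minv[x' [eq ec ei hx]]].
  by exists (Mem q' c i d); split=> //=; split=> //; right.
by exists x'; rewrite eq; split=> //; split=> //; left.
Qed.

(** [(e + k - c) %% k] is the number of cyclic steps from [c] to [e], and a step from any colour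
    other than [e] shortens it. *)
Lemma ordS_dist (k : nat) (c e : 'I_k) : c != e ->
  (e + k - ordS c) %% k < (e + k - c) %% k.
Proof.
move=> ne; have {ne} : (c : nat) != e by [].
case: k c e => [|k] [c Hc] [e He] //=.
have M x : x < k.+1 -> x %% k.+1 = x by exact: modn_small.
have MD x : k.+1 <= x < k.+1 + k.+1 -> x %% k.+1 = x - k.+1.
  by move=> /andP[h1 h2]; rewrite -{1}(subnK h1) modnDr M //; lia.
move=> ne; have [lt|ge] := ltnP c.+1 k.+1.
  rewrite (M c.+1) //; have [h|h] := leqP c e.
    by rewrite !MD; lia.
  by rewrite !M; lia.
have -> : c = k by lia.
by rewrite modnn subn0 MD ?M; lia.
Qed.

(* The claimed colour moves on only when it is seen, so it ends on a colour that the left run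
   avoids; then the ranks [mi] can only decrease finitely often. *)
Lemma mstep_transfer w (s : nat -> Q) (x : nat -> gmem) :
  (forall i, mstep (s i) (x i) (w i) (s i.+1) (x i.+1)) ->
  fin_col w s -> fin_col w (fun i => mq (x i)).
Proof.
move=> H [e [N He]].
pose ds i := (e + nC A - mc (x i)) %% nC A.
(* Outer induction on the cyclic distance from the guess to the colour [e] avoided by the left run,
   inner induction on the rank. *)
suff P n r : forall i, N <= i -> ds i < n -> mi (x i) < r -> fin_col w (fun i => mq (x i)).
  by apply: (P (ds N).+1 (mi (x N)).+1 N).
elim: n r => [//|n IHn] r; elim: r => [//|r IHr] i Ni dn ir.
have [stay|] := pselect (forall j, i <= j -> mc (x j) \notin col (s j, w j, s j.+1) /\
   md (x j) \notin col (mq (x j), w j, mq (x j.+1)) /\ mi (x j.+1) = mi (x j)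
   /\ md (x j.+1) = md (x j)).
  exists (md (x i)), i => j ij; have [_ [h _]] := stay j ij.
  suff -> : md (x i) = md (x j) by [].
  rewrite -(subnK ij) in h *; elim: (j - i) => [//|l ->]; rewrite addSn.
  by have [|_ [_ [_ ->]]] := stay (l + i); first by lia.
move=> /existsNP[j0] /not_implyP[ij0 bad0].
(* Otherwise there is a first time [j] at which the memory moves or its colour is seen; guess and
   rank are constant up to [j], and there one of the two measures drops. *)
have ex : exists j, `[< i <= j /\ ~ (mc (x j) \notin col (s j, w j, s j.+1) /\
   md (x j) \notin col (mq (x j), w j, mq (x j.+1)) /\ mi (x j.+1) = mi (x j)
   /\ md (x j.+1) = md (x j)) >] by exists j0; apply/asboolP.
case: (ex_minnP ex) => j /asboolP[ij bad] min.
have [mcE miE] : mc (x j) = mc (x i) /\ mi (x j) = mi (x i).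
  have : forall l, i <= l <= j -> mc (x l) = mc (x i) /\ mi (x l) = mi (x i).
    move=> l /andP[il]; rewrite -(subnK il); elim: (l - i) => [//|l' IH] lj.
    have [|<- <-] := IH; first by lia.
    have [h1 [h2 [h3 h4]]] : mc (x (l' + i)) \notin col (s (l' + i), w (l' + i), s (l' + i).+1) /\
       md (x (l' + i)) \notin col (mq (x (l' + i)), w (l' + i), mq (x (l' + i).+1)) /\
       mi (x (l' + i).+1) = mi (x (l' + i)) /\ md (x (l' + i).+1) = md (x (l' + i)).
      apply: contrapT => h; have : j <= l' + i by apply: min; apply/asboolP; split=> //; lia.
      by lia.
    have [_ _] := H (l' + i); rewrite (negbTE h1) addSn => -[-> _]; by split.
  by apply; rewrite ij leqnn.
have [_ _] := H j; case: ifP => hc.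
  move=> mcS; apply: (IHn (mi (x j.+1)).+1 j.+1) => //; first by lia.
  suff lt : ds j.+1 < ds i by apply: leq_trans lt _.
  rewrite /ds mcS -mcE; apply: ordS_dist.
  by apply/eqP => E; have := He j; rewrite -E hc => /(_ (leq_trans Ni ij)).
case=> mcS [lt|[h1 h2 h3]].
  by apply: (IHr j.+1); [lia|rewrite /ds mcS mcE|lia].
by case: bad; rewrite hc.
Qed.

Lemma sim_sub (c0 : C) p q w : (p, q) \in sim -> Lq p w -> Lq q w.
Proof.
move=> /(@sim_minv _ _ c0) [x0 [x0q _ x0i]] [s [s0 sr sf]].
have /choice[f Hf] : forall z : Q * gmem * 'I_m * Q, exists x',
    minv z.1.1.1 z.1.1.2 -> (z.1.1.1, z.1.2, z.2) \in delta A ->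
    mstep z.1.1.1 z.1.1.2 z.1.2 z.2 x'.
  move=> [[[p0 x] a] p']; have [h|h] := pselect (minv p0 x); last by exists x.
  have [h'|h'] := pselect ((p0, a, p') \in delta A); last by exists x.
  by have [x' H] := mstep_ex h h'; exists x'.
pose x := fix x i := if i is j.+1 then f (s j, x j, w j, s i) else x0.
have xi i : minv (s i) (x i).
  elim: i => [|i IH]; first by rewrite s0.
  by have /(_ IH (sr i)) [] := Hf (s i, x i, w i, s i.+1).
have xs i : mstep (s i) (x i) (w i) (s i.+1) (x i.+1).
  exact: (Hf (s i, x i, w i, s i.+1) (xi i) (sr i)).
exists (fun i => mq (x i)); split; first by rewrite /= x0q.
  by move=> i; case: (xs i).
exact: mstep_transfer sf.
Qed.

(** Against a resolver the memory of the right player depends on the input history alone, so its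
    answers form a strategy on words. *)
Lemma sim_strategy (c0 : C) p q T : (p, q) \in sim -> sres p T ->
  exists T', [/\ T' [::] = q, forall u a, (T' u, a, T' (rcons u a)) \in delta A &
    forall w, fin_col w (traj T w) -> fin_col w (traj T' w)].
Proof.
move=> /(@sim_minv _ _ c0) [x0 [x0q _ x0i]] [T0 Td _].
have /choice[f Hf] : forall z : seq 'I_m * gmem * 'I_m, exists x',
    minv (T z.1.1) z.1.2 -> mstep (T z.1.1) z.1.2 z.2 (T (rcons z.1.1 z.2)) x'.
  move=> [[u x] a]; have [h|h] := pselect (minv (T u) x); last by exists x.
  by have [x' H] := mstep_ex h (Td u a); exists x'.
pose F (z : seq 'I_m * gmem) a := (rcons z.1 a, f (z.1, z.2, a)).
pose x u := (foldl F ([::], x0) u).2.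
have F1 u : (foldl F ([::], x0) u).1 = u.
  by elim/last_ind: u => [//|u a IH]; rewrite foldl_rcons /= IH.
have xS u a : x (rcons u a) = f (u, x u, a).
  by rewrite /x foldl_rcons /= F1.
have xi u : minv (T u) (x u).
  elim/last_ind: u => [|u a IH]; first by rewrite T0.
  by rewrite xS; have /(_ IH) [] := Hf (u, x u, a).
have xs u a : mstep (T u) (x u) a (T (rcons u a)) (x (rcons u a)).
  by rewrite xS; apply: (Hf (u, x u, a) (xi u)).
exists (fun u => mq (x u)); split; first by rewrite /x /= x0q.
  by move=> u a; case: (xs u a).
move=> w; apply: (@mstep_transfer w (traj T w) (fun i => x (prefix w i))) => i.
rewrite /traj prefixS; exact: xs.
Qed.

(** The pairs with an inclusion of languages and a resolver on the right form a post-fixed point. If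
    this failed at a colour [c], the left player could avoid [c] forever and still lead the resolver
    through every colour, against [no_escape]. *)
Lemma sim_complete p q : hd q -> (forall w, Lq p w -> Lq q w) -> (p, q) \in sim.
Proof.
move=> hq pq.
apply: (@gfp_coind _ simXF (fun z => hd z.2 /\ forall w, Lq z.1 w -> Lq z.2 w)) => //.
  exact: simXF_mono.
move=> {p q hq pq} [p q] /= [[T HT] pq].
set X := [set y | _]; apply/bigcapP => c _.
set Y := simY X c; apply: contrapT => nY.
have YK : simYF X c Y = Y by apply: lfpK; apply: simYF_mono.
have [T0 Td _] := HT.
(* While the right player follows its resolver, inclusion at the current pair is all that a restart
   in [X] requires. *)
have X0 u p' : (forall v, Lq p' v -> Lq q (wcat u v)) -> (p', T u) \in X.
  move=> h; rewrite inE; apply/asboolP => /=; have [h1 h2] := sres_cat u HT.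
  by split; [exists (fun x => T (u ++ x))|move=> w /h /h2].
pose g r a r' := ((r, a, r') \in delta A) && (c \notin col (r, a, r')).
have gL r x r' v : wrun g r x r' -> Lq r' v -> Lq r (wcat x v).
  elim: x r => [|a x IH] r /=; first by move/eqP->.
  case/existsP=> r1 /andP[/andP[dr _] /IH h] /h; exact: Lq_cons.
pose Inv h := gpath g p h /\ (gend p h, T (gword h)) \notin Y.
have hit h d : Inv h -> exists2 x, Inv (h ++ x) & hits T (gword h) (gword x) d.
  move=> [gh nh]; apply: contrapT => N.
  case/negP: nh; rewrite -YK; apply/bigcupP; exists d => //.
  (* If no continuation inside [Inv] met [d], the pairs reached before [d] is met would be closed
     under [Phi], which would put the present pair into [Y]. *)
  pose P z := exists x, [/\ gpath g p (h ++ x), z = (gend p (h ++ x), T (gword (h ++ x)))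
      & ~ hits T (gword h) (gword x) d].
  apply: (@gfp_coind _ _ P); first exact: Phi_mono; last first.
    by exists [::]; rewrite cats0; split=> // -[x1 [a [x2 [e _]]]]; case: x1 e.
  move=> _ [x [gx -> nx]]; apply/PhiP => a p' dp.
  set p1 := gend p _ in dp *; set u := gword (h ++ x).
  exists (T (rcons u a)); split; first exact: Td.
  have Hx : forall v, Lq p' v -> Lq q (wcat (rcons u a) v).
    move=> v hv; apply: pq; rewrite -cats1 wcat_cat; apply: gL (gpath_wrun gx) _.
    exact: Lq_cons dp hv.
  case: ifP => hc; first exact: X0.
  pose x' := rcons x (a, p').
  have gx' : gpath g p (h ++ x').
    by rewrite /x' -cats1 catA gpath_cat gx /= -/p1 /g dp hc.
  have ex' : gend p (h ++ x') = p' by rewrite /x' -cats1 catA gend_cat.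
  have wx' : gword (h ++ x') = rcons u a by rewrite /x' -cats1 catA gword_cat cats1.
  (* If [d] is met, the next pair must lie in [Y]: otherwise the walk would still satisfy [Inv] and
     would be the excluded continuation. *)
  have [hd|hd] := pselect (d \in col (T u, a, T (rcons u a))).
    right; apply: contrapT => nY'; apply: N; exists x'.
      by split=> //; rewrite ex' wx'; apply/negP.
    exists (gword x), a, [::]; split; last by rewrite -gword_cat.
    by rewrite /x' /gword map_rcons cats1.
  have [yY|yY] := boolP ((p', T (rcons u a)) \in Y); [by right|left; split; first exact/negP].
  rewrite inE; apply/asboolP; exists x'; rewrite ex' wx'; split=> //.
  move=> [x1 [b [x2 [e hb]]]].
  move: e; rewrite /x' /gword map_rcons /=.
  case/lastP: x2 => [|x2 b'].
    rewrite cats1 => /rcons_inj[e1 e2]; apply: hd; move: hb.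
    by rewrite -e1 -e2 -/(gword x) -gword_cat.
  rewrite -rcons_cons -rcons_cat => /rcons_inj[e1 _]; apply: nx; by exists x1, b, x2.
apply: (@no_escape _ _ g p A q T HT _ Inv [::]).
- move=> w s s0 wk; apply: pq; exists s; split=> //.
    by move=> i; case/andP: (wk i).
  by exists c, 0 => i _; case/andP: (wk i).
- by move=> h [].
- by split=> //=; rewrite /gend /= T0; apply/negP.
- move=> h Ih; have [d _|noC] := pickP (predT : pred C).
    have [x Ix Hx] := hit h d Ih; exists x => // e; move: Hx; rewrite e.
    by case=> x1 [a [x2 [e' _]]]; case: x1 e'.
  by have := noC c.
- by move=> h d /(hit h d).
Qed.

End Simulation.

(** * The minimal automaton *)

Section Canonical.
Variables (m : nat) (A : gcb m).
Notation Q := 'I_(nQ A).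
Notation C := 'I_(nC A).
Notation q0 := (qinit A).
Implicit Types (p q e : Q) (c d : C) (t : Q * C) (x y z u : seq 'I_m).

Definition gd q a q' := ((q, a, q') \in delta A) &&
  [forall q'', ((q, a, q'') \in delta A) ==> ((q'', q') \in sim A)].
Definition good q := connect (erel gd) q0 q.
Definition eqv p q := [&& good p, good q, (p, q) \in sim A & (q, p) \in sim A].
Definition G c : Q -> 'I_m -> Q -> bool := rg (sg gd c).

Definition pleF (R : {set (Q * C) * (Q * C)}) : {set (Q * C) * (Q * C)} :=
  [set z | eqv z.1.1 z.2.1 && [forall a, forall p', G z.1.2 z.1.1 a p' ==>
     [exists q', G z.2.2 z.2.1 a q' && (((p', z.1.2), (q', z.2.2)) \in R)]]].
Definition ple t t' := (t, t') \in gfp pleF.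
Definition peq c e e' := ple (e, c) (e', c) && ple (e', c) (e, c).
Definition tmax t := good t.1 && [forall t', ple t t' ==> ple t' t].
(** The maximality of [gd] once more, one level down: for promises instead of languages. *)
Definition dg c q a q' := G c q a q' && [forall q'', G c q a q'' ==> ple (q'', c) (q', c)].
Definition fam t e := tmax t && connect (erel (dg t.2)) t.1 e.

Variables (c0 : C) (T : seq 'I_m -> Q).
Hypothesis HT : sres q0 T.

(** The successor chosen by a resolver has the full residual language and is among the competitors,
    so a maximal successor simulates it and inherits a resolver through the simulation. *)
Lemma gd_spec q a q' : hd q -> gd q a q' -> hd q' /\ forall v, Lq q' v <-> Lq q (wcons a v).
Proof.
move=> [T1 H1] /andP[dq /forallP mx].
have [H2 E2] := sres_cons a H1.
have s2 : (T1 [:: a], q') \in sim A.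
  have /implyP := mx (T1 [:: a]); apply.
  by case: H1 => <- Td _; apply: (Td [::]).
have E v : Lq q' v <-> Lq q (wcons a v).
  by split; [apply: Lq_cons|move=> /E2; apply: sim_sub].
split=> //; have [T' [T'0 T'd T'a]] := sim_strategy c0 s2 H2.
exists T'; split=> // w /E /E2; case: H2 => _ _ h /h; exact: T'a.
Qed.

(** A competing successor accepts only residual words, and all of these are accepted after the move
    of the resolver; completeness of simulation applies because the resolver continues from
    there. *)
Lemma gd_res q T1 u a : sres q T1 -> gd (T1 u) a (T1 (rcons u a)).
Proof.
move=> H; have [[_ Td _]] := (H); have [H1 _] := sres_cat u H.
rewrite /gd Td; apply/forallP => q''; apply/implyP => dq.
have [H2 _] := sres_cat (rcons u a) H; have [_ E2] := sres_cons a H1.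
apply: sim_complete => [|w hw]; first by exists (fun x => T1 (rcons u a ++ x)).
rewrite -cats1 E2; exact: Lq_cons dq hw.
Qed.

Lemma gd_run_spec u q : wrun gd q0 u q -> hd q /\ forall v, Lq q v <-> Lq q0 (wcat u v).
Proof.
elim/last_ind: u q => [|u a IH] q /=; first by move/eqP <-; split=> //; exists T.
rewrite wrun_rcons => /existsP[r /andP[/IH[hr Er] /(gd_spec hr)[hq Eq]]]; split=> // v.
by rewrite Eq Er -cats1 wcat_cat.
Qed.

Lemma goodP q : reflect (exists u, wrun gd q0 u q) (good q).
Proof. exact: connect_wrunP. Qed.

Lemma good_hd q : good q -> hd q.
Proof. by case/goodP=> u /gd_run_spec[]. Qed.

Lemma good_step q a q' : good q -> gd q a q' -> good q'.
Proof. by move=> h g; apply: connect_trans h _; apply: connect1; apply/existsP; exists a. Qed.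

Lemma good_succ q a : good q -> exists q', gd q a q'.
Proof.
move=> /good_hd [T1 H1]; exists (T1 [:: a]); have := gd_res [::] a H1.
by case: H1 => ->.
Qed.

Lemma T_run u : wrun gd q0 u (T u).
Proof.
elim/last_ind: u => [|u a IH]; first by case: HT => ->; rewrite /= eqxx.
by rewrite wrun_rcons; apply/existsP; exists (T u); rewrite IH (gd_res _ _ HT).
Qed.

Lemma good_T u : good (T u).
Proof. by apply/goodP; exists u; apply: T_run. Qed.

Lemma eqvP p q : good p -> good q -> (eqv p q <-> forall w, Lq p w <-> Lq q w).
Proof.
move=> gp gq; rewrite /eqv gp gq /=; split.
  by move=> /andP[h1 h2] w; split; apply: sim_sub.
move=> h; apply/andP; split; apply: sim_complete; try exact: good_hd; by move=> w /h.
Qed.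

Lemma eqv_goodl p q : eqv p q -> good p. Proof. by case/and4P. Qed.
Lemma eqv_goodr p q : eqv p q -> good q. Proof. by case/and4P. Qed.

Lemma eqv_refl q : good q -> eqv q q.
Proof. by move=> h; apply/eqvP. Qed.

Lemma eqv_sym p q : eqv p q = eqv q p.
Proof. by rewrite /eqv andbCA; congr [&& _, _ & _]; rewrite andbC. Qed.

Lemma eqv_trans p q r : eqv p q -> eqv q r -> eqv p r.
Proof.
move=> h1 h2; have [g1 g2 g3] := And3 (eqv_goodl h1) (eqv_goodl h2) (eqv_goodr h2).
by apply/eqvP => // w; rewrite (eqvP g1 g2).1 // (eqvP g2 g3).1.
Qed.

Lemma eqv_step p q a p' q' : eqv p q -> gd p a p' -> gd q a q' -> eqv p' q'.
Proof.
move=> h gp gq; have [g1 g2] := (eqv_goodl h, eqv_goodr h).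
have [_ E1] := gd_spec (good_hd g1) gp; have [_ E2] := gd_spec (good_hd g2) gq.
apply/eqvP; try by [apply: good_step gp|apply: good_step gq].
by move=> w; rewrite E1 E2 (eqvP g1 g2).1.
Qed.

(** [gd] is deterministic up to equality of languages. *)
Lemma eqv_run p q x p' q' : eqv p q -> wrun gd p x p' -> wrun gd q x q' -> eqv p' q'.
Proof.
elim: x p q => [|a x IH] p q h /=; first by move=> /eqP <- /eqP <-.
case/existsP=> r /andP[g1 h1] /existsP[s /andP[g2 h2]]; exact: IH (eqv_step h g1 g2) h1 h2.
Qed.

Lemma eqv_run_T u q : wrun gd q0 u q -> eqv q (T u).
Proof.
move=> h; apply: eqv_run h (T_run u); apply: eqv_refl; apply/goodP; exists [::].
by rewrite /= eqxx.
Qed.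

Lemma G_sg c p a q : G c p a q -> sg gd c p a q. Proof. exact: sub_rg. Qed.
Lemma G_gd c p a q : G c p a q -> gd p a q.
Proof. by move/G_sg/andP=> []. Qed.
Lemma wrunG_gd c p x q : wrun (G c) p x q -> wrun gd p x q.
Proof. by apply: sub_wrun => *; apply: G_gd; eassumption. Qed.

Lemma pleFP (R : {set _}) p c q d : reflect
  (eqv p q /\ forall a p', G c p a p' -> exists2 q', G d q a q' & ((p', c), (q', d)) \in R)
  (((p, c), (q, d)) \in pleF R).
Proof.
rewrite inE /=; apply: (iffP andP) => -[h H]; split=> //.
  move=> a p' g; have /forallP/(_ p')/implyP/(_ g)/existsP[q' /andP[]] := forallP H a.
  by exists q'.
apply/forallP => a; apply/forallP => p'; apply/implyP => /H[q' h1 h2].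
by apply/existsP; exists q'; rewrite h1.
Qed.

Lemma pleF_mono : monotone pleF.
Proof.
move=> R R' /subsetP sR; apply/subsetP => -[[p c] [q d]] /pleFP[h H]; apply/pleFP; split=> //.
by move=> a p' /H[q' h1 h2]; exists q' => //; apply: sR.
Qed.

Lemma pleP p c q d : reflect
  (eqv p q /\ forall a p', G c p a p' -> exists2 q', G d q a q' & ple (p', c) (q', d))
  (ple (p, c) (q, d)).
Proof.
have -> : ple (p, c) (q, d) = (((p, c), (q, d)) \in pleF (gfp pleF)).
  by rewrite gfpK //; apply: pleF_mono.
exact: pleFP.
Qed.

Lemma ple_coind (P : Q -> C -> Q -> C -> Prop) :
  (forall p c q d, P p c q d -> eqv p q /\ forall a p', G c p a p' ->
     exists2 q', G d q a q' & P p' c q' d) ->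
  forall p c q d, P p c q d -> ple (p, c) (q, d).
Proof.
move=> H p c q d h.
rewrite /ple; pose P' (z : (Q * C) * (Q * C)) := P z.1.1 z.1.2 z.2.1 z.2.2.
apply: (@gfp_coind _ pleF P') => //; first exact: pleF_mono.
move=> [[p1 c1] [q1 d1]] /= /H [h1 h2]; apply/pleFP; split=> // a p' /h2[q' h3 h4].
by exists q' => //; rewrite inE; apply/asboolP.
Qed.

Lemma ple_eqv t t' : ple t t' -> eqv t.1 t'.1.
Proof. by case: t t' => p c [q d] /pleP[]. Qed.

Lemma ple_refl t : good t.1 -> ple t t.
Proof.
case: t => p c /= gp.
apply: (@ple_coind (fun p c q d => [/\ good p, p = q & c = d])) => // {gp} p1 c1 q1 d1 [g <- <-].
split; first exact: eqv_refl.
by move=> a p' h; exists p' => //; split=> //; apply: good_step (G_gd h).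
Qed.

Lemma ple_trans t2 t1 t3 : ple t1 t2 -> ple t2 t3 -> ple t1 t3.
Proof.
case: t1 t2 t3 => [p c] [q d] [r e] h1 h2.
pose P p c r (e : C) := exists q d, ple (p, c) (q, d) /\ ple (q, d) (r, e).
apply: (@ple_coind P); last by exists q, d.
move=> {h1 h2} p1 c1 r1 e1 [q1 [d1 [/pleP[h1 h2] /pleP[h3 h4]]]].
split; first exact: eqv_trans h3.
move=> a p' /h2[q' /h4[r' h5 h6] h7]; exists r' => //; by exists q', d1.
Qed.

Lemma ple_run p c q d x p' : ple (p, c) (q, d) -> wrun (G c) p x p' ->
  exists2 q', wrun (G d) q x q' & ple (p', c) (q', d).
Proof.
elim: x p q => [|a x IH] p q h /=; first by move/eqP<-; exists q.
case/existsP=> r /andP[g1 h1]; have /pleP[_ /(_ _ _ g1)[r' g2 /IH/(_ h1)[q' h2 h3]]] := h.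
by exists q' => //; apply/existsP; exists r'; rewrite g2.
Qed.

Lemma ple_wacc p c q d x : ple (p, c) (q, d) -> wacc (G c) p x -> wacc (G d) q x.
Proof.
by move=> h /waccP[p' /(ple_run h)[q' h1 _]]; apply/waccP; exists q'.
Qed.

(** Stronger than [ple]: the answer is a function of the word and does not depend on the run of
    [G c] that reads it. *)
Definition follow p c q d := exists f : seq 'I_m -> Q,
  f [::] = q /\ forall x a, wacc (G c) p (rcons x a) -> G d (f x) a (f (rcons x a)).

Lemma follow_run p c q d f x y : f [::] = q ->
  (forall x a, wacc (G c) p (rcons x a) -> G d (f x) a (f (rcons x a))) ->
  wacc (G c) p (x ++ y) -> wrun (G d) (f x) y (f (x ++ y)).
Proof.
move=> f0 H; elim: y x => [|a y IH] x /=; first by rewrite cats0.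
rewrite -cat_rcons => h; apply/existsP; exists (f (rcons x a)); rewrite IH // andbT.
by apply: H; apply: wacc_prefix h.
Qed.

Lemma follow_ple p c q d : eqv p q -> follow p c q d -> ple (p, c) (q, d).
Proof.
move=> epq [f [f0 H]].
apply: (@ple_coind (fun p' c' q' d' => [/\ c' = c, d' = d &
   exists x, wrun (G c) p x p' /\ q' = f x])); last first.
  by split=> //; exists [::]; rewrite /= eqxx.
move=> p1 c1 q1 d1 [-> -> [x [h ->]]]; split.
  apply: eqv_run epq (wrunG_gd h) _.
  by rewrite -f0; apply/wrunG_gd/(follow_run (x := [::]) f0 H)/wrun_wacc/h.
move=> a p' g; have hx : wrun (G c) p (rcons x a) p'.
  by rewrite wrun_rcons; apply/existsP; exists p1; rewrite h.
exists (f (rcons x a)); first by apply: H; apply: wrun_wacc hx.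
by split=> //; exists (rcons x a).
Qed.

(** The simulation answers the single run chosen by [f], so the composed answer still depends on the
    word only. *)
Lemma follow_trans p c q d r (e : C) : follow p c q d -> ple (q, d) (r, e) -> follow p c r e.
Proof.
move=> [f [f0 H]] h.
have /choice[k Hk] : forall z : Q * Q * 'I_m * Q, exists r', ple (z.1.1.1, d) (z.1.1.2, e) ->
    G d z.1.1.1 z.1.2 z.2 -> G e z.1.1.2 z.1.2 r' /\ ple (z.2, d) (r', e).
  move=> [[[q1 r1] a] q2] /=.
  have [h1|n] := pselect (ple (q1, d) (r1, e)); last by exists r1.
  have [h2|n] := pselect (G d q1 a q2); last by exists r1.
  by have /pleP[_ /(_ _ _ h2)[r' ? ?]] := h1; exists r'.
pose F (z : seq 'I_m * Q) a := (rcons z.1 a, k (f z.1, z.2, a, f (rcons z.1 a))).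
pose f' u := (foldl F ([::], r) u).2.
have F1 u : (foldl F ([::], r) u).1 = u.
  by elim/last_ind: u => [//|u a IH]; rewrite foldl_rcons /= IH.
have f'S u a : f' (rcons u a) = k (f u, f' u, a, f (rcons u a)).
  by rewrite /f' foldl_rcons /= F1.
have inv x : wacc (G c) p x -> ple (f x, d) (f' x, e).
  elim/last_ind: x => [_|x a IH hx]; first by rewrite f0.
  by rewrite f'S; have [] := Hk (f x, f' x, a, f (rcons x a)) (IH (wacc_rcons hx)) (H _ _ hx).
exists f'; split=> // x a hx; rewrite f'S.
by have [] := Hk (f x, f' x, a, f (rcons x a)) (inv _ (wacc_rcons hx)) (H _ _ hx).
Qed.

(** History determinism of a promise: all words readable while keeping it are read by one choice
    function. *)
Definition shd q c := follow q c q c.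

Lemma shd_incl p c q d : shd q d -> eqv p q ->
  (forall x, wacc (G c) p x -> wacc (G d) q x) -> ple (p, c) (q, d).
Proof.
move=> [f [f0 H]] h i; apply: follow_ple => //; exists f; split=> // x a /i; exact: H.
Qed.

Lemma shd_ple q c q' : shd q c -> ple (q, c) (q', c) -> ple (q', c) (q, c) -> shd q' c.
Proof.
move=> h1 h2 h3; have [f [f0 H]] := follow_trans h1 h2; exists f; split=> // x a.
by move/(ple_wacc h3); apply: H.
Qed.

(** A pair above [t] with as many pairs below it as possible is maximal. *)
Lemma max_above t : good t.1 -> exists2 t', tmax t' & ple t t'.
Proof.
move=> gt; pose dn t := [set s | ple s t].
have ex : exists t', ple t t' by exists t; apply: ple_refl.
have [/= t' h mx] : {t' | ple t t' & forall s, ple t s -> #|dn s| <= #|dn t'|}.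
  case: (@arg_maxnP _ t (ple t) (fun s => #|dn s|)); first exact: ple_refl.
  by move=> t' h1 h2; exists t'.
exists t' => //; rewrite /tmax (eqv_goodr (ple_eqv h)) /=.
apply/forallP => s; apply/implyP => h1.
have sub : dn t' \subset dn s by apply/subsetP => r; rewrite !inE => /ple_trans; apply.
have : dn t' == dn s by rewrite eqEcard sub mx //; apply: ple_trans h1.
move/eqP/setP/(_ s); rewrite !inE => ->; apply: ple_refl; exact: eqv_goodr (ple_eqv h1).
Qed.

Lemma walk_Lq c p w s : s 0 = p -> walk (sg gd c) w s -> Lq p w.
Proof.
move=> s0 wk; exists s; split=> //.
  by move=> i; case/andP: (wk i) => /andP[].
by exists c, 0 => i _; case/andP: (wk i).
Qed.

Lemma no_loop_wacc c q x a : ~ (exists x, x <> [::] /\ wrun (sg gd c) q x q) ->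
  ~~ wacc (G c) q (rcons x a).
Proof.
move=> N; apply/negP => /waccP[r h]; apply: N.
have /connect_wrunP[y hy] := rg_return h.
exists (rcons x a ++ y); split; first by case: (x).
by rewrite wrun_cat; apply/existsP; exists r; rewrite hy (sub_wrun (@G_sg c) h).
Qed.

(** The resolver captures the loops of [q], so some pair follows [(q, c)]. By maximality that pair
    is below [(q, c)] again, and the composition lets [(q, c)] follow itself. *)
Lemma max_shd q c : tmax (q, c) -> shd q c.
Proof.
move=> /andP[/= gq /forallP mx].
(* Without a loop the recurrent part reads no letter at [q], so a constant function will do. *)
have [lp|nl] := pselect (exists x, x <> [::] /\ wrun (sg gd c) q x q); last first.
  by exists (fun=> q); split=> // x a; rewrite (negbTE (no_loop_wacc _ _ nl)).
have /goodP[u hu] := gq; have [HTu Lu] := sres_cat u HT.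
have Eq := eqv_run_T hu.
have [z [d [hz H]]] := @recurrent_capture _ _ (sg gd c) q A (T u) _ HTu
  (fun w s s0 wk => ((eqvP gq (good_T u)).1 Eq w).1 (walk_Lq s0 wk)) gd
  (fun v a => gd_res v a HTu) lp.
have F : follow q c (T (u ++ z)) d.
  by exists (fun x => T (u ++ (z ++ x))); split=> [|x a /H]; rewrite ?cats0 ?rcons_cat.
have E2 : eqv q (T (u ++ z)).
  apply: eqv_run_T; rewrite wrun_cat; apply/existsP; exists q; rewrite hu /=.
  by apply: sub_wrun hz => ? ? ? /andP[].
have h1 := follow_ple E2 F.
exact: follow_trans F (implyP (mx (T (u ++ z), d)) h1).
Qed.

Lemma dg_G c q a q' : dg c q a q' -> G c q a q'. Proof. by case/andP. Qed.

(** The first move of the choice function loses no readable word, which by [shd_incl] puts it above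
    all competitors. *)
Lemma shd_next q c a : good q -> shd q c -> wacc (G c) q [:: a] ->
  exists2 q', dg c q a q' & shd q' c /\ forall x, wacc (G c) q' x = wacc (G c) q (a :: x).
Proof.
move=> gq [f [f0 H]] ha.
have g1 : G c q a (f [:: a]) by rewrite -f0; apply: (H [::]).
have W x : wacc (G c) (f [:: a]) x = wacc (G c) q (a :: x).
  apply/idP/idP => h; first by apply/existsP; exists (f [:: a]); rewrite g1.
  by apply: wrun_wacc (follow_run (x := [:: a]) f0 H h).
have S : shd (f [:: a]) c.
  exists (fun x => f (a :: x)); split=> // x b; rewrite W; exact: (H (a :: x)).
exists (f [:: a]) => //; rewrite /dg g1; apply/forallP => q''; apply/implyP => g2.
apply: shd_incl => //.
  exact: eqv_step (eqv_refl gq) (G_gd g2) (G_gd g1).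
by move=> x h; rewrite W; apply/existsP; exists q''; rewrite g2.
Qed.

(** Two [dg] moves on one letter are above each other, and the one from [shd_next] keeps all
    readable words. *)
Lemma dg_spec q c a q' : good q -> shd q c -> dg c q a q' ->
  shd q' c /\ forall x, wacc (G c) q' x = wacc (G c) q (a :: x).
Proof.
move=> gq sq /andP[g /forallP mx].
have ha : wacc (G c) q [:: a] by apply/existsP; exists q'; rewrite g.
have [q1 h1 [S1 W1]] := shd_next gq sq ha.
have i1 := implyP (mx q1) (dg_G h1).
have i2 : ple (q', c) (q1, c) by case/andP: h1 => _ /forallP/(_ q')/implyP; apply.
split; first exact: shd_ple S1 i1 i2.
by move=> x; rewrite -W1; apply/idP/idP; apply: ple_wacc.
Qed.

Lemma dg_run_spec q c x e : good q -> shd q c -> wrun (dg c) q x e ->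
  [/\ good e, shd e c & forall y, wacc (G c) e y = wacc (G c) q (x ++ y)].
Proof.
elim: x q => [|a x IH] q gq sq /=; first by move/eqP<-.
case/existsP=> r /andP[h /IH H]; have [sr Wr] := dg_spec gq sq h.
have [||ge se We] := H => //; first exact: good_step (G_gd (dg_G h)).
by split=> // y; rewrite We Wr.
Qed.

Lemma dg_run_ex q c x : good q -> shd q c -> wacc (G c) q x -> exists e, wrun (dg c) q x e.
Proof.
elim: x q => [|a x IH] q gq sq h; first by exists q; rewrite /= eqxx.
have [|r hr [sr Wr]] := @shd_next q c a gq sq; first by rewrite (@wacc_prefix _ _ _ _ _ x).
have [||e he] := IH r _ sr; rewrite ?Wr //; first exact: good_step (G_gd (dg_G hr)).
by exists e; apply/existsP; exists r; rewrite hr.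
Qed.

Lemma wrunD_G c q x e : wrun (dg c) q x e -> wrun (G c) q x e.
Proof. by apply: sub_wrun => *; apply: dg_G; eassumption. Qed.

Lemma tmax_good t : tmax t -> good t.1. Proof. by case/andP. Qed.

Lemma famP t e : reflect (tmax t /\ exists x, wrun (dg t.2) t.1 x e) (fam t e).
Proof.
apply: (iffP andP) => -[h H]; split=> //; exact/connect_wrunP.
Qed.

Lemma fam_shd t e : fam t e -> good e /\ shd e t.2.
Proof.
case/famP=> mt [x h]; case: t mt h => q c mt /= h.
by have [] := dg_run_spec (tmax_good mt) (max_shd mt) h.
Qed.

Lemma fam_step t e a e' : fam t e -> dg t.2 e a e' -> fam t e'.
Proof.
case/famP=> mt [x h] g; apply/famP; split=> //; exists (rcons x a).
by rewrite wrun_rcons; apply/existsP; exists e; rewrite h.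
Qed.

Lemma fam_self t : tmax t -> fam t t.1.
Proof. by move=> h; apply/famP; split=> //; exists [::]; rewrite /= eqxx. Qed.

(** Members of a family are history-deterministic for their promise, which turns equality of
    readable words into mutual simulation. *)
Lemma fam_peq t e e' : fam t e -> fam t e' ->
  (peq t.2 e e' <-> eqv e e' /\ forall x, wacc (G t.2) e x = wacc (G t.2) e' x).
Proof.
move=> /fam_shd[g1 s1] /fam_shd[g2 s2]; split.
  move=> /andP[h1 h2]; split; first exact: ple_eqv h1.
  by move=> x; apply/idP/idP; apply: ple_wacc.
move=> [h W]; apply/andP; split; apply: shd_incl => //; rewrite 1?eqv_sym // => x; by rewrite W.
Qed.

Lemma peq_sym c e e' : peq c e e' = peq c e' e. Proof. exact: andbC. Qed.
Lemma peq_trans c e1 e2 e3 : peq c e1 e2 -> peq c e2 e3 -> peq c e1 e3.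
Proof.
move=> /andP[h1 h2] /andP[h3 h4]; apply/andP; split; [exact: ple_trans h3|exact: ple_trans h2].
Qed.
Lemma peq_eqv c e e' : peq c e e' -> eqv e e'.
Proof. by case/andP=> /ple_eqv. Qed.
Lemma peq_refl c e : good e -> peq c e e.
Proof. by move=> h; rewrite /peq ple_refl. Qed.

Lemma peq_step t e1 e2 a e1' e2' : fam t e1 -> fam t e2 -> peq t.2 e1 e2 ->
  dg t.2 e1 a e1' -> dg t.2 e2 a e2' -> peq t.2 e1' e2'.
Proof.
move=> f1 f2 h d1 d2; have [g1 s1] := fam_shd f1; have [g2 s2] := fam_shd f2.
have [E W] := (fam_peq f1 f2).1 h.
apply/(fam_peq (fam_step f1 d1) (fam_step f2 d2)); split.
  exact: eqv_step E (G_gd (dg_G d1)) (G_gd (dg_G d2)).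
have [_ W1] := dg_spec g1 s1 d1; have [_ W2] := dg_spec g2 s2 d2.
by move=> x; rewrite W1 W2 W.
Qed.

End Canonical.

Arguments gd {m A}.
Arguments G {m A}.
Arguments dg {m A}.

(** * Ranks in a finite linear order *)

Section Rank.
Variable n : nat.
Implicit Types (P : pred 'I_n) (x y : 'I_n).

Definition rank P x := #|[set y : 'I_n | (y < x) && P y]|.

Lemma rank_ltn P x y : P x -> x < y -> rank P x < rank P y.
Proof.
move=> Px lt; apply: proper_card; apply/properP; split.
  by apply/subsetP => z; rewrite !inE => /andP[h ->]; rewrite andbT; lia.
by exists x; rewrite !inE ?lt ?Px //= ltnn.
Qed.

Lemma rank_inj P x y : P x -> P y -> rank P x = rank P y -> x = y.
Proof.
move=> Px Py e; apply: val_inj; case: (ltngtP x y) => // lt.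
  by have := rank_ltn Px lt; rewrite e ltnn.
by have := rank_ltn Py lt; rewrite e ltnn.
Qed.

Lemma rank_card P x : P x -> rank P x < #|[set y | P y]|.
Proof.
move=> Px; apply: proper_card; apply/properP; split.
  by apply/subsetP => z; rewrite !inE => /andP[].
by exists x; rewrite !inE ?Px //= ltnn.
Qed.

Lemma rank_below P i : #|[set y | P y & rank P y < i]| <= i.
Proof.
case: i => [|i]; first by rewrite leqn0 cards_eq0; apply/eqP/setP => y; rewrite !inE ltn0 andbF.
rewrite -(@card_in_imset _ _ (fun y => inord (rank P y) : 'I_i.+1)).
  by rewrite -[X in _ <= X]card_ord; apply: max_card.
move=> x y; rewrite !inE => /andP[Px lx] /andP[Py ly] /(congr1 val).
by rewrite /= !inordK //; apply: rank_inj.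
Qed.

(** Take the least element of rank at least [i]: the elements of [P] before it have rank below [i],
    and there are at most [i] of those. *)
Lemma rank_onto P i : i < #|[set y | P y]| -> exists2 x, P x & rank P x = i.
Proof.
move=> lt.
have [x0 x0P] : exists x, P x && (i <= rank P x).
  apply: contrapT => N; have := rank_below P i; rewrite leqNgt => /negP; apply.
  apply: leq_trans lt _; apply: subset_leq_card; apply/subsetP => y; rewrite !inE => Py.
  by rewrite Py ltnNge; apply/negP => h; apply: N; exists y; rewrite Py.
case: (@arg_minnP _ x0 (fun x => P x && (i <= rank P x)) (fun x => val x)) => // x /andP[Px ix] mn.
exists x => //; apply/eqP; rewrite eqn_leq ix andbT.
apply: leq_trans (rank_below P i); apply: subset_leq_card; apply/subsetP => y.
rewrite !inE => /andP[yx Py]; rewrite Py ltnNge; apply/negP => h.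
by have := mn y; rewrite Py h => /(_ isT) /=; lia.
Qed.

Lemma eq_rank P P' x : P =1 P' -> rank P x = rank P' x.
Proof. by move=> e; apply: eq_card => y; rewrite !inE e. Qed.

End Rank.

(** * Superposing the families, and the resolver of the result *)

Section MinAutomaton.
Variables (m : nat) (A : gcb m).
Notation Q := 'I_(nQ A).
Notation C := 'I_(nC A).
Notation q0 := (qinit A).
Implicit Types (p q e s : Q) (c d : C) (t : Q * C) (x y u : seq 'I_m).

Definition rk q := rank (fun p => eqv p q) q.
Definition rep t e := fam t e &&
  [forall e' : Q, (e' < e) && fam t e' ==> ~~ peq t.2 e' e].
Definition rkf t e := rank (fun e' => rep t e' && eqv e' e) e.
(* The element [e] of the family of [t] is placed on the state of its class with the same rank. *)
Definition img t e s := fam t e &&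
  [exists e0, [&& rep t e0, peq t.2 e0 e, eqv e0 s & rkf t e0 == rk s]].
(** Rank 0 gives every class a state at once, as the initial state and the fallback of the resolver
    require. *)
Definition QB : {set Q} := [set s | good s && ((rk s == 0) || [exists t, exists e, img t e s])].
(** Every transition that respects residual languages is present; only the colours restrict a
    run. *)
Definition dB s a s' := [exists r, gd s a r && eqv r s'].
Definition sB t s a s' := [exists e, exists e', [&& img t e s, dg t.2 e a e' & img t e' s']].
Definition b0 : Q := odflt q0 [pick s | eqv s q0 && (rk s == 0)].
(** Avoiding the colour [t] means following the family of [t]. A pair that is not maximal has no
    images, so its colour lies on every transition. *)
Definition mkB (H : b0 \in QB) : gcb m :=
  @GCB m #|QB| #|{: Q * C}| (enum_rank_in H b0)
    [set z : trans_t #|QB| m | dB (enum_val z.1.1) z.1.2 (enum_val z.2)]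
    (fun z : trans_t #|QB| m => [set i | ~~ sB (enum_val i) (enum_val z.1.1) z.1.2 (enum_val z.2)]).

Variables (c0 : C) (T : seq 'I_m -> Q).
Hypothesis HT : sres q0 T.
Let eqv_trans := eqv_trans c0 HT.
Let eqv_refl := eqv_refl c0 HT.
Let good_T := good_T HT.
Let fam_shd := @fam_shd m A c0 T HT.
Let peq_trans := @peq_trans m A c0 T HT.
Let peq_refl := @peq_refl m A c0 T HT.

Lemma eqv_l s q : eqv s q -> (fun p => eqv p s) =1 (fun p => eqv p q).
Proof.
move=> h p; apply/idP/idP => h'; first exact: eqv_trans h.
by apply: eqv_trans h' _; rewrite eqv_sym.
Qed.

Lemma rk_inj s s' : eqv s s' -> rk s = rk s' -> s = s'.
Proof.
move=> h; rewrite /rk (eq_rank _ (eqv_l h)); apply: rank_inj => //.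
exact/eqv_refl/(eqv_goodr h).
Qed.

Lemma rkf_inj t e e' : rep t e -> rep t e' -> eqv e e' -> rkf t e = rkf t e' -> e = e'.
Proof.
move=> r1 r2 h; rewrite /rkf.
have E : (fun p => rep t p && eqv p e) =1 (fun p => rep t p && eqv p e').
  by move=> p; rewrite (eqv_l h).
rewrite (eq_rank _ E); apply: rank_inj; first by rewrite r1 h.
by rewrite r2 /=; apply/eqv_refl/(eqv_goodr h).
Qed.

Lemma rep_fam t e : rep t e -> fam t e. Proof. by case/andP. Qed.

Lemma rep_uniq t e e' : rep t e -> rep t e' -> peq t.2 e e' -> e = e'.
Proof.
move=> /andP[f1 /forallP m1] /andP[f2 /forallP m2] h; apply: val_inj.
case: (ltngtP e e') => // lt.
  by have := m2 e; rewrite lt f1 h.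
by have := m1 e'; rewrite lt f2 peq_sym h.
Qed.

Lemma rep_ex t e : fam t e -> exists2 e0, rep t e0 & peq t.2 e0 e.
Proof.
move=> f; have [g _] := fam_shd f.
case: (@arg_minnP _ e (fun e' => fam t e' && peq t.2 e' e) (fun e' => val e')).
  by rewrite f peq_refl.
move=> e0 /andP[f0 h0] mn; exists e0 => //; rewrite /rep f0; apply/forallP => e'.
apply/implyP => /andP[lt f']; apply/negP => h; have := mn e'.
by rewrite f' (peq_trans h h0) => /(_ isT) /=; lia.
Qed.

(** The representatives in a class are themselves states of the class, so it has enough ranks for
    all of them. *)
Lemma img_ex t e : fam t e -> exists s, img t e s.
Proof.
move=> f; have [e0 r0 h0] := rep_ex f; have [g0 _] := fam_shd (rep_fam r0).
have lt : rkf t e0 < #|[set s | eqv s e0]|.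
  apply: leq_trans (rank_card _) _; first by rewrite r0 eqv_refl.
  by apply: subset_leq_card; apply/subsetP => y; rewrite !inE => /andP[].
have [s hs rs] := rank_onto lt; exists s; rewrite /img f; apply/existsP; exists e0.
by rewrite r0 h0 eqv_sym hs -rs /rk (eq_rank _ (eqv_l hs)) eqxx.
Qed.

Lemma imgP t e s : reflect (fam t e /\ exists e0,
  [/\ rep t e0, peq t.2 e0 e, eqv e0 s & rkf t e0 = rk s]) (img t e s).
Proof.
apply: (iffP andP) => -[f h]; split=> //.
  by case/existsP: h => e0 /and4P[h1 h2 h3 /eqP h4]; exists e0.
by case: h => e0 [h1 h2 h3 h4]; apply/existsP; exists e0; rewrite h1 h2 h3 h4 eqxx.
Qed.

Lemma img_fam t e s : img t e s -> fam t e. Proof. by case/andP. Qed.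

Lemma img_eqv t e s : img t e s -> eqv e s.
Proof.
case/imgP=> f [e0 [_ /peq_eqv h h' _]]; apply: eqv_trans h'; by rewrite eqv_sym.
Qed.

Lemma img_peq t e e' s : img t e s -> fam t e' -> peq t.2 e e' -> img t e' s.
Proof.
move=> /imgP[f [e0 [h1 h2 h3 h4]]] f' h; apply/imgP; split=> //; exists e0; split=> //.
exact: peq_trans h.
Qed.

Lemma img_inj t e e' s : img t e s -> img t e' s -> peq t.2 e e'.
Proof.
move=> /imgP[f [e0 [h1 h2 h3 h4]]] /imgP[f' [e0' [h1' h2' h3' h4']]].
have E : e0 = e0'.
  apply: (rkf_inj h1 h1'); last by rewrite h4.
  by apply: eqv_trans h3 _; rewrite eqv_sym.
by rewrite -E in h2'; apply: peq_trans h2'; rewrite peq_sym.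
Qed.

Lemma img_QB t e s : img t e s -> s \in QB.
Proof.
move=> h; rewrite inE (eqv_goodr (img_eqv h)); apply/orP; right.
by apply/existsP; exists t; apply/existsP; exists e.
Qed.

Lemma b0E s : eqv s q0 && (rk s == 0) = (s == b0).
Proof.
have g0 : good q0 by exact: connect0.
have [|s0 hs rs] := @rank_onto _ (fun p => eqv p q0) 0.
  by apply/card_gt0P; exists q0; rewrite inE eqv_refl.
rewrite /b0; case: pickP => [s' /andP[h /eqP h']|/(_ s0)]; last first.
  by rewrite hs /= /rk (eq_rank _ (eqv_l hs)) rs.
apply/andP/eqP => [[e /eqP r]|->]; last by rewrite h h'.
apply: rk_inj; last by rewrite h'.
by apply: eqv_trans e _; rewrite eqv_sym.
Qed.

Lemma b0P : eqv b0 q0 /\ b0 \in QB.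
Proof.
by have := b0E b0; rewrite eqxx => /andP[h r]; rewrite inE (eqv_goodl h) r.
Qed.

Lemma dB_step s a s' q q' : eqv s q -> gd q a q' -> dB s a s' = eqv s' q'.
Proof.
move=> h g; apply/existsP/idP => [[r /andP[g' h']]|h'].
  by rewrite eqv_sym; apply: eqv_trans h'; rewrite eqv_sym; apply: (eqv_step c0 HT h g' g).
have [r g'] := good_succ c0 HT a (eqv_goodl h); exists r; rewrite g' /=.
by apply: eqv_trans (eqv_step c0 HT h g' g) _; rewrite eqv_sym.
Qed.

(** Without the colour [t] each state names a member of the family up to [peq]; from one such member
    a run of [A] avoiding [t.2] is rebuilt by [dg] steps. *)
Lemma B_sound w (s : nat -> Q) t N : s 0 = b0 ->
  (forall i, dB (s i) (w i) (s i.+1)) ->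
  (forall i, N <= i -> sB t (s i) (w i) (s i.+1)) -> Lq q0 w.
Proof.
move=> s0 sd sa.
have sT i : eqv (s i) (T (prefix w i)).
  elim: i => [|i IH]; first by rewrite s0; case: HT => -> _ _; case: b0P.
  by rewrite prefixS -(dB_step _ IH (gd_res _ _ HT)).
have [_ LT] := sres_cat (prefix w N) HT.
rewrite -(wcat_prefix w N) -LT.
have /choice[E HE] : forall i, exists e, N <= i -> exists e',
    [/\ img t e (s i), dg t.2 e (w i) e' & img t e' (s i.+1)].
  move=> i; have [/sa/existsP[e /existsP[e' /and3P[]]]|] := boolP (N <= i); last by exists q0.
  by exists e => _; exists e'.
have [e'N [iN _ _]] := HE N (leqnn _).
have [gN sN] := fam_shd (img_fam iN).
(* The members [E i] fit together only up to [peq], so the steps are redone from a member equivalent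
   to [E i]. *)
have nx i e : N <= i -> fam t e -> peq t.2 (E i) e ->
    exists e', [/\ dg t.2 e (w i) e', fam t e' & peq t.2 (E i.+1) e'].
  move=> Ni fe pe; have [e' [h1 h2 h3]] := HE i Ni.
  have [e'' [h4 _ _]] := HE i.+1 (leqW Ni).
  have [ge se] := fam_shd fe.
  have [|e1 d1 _] := @shd_next _ _ c0 _ HT _ _ (w i) ge se.
    apply: ple_wacc (proj1 (andP pe)) _; apply/existsP; exists e'; by rewrite (dg_G h2).
  exists e1; split=> //; first exact: fam_step d1.
  apply: peq_trans (peq_step c0 HT (img_fam h1) fe pe h2 d1).
  exact: img_inj h4 h3.
have /choice[f Hf] : forall z : nat * Q, exists e', N <= z.1 -> fam t z.2 -> peq t.2 (E z.1) z.2 ->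
    [/\ dg t.2 z.2 (w z.1) e', fam t e' & peq t.2 (E z.1.+1) e'].
  move=> [i e] /=; have [[h1 [h2 h3]]|h] := pselect (N <= i /\ fam t e /\ peq t.2 (E i) e).
    by have [e' h'] := nx _ _ h1 h2 h3; exists e'.
  by exists e => h1 h2 h3; case: h.
pose r := fix r j := if j is j'.+1 then f (N + j', r j') else E N.
have rP j : fam t (r j) /\ peq t.2 (E (N + j)) (r j).
  elim: j => [|j [h1 h2]]; first by rewrite addn0 (img_fam iN); split=> //; apply: peq_refl.
  by have [] := Hf (N + j, r j) (leq_addr _ _) h1 h2; rewrite addnS.
have wr : Lq (E N) (fun i => w (N + i)).
  apply: (@walk_Lq m A t.2 _ _ r) => // j; apply/G_sg/dg_G.
  by have [h1 h2] := rP j; have [] := Hf (N + j, r j) (leq_addr _ _) h1 h2.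
have h : eqv (E N) (T (prefix w N)) by apply: eqv_trans (sT N); apply: img_eqv iN.
by apply/((eqvP c0 HT gN (good_T _)).1 h).
Qed.

(** The candidates started after [i] letters that have been able to keep their promise on the rest
    of [u]. *)
Definition alive u i : {set (Q * C) * Q} :=
  [set z | [&& fam z.1 z.2, eqv z.2 (T (take i u)) & wacc (G z.1.2) z.2 (drop i u)]].
Definition oldest u := find (fun i => alive u i != set0) (iota 0 (size u).+1).
(** [pick] depends on the set only, so once the set of oldest candidates is stable, the same
    candidate is tracked forever. *)
Definition track u := [pick z in alive u (oldest u)].
Definition track_state u s := if track u is Some z then
  exists2 e, wrun (dg z.1.2) z.2 (drop (oldest u) u) e & img z.1 e s
  else s \in QB /\ eqv s (T u).

Lemma track_state_ex u : exists s, track_state u s.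
Proof.
rewrite /track_state /track; case: pickP => [[t e]|_].
  rewrite !inE /= => /and3P[fe he we]; have [ge se] := fam_shd fe.
  have [e' h'] := dg_run_ex c0 HT ge se we.
  have f' : fam t e'.
    case/famP: fe => mt [x hx]; apply/famP; split=> //; exists (x ++ drop (oldest u) u).
    by rewrite wrun_cat; apply/existsP; exists e; rewrite hx.
  by have [s hs] := img_ex f'; exists s, e'.
have gT := good_T u.
have [|s hs rs] := @rank_onto _ (fun p => eqv p (T u)) 0.
  by apply/card_gt0P; exists (T u); rewrite inE eqv_refl.
by exists s; split=> //; rewrite inE (eqv_goodl hs) /rk (eq_rank _ (eqv_l hs)) rs.
Qed.

Lemma track_state_spec u s : track_state u s -> s \in QB /\ eqv s (T u).
Proof.
rewrite /track_state /track; case: pickP => [[t e]|_] //.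
move=> /[1!inE] /= /and3P[fe he we] [e' h' hi]; split; first exact: img_QB hi.
rewrite eqv_sym; have := img_eqv hi; apply: eqv_trans.
rewrite eqv_sym; apply: (eqv_run c0 HT he); first exact: wrunG_gd (wrunD_G h').
suff run x y : wrun gd (T x) y (T (x ++ y)).
  by have := run (take (oldest u) u) (drop (oldest u) u); rewrite cat_take_drop.
elim/last_ind: y => [|y a IH]; first by rewrite cats0 /= eqxx.
rewrite wrun_rcons; apply/existsP; exists (T (x ++ y)); rewrite IH -rcons_cat.
exact: gd_res HT.
Qed.

(** The set of states reachable without [c] shrinks along the walk; once it is constant, every edge
    of the walk is recurrent. *)
Lemma wacc_reach_const c w (s : nat -> Q) N : (forall i, N <= i -> sg gd c (s i) (w i) (s i.+1)) ->
  exists2 M, N <= M & forall n, wacc (G c) (s M) (mkseq (fun i => w (M + i)) n).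
Proof.
move=> H; pose R i := [set r | connect (erel (sg gd c)) (s i) r].
have edge i : N <= i -> connect (erel (sg gd c)) (s i) (s i.+1).
  by move=> /H h; apply: connect1; apply/existsP; exists (w i).
have [|M NM st] := @decreasing_stable _ R N.
  move=> i Ni; apply/subsetP => r; rewrite !inE; apply: connect_trans; exact: edge.
exists M => // n; apply: (@wrun_wacc _ _ _ _ _ (s (M + n))).
elim: n => [|n IH]; first by rewrite addn0 /= eqxx.
rewrite mkseqS wrun_rcons; apply/existsP; exists (s (M + n)); rewrite IH /=.
rewrite addnS /G /rg H /=; last by lia.
have E : R (M + n).+1 = R (M + n) by rewrite !st //; lia.
have : s (M + n) \in R (M + n).+1 by rewrite E inE connect0.
by rewrite inE.
Qed.

(** The resolver of [A] finally moves along recurrent edges without some colour; a maximal pair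
    above its state reads the same words. *)
Lemma eternal_track w : Lq q0 w -> exists M t e, forall n, M <= n ->
  (t, e) \in alive (prefix w n) M.
Proof.
case: HT => _ _ h /h [c [N Hc]].
have [|M NM HM] := @wacc_reach_const c w (traj T w) N.
  by move=> i /Hc hc; rewrite /sg hc andbT /traj prefixS; apply: gd_res HT.
have gM := good_T (prefix w M).
have [t mt le] := max_above c0 HT (t := (traj T w M, c)) gM.
exists M, t, t.1 => n Mn; rewrite inE /= fam_self //.
have -> : take M (prefix w n) = prefix w M by rewrite /prefix /mkseq -map_take take_iota (minn_idPl Mn).
rewrite eqv_sym (ple_eqv le) /=.
have -> : drop M (prefix w n) = mkseq (fun i => w (M + i)) (n - M).
  rewrite /prefix /mkseq -map_drop drop_iota add0n -[X in iota X]addn0 iotaDl -map_comp.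
  by apply: eq_map => i /=.
by case: t le {mt} => q' c' le; apply: ple_wacc le _.
Qed.

Lemma alive_dec w i n : i <= n -> alive (prefix w n.+1) i \subset alive (prefix w n) i.
Proof.
move=> le; apply/subsetP => z; rewrite !inE prefixS => /and3P[-> h1 h2] /=.
move: h1 h2; rewrite -cats1 takel_cat ?size_prefix // => ->.
rewrite drop_cat size_prefix; case: ltnP => ni; first exact: wacc_prefix.
by rewrite (@drop_oversize _ i (prefix w n)) ?size_prefix.
Qed.

Lemma B_resolver : exists S : seq 'I_m -> Q, [/\ S [::] = b0, forall u, S u \in QB,
  forall u a, dB (S u) a (S (rcons u a)) &
  forall w, Lq q0 w -> exists t N, forall i, N <= i ->
     sB t (S (prefix w i)) (w i) (S (prefix w i.+1))].
Proof.
have /choice[S0 HS0] := track_state_ex.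
pose S u := if u is [::] then b0 else S0 u.
have SP u : S u \in QB /\ eqv (S u) (T u).
  case: u => [|a u]; first by case: b0P => ? ?; case: HT => -> _ _.
  exact: track_state_spec.
exists S; split=> // [u|u a|w Lw]; first by case: (SP u).
  have [_ h] := SP u; have [_ h'] := SP (rcons u a).
  by rewrite (dB_step _ h (gd_res _ _ HT)).
have [M0 [t0 [e0 alv]]] := eternal_track Lw.
have ex : exists M, `[< exists t e, forall n, M <= n -> (t, e) \in alive (prefix w n) M >].
  by exists M0; apply/asboolP; exists t0, e0.
(* [M] is the first starting time of an immortal candidate, so all candidates started earlier
   die. *)
case: (ex_minnP ex) => M /asboolP[t [e et]] min {ex M0 t0 e0 alv}.
have [K MK stK] := @decreasing_stable _ (fun n => alive (prefix w n) M) M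
  (fun n h => alive_dec w h).
have dead i : i < M -> exists2 n, i <= n & forall n', n <= n' -> alive (prefix w n') i = set0.
  move=> iM; have [n ni st] := @decreasing_stable _ (fun n => alive (prefix w n) i) i
    (fun n h => alive_dec w h).
  exists n => // n' nn'; rewrite st //; apply/eqP; apply: contraT => /set0Pn[[t' e'] h].
  have : M <= i.
    apply: min; apply/asboolP; exists t', e' => l il.
    have [nl|ln] := leqP n l; first by rewrite st.
    have : forall j, alive (prefix w (l + j)) i \subset alive (prefix w l) i.
      elim=> [|j IH]; first by rewrite addn0.
      by rewrite addnS; apply: subset_trans (alive_dec _ _) IH; lia.
    by move/(_ (n - l)); rewrite subnKC 1?ltnW // => /subsetP; apply.
  by rewrite leqNgt iM.
have [D HD] : exists D, forall i, i < M -> forall n, D <= n -> alive (prefix w n) i = set0.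
  suff : forall j, j <= M -> exists D, forall i, i < j -> forall n, D <= n ->
      alive (prefix w n) i = set0 by apply.
  elim=> [|j IH] jM; first by exists 0.
  have [D HD] := IH (ltnW jM); have [n _ Hn] := dead j jM.
  exists (maxn D n) => i; rewrite ltnS leq_eqVlt => /orP[/eqP ->|ij] n'; rewrite geq_max => /andP[h1 h2].
    exact: Hn.
  exact: HD.
(* After [K] the candidates started at [M] are constant, after [D] the earlier ones are dead; the
   successor makes the prefix nonempty, so that [S] is [S0] and not [b0]. *)
pose N := (maxn K D).+1.
have old n : N <= n -> oldest (prefix w n) = M.
  rewrite /N gtn_max => /andP[h1 h2].
  rewrite /oldest size_prefix.
  have -> : n.+1 = M + (n - M).+1 by lia.
  rewrite iotaD find_cat ifN ?size_iota; last first.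
    apply/hasPn => i; rewrite mem_iota /= add0n => iM.
    by rewrite (HD i iM n) ?eqxx //; lia.
  rewrite /= ifT ?addn0 //; apply/set0Pn; exists (t, e); apply: et; lia.
have trk n : N <= n -> track (prefix w n) = [pick z in alive (prefix w K) M].
  by move=> h; rewrite /track old // stK //; rewrite /N in h; lia.
have [[t1 e1] trE alv1] : exists2 z, [pick z in alive (prefix w K) M] = Some z &
    forall n, N <= n -> z \in alive (prefix w n) M.
  case: pickP => [z hz|no].
    by exists z => // n h; rewrite stK //; rewrite /N in h; lia.
  by have := no (t, e); rewrite et.
exists t1, N => i Ni.
have Si j : N <= j -> exists2 e, wrun (dg t1.2) e1 (drop M (prefix w j)) e & img t1 e (S (prefix w j)).
  move=> Nj; have := HS0 (prefix w j); rewrite /track_state trk // trE old //=.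
  by case: j Nj => // j _; rewrite prefixS /S; case: (prefix w j).
have [e2 r2 i2] := Si i Ni; have [e3 r3 i3] := Si i.+1 (leqW Ni).
have [ge2 se2] := fam_shd (img_fam i2).
have := alv1 i.+1 (leqW Ni); rewrite inE /= => /and3P[f1 _].
have dr : drop M (prefix w i.+1) = rcons (drop M (prefix w i)) (w i).
  rewrite prefixS -!cats1 drop_cat size_prefix; case: ltnP => // h; rewrite /N in Ni; lia.
rewrite dr => wa; have [ge1 se1] := fam_shd f1.
have [_ _ W2] := dg_run_spec c0 HT ge1 se1 r2.
(* The next state was chosen for some member [e3], while the transition needs a [dg] successor [e4]
   of [e2]. Both are reached by the same word, hence they are [peq] and share the image. *)
have [|e4 d4 _] := @shd_next _ _ c0 _ HT _ _ (w i) ge2 se2; first by rewrite W2 cats1.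
apply/existsP; exists e2; apply/existsP; exists e4; rewrite i2 d4 /=.
have f4 := fam_step (img_fam i2) d4.
apply: (img_peq i3 f4).
have r4 : wrun (dg t1.2) e1 (drop M (prefix w i.+1)) e4.
  by rewrite dr wrun_rcons; apply/existsP; exists e2; rewrite r2.
have [_ _ W3] := dg_run_spec c0 HT ge1 se1 r3.
have [_ _ W4] := dg_run_spec c0 HT ge1 se1 r4.
apply/(fam_peq c0 HT (img_fam i3) f4); split; last by move=> y; rewrite W3 W4.
exact: (eqv_run c0 HT (eqv_refl ge1) (wrunG_gd (wrunD_G r3)) (wrunG_gd (wrunD_G r4))).
Qed.

End MinAutomaton.

(** * The lower bound on the number of states *)

Section Minimality.
Variables (m : nat) (A : gcb m).
Notation Q := 'I_(nQ A).
Notation C := 'I_(nC A).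
Notation q0 := (qinit A).
Variables (c0 : C) (T : seq 'I_m -> Q).
Hypothesis HT : sres q0 T.
Variables (B : gcb m) (TB : seq 'I_m -> 'I_(nQ B)).
Hypothesis HB : sres (qinit B) TB.
Hypothesis LBA : forall w, Lq (qinit B) w <-> Lq q0 w.
Implicit Types (p q e s : Q) (c : C) (t : Q * C) (b : 'I_(nQ B)) (x y u : seq 'I_m).

(** On a common history both resolvers keep the same residual language, which ties each visited
    state of [B] to one language class of [A]. *)
Definition bclass q b := `[< exists u, TB u = b /\ eqv q (T u) >].

Lemma bclass_eqv q q' b : bclass q b -> bclass q' b -> eqv q q'.
Proof.
move=> /asboolP[u [<- h]] /asboolP[u' [E h']].
apply: (eqv_trans c0 HT h); rewrite eqv_sym; apply: (eqv_trans c0 HT h').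
apply/(eqvP c0 HT); try exact: (good_T HT).
move=> w; have [_ ->] := sres_cat u' HT; have [_ ->] := sres_cat u HT.
rewrite -!LBA; have [_ <-] := sres_cat u' HB; have [_ <-] := sres_cat u HB.
by rewrite E.
Qed.

Lemma bclass_ex q : good q -> exists b, bclass q b.
Proof.
by case/goodP=> u /(eqv_run_T c0 HT) h; exists (TB u); apply/asboolP; exists u.
Qed.

(* Capturing the loops of [t] in [B] and then those of the resulting state of [B] back in [A] is
   bounded by [t] again because [t] is maximal, so [B] must contain an exact copy of the family. *)
Lemma family_embeds t : tmax t -> (exists x, x <> [::] /\ wrun (sg gd t.2) t.1 x t.1) ->
  exists h : Q -> 'I_(nQ B), forall e, fam t e -> bclass e (h e) /\
    forall e', fam t e' -> h e = h e' -> forall x, wacc (G t.2) e x = wacc (G t.2) e' x.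
Proof.
case: t => q c mt /= lp; have gq := tmax_good mt; rewrite /= in gq.
have sq := max_shd c0 HT mt.
have /goodP[u hu] := gq; have [_ Lu] := gd_run_spec c0 HT hu.
have [HBu LBu] := sres_cat u HB.
(* First capture: after [u ++ z] the resolver of [B] reads the words of the promise [(q, c)] along
   recurrent edges without [d]. *)
have [|z [d [hz H1]]] := @recurrent_capture _ _ (sg gd c) q B (TB u) _ HBu _ gd
  (fun v a => gd_res v a HBu) lp.
  by move=> w s s0 wk; apply/LBu/LBA/Lu; apply: walk_Lq s0 wk.
have fB x y : wacc (G c) q (x ++ y) -> wrun (G d) (TB (u ++ (z ++ x))) y (TB (u ++ (z ++ (x ++ y)))).
  elim: y x => [|a y IH] x /=; first by rewrite cats0.
  rewrite -cat_rcons => h; apply/existsP; exists (TB (u ++ (z ++ rcons x a))); rewrite IH // andbT.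
  by rewrite -rcons_cat; apply: H1; apply: wacc_prefix h.
set s0 := TB (u ++ z).
have fB0 x : wacc (G c) q x -> wrun (G d) s0 x (TB (u ++ (z ++ x))).
  by move/(fB [::]); rewrite cats0.
(* The word of a loop at [q] is read in the recurrent part of [B] and can be completed to a loop at
   [s0], which can be captured in turn. *)
have lpB : exists x, x <> [::] /\ wrun (sg gd d) s0 x s0.
  have [x [xN hx]] := lp.
  have wx : wacc (G c) q x.
    case: x xN hx => // a x _ /existsP[r /andP[g1 h1]].
    have aux : forall y p, connect (erel (sg gd c)) q p -> wrun (sg gd c) p y q -> wacc (G c) p y.
      elim=> [//|b y' IH] p cp /= /existsP[p' /andP[g3 h3]]; apply/existsP; exists p'.
      rewrite /G /rg g3 /= IH //.
        by rewrite andbT; apply: connect_trans cp; apply/connect_wrunP; exists y'.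
      by apply: connect_trans cp _; apply: connect1; apply/existsP; exists b.
    apply: aux; first exact: connect0.
    by apply/existsP; exists r; rewrite g1.
  have := fB0 _ wx => hr; have /connect_wrunP[y hy] := rg_return hr.
  exists (x ++ y); split; first by case: (x) xN.
  rewrite wrun_cat; apply/existsP; exists (TB (u ++ (z ++ x))).
  by rewrite (sub_wrun (@G_sg _ _ d) hr).
have [HTz LTz] := sres_cat (u ++ z) HT; have [HBz LBz] := sres_cat (u ++ z) HB.
(* Second capture, back in [A]: the pair obtained is above [(q, c)], hence also below it by
   maximality. *)
have [|z' [d' [hz' H2]]] := @recurrent_capture _ _ (sg gd d) s0 A (T (u ++ z)) _ HTz _ gd
  (fun v a => gd_res v a HTz) lpB.
  by move=> w s e0 wk; apply/LTz/LBA/LBz; apply: walk_Lq e0 wk.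
have F : follow q c (T ((u ++ z) ++ z')) d'.
  exists (fun x => T ((u ++ z) ++ (z' ++ x))); split; first by rewrite cats0.
  by move=> x a /fB0/wrun_wacc/H2; rewrite rcons_cat.
have uz : wrun gd q0 (u ++ z) q.
  rewrite wrun_cat; apply/existsP; exists q; rewrite hu /=.
  by apply: sub_wrun hz => ? ? ? /andP[].
have E : eqv q (T ((u ++ z) ++ z')).
  apply/(eqvP c0 HT gq (good_T HT _)) => w.
  have [_ ->] := gd_run_spec c0 HT uz; have [_ ->] := sres_cat ((u ++ z) ++ z') HT.
  rewrite -!LBA.
  have h1 : wrun gd (qinit B) (u ++ z) s0 by exact: T_run HB _.
  have h2 : wrun gd (qinit B) ((u ++ z) ++ z') s0.
    rewrite wrun_cat; apply/existsP; exists s0; rewrite h1 /=.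
    by apply: sub_wrun hz' => ? ? ? /andP[].
  by have [_ <-] := gd_run_spec d HB h1; have [_ <-] := gd_run_spec d HB h2.
have le1 := follow_ple c0 HT E F.
have le2 : ple (T ((u ++ z) ++ z'), d') (q, c) by case/andP: mt => _ /forallP/(_ _)/implyP; apply.
(* So [s0] reads no more than [q]; by [fB0] both read the same words. *)
have W x : wacc (G d) s0 x -> wacc (G c) q x.
  move=> h; apply: ple_wacc le2 _.
  have aux : forall y x, wacc (G d) s0 (x ++ y) ->
      wrun (G d') (T ((u ++ z) ++ (z' ++ x))) y (T ((u ++ z) ++ (z' ++ (x ++ y)))).
    elim=> [|a y IH] x' /=; first by rewrite cats0.
    rewrite -cat_rcons => h'; apply/existsP; exists (T ((u ++ z) ++ (z' ++ rcons x' a))).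
    by rewrite IH // andbT -rcons_cat; apply: H2; apply: wacc_prefix h'.
  by have := aux x [::] h; rewrite cats0 => /wrun_wacc.
have /choice[xe Hxe] : forall e, exists x, fam (q, c) e -> wrun (dg c) q x e.
  move=> e; have [/famP[_ [x hx]]|] := boolP (fam (q, c) e); first by exists x.
  by exists [::].
(* The state of [B] after [xe e] reads exactly the words of [e], so members with different readable
   words go to different states. *)
have WE e y : fam (q, c) e -> wacc (G d) (TB (u ++ (z ++ xe e))) y = wacc (G c) e y.
  move=> /Hxe hx; have [_ _ ->] := dg_run_spec c0 HT gq sq hx; apply/idP/idP => h.
    apply: W; rewrite wacc_cat; apply/existsP; exists (TB (u ++ (z ++ xe e))).
    by rewrite h andbT; apply: fB0; apply: wrun_wacc (wrunD_G hx).
  exact: wrun_wacc (fB _ _ h).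
exists (fun e => TB (u ++ (z ++ xe e))) => e fe; split; last first.
  by move=> e' fe' h x; rewrite -!WE // h.
apply/asboolP; exists (u ++ (z ++ xe e)); split=> //; apply: (eqv_run_T c0 HT).
rewrite catA wrun_cat; apply/existsP; exists q; rewrite uz.
exact: wrunG_gd (wrunD_G (Hxe e fe)).
Qed.

(** The highest rank kept in a class bounds the number of its states, and it comes from a single
    family, whose representatives up to [e0] inject into [B]. *)
Lemma class_bound q : good q -> #|[set s in QB A | eqv s q]| <= #|[set b | bclass q b]|.
Proof.
move=> gq; case: (set_0Vmem [set s in QB A | eqv s q]) => [->|[s1 h1]]; first by rewrite cards0.
case: (@arg_maxnP _ s1 (fun s => s \in [set s in QB A | eqv s q]) (@rk _ A)) => // s.
rewrite inE => /andP[sQ sq] mx.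
have le : #|[set s in QB A | eqv s q]| <= (rk s).+1.
  apply: leq_trans (rank_below (fun p => eqv p q) _); apply: subset_leq_card.
  apply/subsetP => y hy; have := mx y hy; move: hy; rewrite !inE => /andP[_ yq] h.
  by rewrite yq ltnS; move: h; rewrite [rk y]/rk (eq_rank _ (eqv_l c0 HT yq)).
apply: leq_trans le _.
have [r0|rN] := eqVneq (rk s) 0.
  rewrite r0; apply/card_gt0P; have [b hb] := bclass_ex gq; by exists b; rewrite inE.
move: sQ; rewrite inE (negbTE rN) /= => /andP[_ /existsP[t /existsP[e /imgP]]].
case=> fe [e0 [re0 _ e0s rke]].
have mt : tmax t by case/famP: fe.
(* Without a loop the family is the single state [t.1], whose rank is 0. *)
have [lp|nl] := pselect (exists x, x <> [::] /\ wrun (sg gd t.2) t.1 x t.1); last first.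
  have one e1 : fam t e1 -> e1 = t.1.
    case/famP=> _ [x]; case/lastP: x => [/eqP //|x a] /wrunD_G/wrun_wacc.
    by rewrite (negbTE (no_loop_wacc _ _ nl)).
  case/eqP: rN; rewrite -rke; apply/eqP; rewrite cards_eq0; apply/eqP/setP => y; rewrite !inE.
  apply/negP => /and3P[lt /rep_fam/one ey _].
  by move: lt; rewrite ey (one _ (rep_fam re0)) ltnn.
have [h Hh] := family_embeds mt lp.
have e0q : eqv e0 q by apply: (eqv_trans c0 HT) sq.
pose R := [set e' : Q | [&& e' <= e0, rep t e' & eqv e' e0]].
have cR : (rk s).+1 = #|R|.
  rewrite -rke /rkf /rank (cardsD1 e0 R) !inE leqnn re0 (eqv_refl c0 HT (eqv_goodl e0s)) add1n.
  congr _.+1; apply: eq_card => y; rewrite !inE.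
  by rewrite ltn_neqAle -andbA.
rewrite cR -(@card_in_imset _ _ h).
  apply: subset_leq_card; apply/subsetP => _ /imsetP[e1 + ->].
  rewrite !inE => /and3P[_ r1 q1]; have [/asboolP[u [<- hu]] _] := Hh _ (rep_fam r1).
  apply/asboolP; exists u; split=> //; apply: (eqv_trans c0 HT) hu.
  by rewrite eqv_sym; apply: (eqv_trans c0 HT q1).
move=> e1 e2; rewrite !inE => /and3P[_ r1 q1] /and3P[_ r2 q2] E.
apply: (rep_uniq r1 r2); have [f1 f2] := (rep_fam r1, rep_fam r2).
apply/(fam_peq c0 HT f1 f2); split; last exact: (Hh _ f1).2.
by apply: (eqv_trans c0 HT q1); rewrite eqv_sym.
Qed.

(** The class bounds are summed over the states of rank 0, one per class; a state of [B] is counted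
    at most once, because it belongs to at most one class. *)
Lemma QB_bound : #|QB A| <= nQ B.
Proof.
pose P (r : Q) := good r && (rk r == 0).
pose cl s := odflt s [pick r | eqv s r && (rk r == 0)].
have clP s : good s -> P (cl s) /\ eqv s (cl s).
  move=> gs; rewrite /cl; case: pickP => [r /andP[h1 h2]|no] /=; first by rewrite /P h2 (eqv_goodr h1).
  have [|r hr rr] := @rank_onto _ (fun p => eqv p s) 0.
    by apply/card_gt0P; exists s; rewrite inE (eqv_refl c0 HT).
  by have := no r; rewrite eqv_sym hr /rk (eq_rank _ (eqv_l c0 HT hr)) rr.
have gQ s : s \in QB A -> good s by rewrite inE => /andP[].
rewrite -sum1_card (partition_big cl P) /=; last by move=> s /gQ/clP[].
apply: (@leq_trans (\sum_(r | P r) #|[set b | bclass r b]|)).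
  apply: leq_sum => r /andP[gr _]; rewrite sum1_card; apply: leq_trans (class_bound gr).
  apply: subset_leq_card; apply/subsetP => s; rewrite [in X in X -> _]unfold_in => /andP[hs /eqP <-].
  by rewrite inE hs; case: (clP s (gQ s hs)).
under eq_bigr => r _ do rewrite -sum1_card big_mkcond.
rewrite exchange_big -[X in _ <= X]card_ord -sum1_card; apply: leq_sum => b _.
rewrite -big_mkcondr sum1_card; apply/card_le1_eqP => r r'.
move=> /andP[/andP[g /eqP k] /[1!inE] h] /andP[/andP[g' /eqP k'] /[1!inE] h'].
by apply: (rk_inj c0 HT); rewrite ?k ?k' //; apply: bclass_eqv h' h.
Qed.

End Minimality.

(** * Language and history determinism of the constructed automaton *)

Section Correctness.
Variables (m : nat) (A : gcb m) (c0 : 'I_(nC A)) (T : seq 'I_m -> 'I_(nQ A)).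
Hypothesis HT : sres (qinit A) T.
Variable H : b0 A \in QB A.
Notation B := (mkB H).

Lemma mkB_sound w : Lq (qinit B) w -> Lq (qinit A) w.
Proof.
case=> s [s0 sr [c [N sc]]].
apply: (@B_sound _ _ c0 _ HT w (fun i => enum_val (s i)) (enum_val c) N).
- by rewrite s0 enum_rankK_in.
- by move=> i; have := sr i; rewrite inE.
- by move=> i /sc; rewrite inE negbK.
Qed.

Lemma mkB_res : exists TB, sres (qinit B) TB /\
  forall w, Lq (qinit A) w -> fin_col (A := B) w (traj (A := B) TB w).
Proof.
have [S [S0 SQ Sd Sa]] := B_resolver c0 HT.
pose TB u : 'I_(nQ B) := enum_rank_in H (S u).
have E u : enum_val (TB u) = S u by rewrite /TB enum_rankK_in.
have F w : Lq (qinit A) w -> fin_col (A := B) w (traj (A := B) TB w).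
  case/Sa=> t [N h]; exists (enum_rank t), N => i /h h'.
  by rewrite inE negbK /= /traj !E enum_rankK.
exists TB; split=> //; split=> [|u a|w /mkB_sound /F //]; first by rewrite /TB S0.
by rewrite inE /= !E.
Qed.

End Correctness.

Section DummyColour.
Variables (m : nat) (A : gcb m).

(* The extra colour guarantees that there is at least one. *)
Definition plus : gcb m := @GCB m (nQ A) (nC A).+1 (qinit A) (delta A)
  (fun t : trans_t (nQ A) m => [set c : 'I_(nC A).+1 |
     if insub (val c) is Some c' then (c' : 'I_(nC A)) \in col t else true]).

Lemma fin_col_plus w s : fin_col (A := plus) w s <-> fin_col (A := A) w s.
Proof.
split=> -[c [N h]].
  have := h N (leqnn _); rewrite inE; case: insubP => [c' _ e _|//].
  by exists c', N => i /h; rewrite inE -e valK.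
exists (widen_ord (leqnSn _) c), N => i /h; rewrite inE /=.
by rewrite -[X in insub X]/(val c) valK.
Qed.

Lemma Lq_plus q w : Lq (A := plus) q w <-> Lq (A := A) q w.
Proof. by split=> -[s [h1 h2 h3]]; exists s; split=> //; apply/fin_col_plus. Qed.

Lemma sres_plus q T : sres (A := A) q T -> sres (A := plus) q T.
Proof. by case=> h1 h2 h3; split=> // w /Lq_plus /h3 h; apply/fin_col_plus. Qed.

End DummyColour.

Theorem minimal_automaton m (A : gcb m) : history_deterministic A ->
  exists H : b0 (plus A) \in QB (plus A),
  [/\ history_deterministic (mkB H), forall w, accepts (mkB H) w <-> accepts A w
    & forall B' : gcb m, history_deterministic B' ->
        (forall w, accepts B' w <-> accepts A w) -> nQ (mkB H) <= nQ B'].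
Proof.
move=> hA; have [T /sres_plus HT] := hd_of_history_deterministic hA.
have c0 : 'I_(nC (plus A)) by exact: ord0.
have H : b0 (plus A) \in QB (plus A) by case: (b0P c0 HT).
(* A resolver has a value even on the empty word, so the alphabet is inhabited. *)
have [a0 _] : exists a : 'I_m, True by case: hA => sigma _; exists (sigma [::]).1.2.
have [TB [HB FB]] := mkB_res c0 HT H.
have L w : Lq (qinit (mkB H)) w <-> Lq (qinit (plus A)) w.
  split; first exact: (mkB_sound c0 HT).
  by move=> /FB f; apply/(sres_Lq w HB).
exists H; split.
- by apply: (history_deterministic_of_hd a0); exists TB.
- by move=> w; rewrite !acceptsE L; apply: Lq_plus.
- move=> B' /hd_of_history_deterministic[T' HT'] E.
  apply: (QB_bound c0 HT HT') => w; rewrite -acceptsE E acceptsE; apply: iff_sym; exact: Lq_plus.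
Qed.

(** * Turing machines for while programs *)

Definition fupd (X : eqType) Y (f : X -> Y) x y : X -> Y := fun z => if z == x then y else f z.

Lemma rev_map_iotaS X (f : nat -> X) h :
  rev [seq f i | i <- iota 0 h.+1] = f h :: rev [seq f i | i <- iota 0 h].
Proof. by rewrite -addn1 iotaD map_cat rev_cat. Qed.

Section WhilePrograms.
Variables (V : eqType) (cell : Type).

Record mst := Mst { ctr : V -> nat; arr : nat -> cell }.
Inductive test := TNZ of V | TCell of V & (cell -> bool).
Inductive wprog :=
| WSkip | WInc of V | WDec of V | WUpd of V & (cell -> cell) | WSeq of wprog & wprog
| WIf of test & wprog & wprog | WWhile of test & wprog.

Definition evalt t st := match t with
  | TNZ v => ctr st v != 0 | TCell v P => P (arr st (ctr st v)) end.
Definition sinc v st := Mst (fupd (ctr st) v (ctr st v).+1) (arr st).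
Definition sdec v st := Mst (fupd (ctr st) v (ctr st v).-1) (arr st).
Definition swr v f st :=
  Mst (ctr st) (fupd (arr st) (ctr st v) (f (arr st (ctr st v)))).

(** The costs are those of the compiled code: a true test adds the test itself and one jump, over
    the other branch or back to the test. *)
Inductive exec : wprog -> mst -> nat -> mst -> Prop :=
| ExSkip st : exec WSkip st 0 st
| ExInc v st : exec (WInc v) st 1 (sinc v st)
| ExDec v st : exec (WDec v) st 1 (sdec v st)
| ExUpd v f st : exec (WUpd v f) st 1 (swr v f st)
| ExSeq a b st n st' n' st'' : exec a st n st' -> exec b st' n' st'' ->
    exec (WSeq a b) st (n + n') st''
| ExIfT t a b st n st' : evalt t st -> exec a st n st' -> exec (WIf t a b) st (n.+1 + 1) st'
| ExIfF t a b st n st' : ~~ evalt t st -> exec b st n st' -> exec (WIf t a b) st n.+1 st'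
| ExWhF t a st : ~~ evalt t st -> exec (WWhile t a) st 1 st
| ExWhT t a st n st' n' st'' : evalt t st -> exec a st n st' ->
    exec (WWhile t a) st' n' st'' -> exec (WWhile t a) st ((n.+1 + 1) + n') st''.

End WhilePrograms.

Definition init_mst (V : eqType) (cell : Type) (dec : 'I_3 -> cell) (x : seq nat) : mst V cell :=
  Mst (fun=> 0) (fun j => dec (inord (nth 0 x j))).

Arguments TNZ {V} cell.
Arguments WSkip {V cell}.
Arguments WInc {V} cell.
Arguments WDec {V} cell.

Section RenameCounters.
Variables (V V' : eqType) (cell : Type) (f : V -> V').

Definition rtest (t : test V cell) : test V' cell :=
  match t with TNZ v => TNZ cell (f v) | TCell v P => TCell (f v) P end.
(** Programs are written with an infinite supply of counters, but tape cells carry finite sets of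
    marks; hence the counters in use are renamed injectively. *)
Fixpoint rename (s : wprog V cell) : wprog V' cell := match s with
  | WSkip => WSkip | WInc v => WInc cell (f v) | WDec v => WDec cell (f v)
  | WUpd v g => WUpd (f v) g
  | WSeq a b => WSeq (rename a) (rename b) | WIf t a b => WIf (rtest t) (rename a) (rename b)
  | WWhile t a => WWhile (rtest t) (rename a) end.

Variable D : pred V.
Definition tdom (t : test V cell) := match t with TNZ v => D v | TCell v _ => D v end.
Fixpoint wdom (s : wprog V cell) := match s with
  | WSkip => true | WInc v => D v | WDec v => D v | WUpd v _ => D v
  | WSeq a b => wdom a && wdom b | WIf t a b => [&& tdom t, wdom a & wdom b]
  | WWhile t a => tdom t && wdom a end.

Hypothesis f_inj : {in D &, injective f}.

Definition same_on_dom (st : mst V cell) (st' : mst V' cell) :=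
  arr st = arr st' /\ {in D, forall v, ctr st v = ctr st' (f v)}.

Lemma exec_rename s st n st' : exec s st n st' -> wdom s -> forall t, same_on_dom st t ->
  exists2 t', exec (rename s) t n t' & same_on_dom st' t'.
Proof.
have ev b st0 t0 : tdom b -> same_on_dom st0 t0 -> evalt (rtest b) t0 = evalt b st0.
  by case: b => [v|v P] /= Dv [e h]; rewrite -?e h.
have up st0 t0 v k : D v -> same_on_dom st0 t0 ->
    {in D, forall u, fupd (ctr st0) v k u = fupd (ctr t0) (f v) k (f u)}.
  by move=> Dv [_ h] u Du; rewrite /fupd (inj_in_eq f_inj) // h.
elim=> {s st n st'} /=.
- by move=> st _ t h; exists t => //; constructor.
- move=> v st Dv t h; exists (sinc (f v) t); first by constructor.
  by have [h1 h2] := h; split=> //= u Du; rewrite h2 // -(up st).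
- move=> v st Dv t h; exists (sdec (f v) t); first by constructor.
  by have [h1 h2] := h; split=> //= u Du; rewrite h2 // -(up st).
- move=> v g st Dv t h; exists (swr (f v) g t); first by constructor.
  by have [h1 h2] := h; split=> //=; rewrite h1 h2.
- move=> a b st n st' n' st'' _ IH1 _ IH2 /andP[/IH1 h1 /IH2 h2] t /h1[t1 e1 /h2[t2 e2 s2]].
  by exists t2 => //; econstructor; eassumption.
- move=> b s1 s2 st n st' et _ IH /and3P[Db /IH h1 _] t h; have [t1 e1 ?] := h1 _ h.
  by exists t1 => //; apply: ExIfT => //; rewrite (ev _ st).
- move=> b s1 s2 st n st' et _ IH /and3P[Db _ /IH h1] t h; have [t1 e1 ?] := h1 _ h.
  by exists t1 => //; apply: ExIfF => //; rewrite (ev _ st).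
- move=> b s1 st et /andP[Db _] t h; exists t => //; apply: ExWhF; by rewrite (ev _ st).
- move=> b s1 st n st' n' st'' et _ IH1 _ IH2 /andP[Db Ds] t h.
  have [t1 e1 h1] := IH1 Ds _ h; have [|t2 e2 h2] := IH2 _ _ h1; first by rewrite Db.
  by exists t2 => //; apply: ExWhT e1 e2; rewrite (ev _ st).
Qed.

End RenameCounters.

(** * Jump code and its simulation by a Turing machine *)

Section While.
Variables (V cell : finType).
Variable vO : V.
Notation test := (test V cell).
Notation wprog := (wprog V cell).
Notation mst := (mst V cell).

(** [IJmp] jumps when its test fails, so the constantly false test gives [IGoto]. *)
Inductive instr := IInc of V | IDec of V | IUpd of V & (cell -> cell) | IJmp of test & nat.
Definition IGoto := IJmp (TCell vO xpred0).

Definition tvar (t : test) := match t with TNZ v => v | TCell v _ => v end.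
Definition ivar i := match i with
  | IInc v => v | IDec v => v | IUpd v _ => v | IJmp t _ => tvar t end.
Definition itgt i := if i is IJmp _ l then l else 0.

Definition istep (code : seq instr) (c : nat * mst) : nat * mst :=
  let: (pc, st) := c in
  match nth (IGoto (size code)) code pc with
  | IInc v => (pc.+1, sinc v st)
  | IDec v => (pc.+1, sdec v st)
  | IUpd v f => (pc.+1, swr v f st)
  | IJmp t l => (if evalt t st then pc.+1 else l, st)
  end.

Fixpoint wlen (s : wprog) := match s with
  | WSkip => 0 | WInc _ => 1 | WDec _ => 1 | WUpd _ _ => 1 | WSeq a b => wlen a + wlen b
  | WIf _ a b => (wlen a).+2 + wlen b | WWhile _ a => (wlen a).+2 end.

Fixpoint comp (s : wprog) b := match s with
  | WSkip => [::] | WInc v => [:: IInc v] | WDec v => [:: IDec v] | WUpd v f => [:: IUpd v f]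
  | WSeq s1 s2 => comp s1 b ++ comp s2 (b + wlen s1)
  | WIf t s1 s2 => IJmp t (b + (wlen s1).+2) :: comp s1 b.+1 ++
       IGoto (b + ((wlen s1).+2 + wlen s2)) :: comp s2 (b + (wlen s1).+2)
  | WWhile t s1 => IJmp t (b + (wlen s1).+2) :: comp s1 b.+1 ++ [:: IGoto b]
  end.

Lemma size_comp s b : size (comp s b) = wlen s.
Proof.
elim: s b => //= [s1 IH1 s2 IH2|t s1 IH1 s2 IH2|t s1 IH1] b;
  rewrite ?size_cat /= ?size_cat /= ?IH1 ?IH2; lia.
Qed.

Lemma comp_tgt s b : all (fun i => itgt i <= b + wlen s) (comp s b).
Proof.
have sub l k k' : k <= k' -> all (fun i => itgt i <= k) l -> all (fun i => itgt i <= k') l.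
  by move=> h; apply: sub_all => i /= h'; apply: leq_trans h.
elim: s b => //= [s1 IH1 s2 IH2|t s1 IH1 s2 IH2|t s1 IH1] b.
- by rewrite all_cat addnA IH2 andbT; apply: sub (IH1 b); lia.
- rewrite all_cat /= leqnn /=; apply/and3P; split; first by lia.
    by apply: sub (IH1 _); lia.
  by apply: sub (IH2 _); lia.
- by rewrite all_cat /= leqnn leq_addr !andbT /=; apply: sub (IH1 _); lia.
Qed.

Definition code_at code b s := exists l r, code = l ++ comp s b ++ r /\ size l = b.

Lemma code_at_nth (code : seq instr) b l i r : code = l ++ i :: r -> size l = b ->
  forall d, nth d code b = i.
Proof. by move=> -> <- d; rewrite nth_cat ltnn subnn. Qed.

Lemma comp_sim code s st n st' : exec s st n st' -> forall b, code_at code b s ->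
  iter n (istep code) (b, st) = (b + wlen s, st').
Proof.
elim=> {s st n st'}.
- by move=> st b _; rewrite addn0.
- by move=> v st b [l [r [E sl]]]; rewrite /= (code_at_nth E sl) addn1.
- by move=> v st b [l [r [E sl]]]; rewrite /= (code_at_nth E sl) addn1.
- by move=> v f st b [l [r [E sl]]]; rewrite /= (code_at_nth E sl) addn1.
- move=> s1 s2 st n st' n' st'' _ IH1 _ IH2 b [l [r [E sl]]].
  rewrite addnC iterD IH1; last by exists l, (comp s2 (b + wlen s1) ++ r); rewrite E /= -?catA.
  rewrite IH2 ?addnA //; exists (l ++ comp s1 b), r.
  by rewrite E /= -?catA size_cat size_comp sl.
- move=> t s1 s2 st n st' et _ IH b [l [r [E sl]]].
  rewrite addn1 iterS iterSr /= (code_at_nth E sl) et IH.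
    have -> : b.+1 + wlen s1 = size (l ++ IJmp t (b + (wlen s1).+2) :: comp s1 b.+1).
      by rewrite size_cat /= size_comp; lia.
    rewrite /= (@code_at_nth code _ (l ++ IJmp t (b + (wlen s1).+2) :: comp s1 b.+1)
      (IGoto (b + ((wlen s1).+2 + wlen s2))) (comp s2 (b + (wlen s1).+2) ++ r)) //.
    by rewrite E /= -?catA /= -?catA.
  exists (rcons l (IJmp t (b + (wlen s1).+2))),
    (IGoto (b + ((wlen s1).+2 + wlen s2)) :: comp s2 (b + (wlen s1).+2) ++ r).
  by rewrite E /= cat_rcons size_rcons sl -catA.
- move=> t s1 s2 st n st' et _ IH b [l [r [E sl]]].
  rewrite iterSr /= (code_at_nth E sl) (negbTE et) IH ?addnA //.
  exists (l ++ IJmp t (b + (wlen s1).+2) :: comp s1 b.+1 ++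
    [:: IGoto (b + ((wlen s1).+2 + wlen s2))]), r.
  rewrite E /= -?catA /= -?catA; split=> //; rewrite size_cat /= size_cat size_comp /=; lia.
- by move=> t s1 st et b [l [r [E sl]]]; rewrite /= (code_at_nth E sl) (negbTE et).
- move=> t s1 st n st' n' st'' et _ IH1 _ IH2 b H; have [l [r [E sl]]] := H.
  rewrite [_ + n']addnC iterD addn1 iterS iterSr /= (code_at_nth E sl) et IH1.
    have -> : b.+1 + wlen s1 = size (l ++ IJmp t (b + (wlen s1).+2) :: comp s1 b.+1).
      by rewrite size_cat /= size_comp; lia.
    rewrite /= (@code_at_nth code _ (l ++ IJmp t (b + (wlen s1).+2) :: comp s1 b.+1)
      (IGoto b) r) //=; last by rewrite E /= -?catA /= -?catA.
    exact: IH2.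
  exists (rcons l (IJmp t (b + (wlen s1).+2))), (IGoto b :: r).
  by rewrite E /= cat_rcons size_rcons sl -catA.
Qed.

Variables (dec : 'I_3 -> cell) (enc : cell -> 'I_3) (code : seq instr).

(* A tape cell is either a raw input/output symbol or an array cell decorated with the set of
   counters pointing at it and a flag telling whether it is the leftmost cell. *)
Notation kcell := (cell * {set V} * bool)%type.
Notation sym := ('I_3 + kcell)%type.
Notation pcs := 'I_(size code).+1.
(* [inl (pc, 0/1/2)] = rewinding, seeking the counter of the instruction, putting its mark back;
   [inr 0/1/2] = converting the output to raw symbols, stepping back, halted; [None] = start. *)
Notation ctl := (pcs * 'I_3 + 'I_3)%type.

Definition view (g : sym) : kcell := match g with inl r => (dec r, set0, false) | inr k => k end.
Definition o0 : 'I_3 := inord 0.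
Definition o1 : 'I_3 := inord 1.
Definition o2 : 'I_3 := inord 2.

Definition evalk (t : test) (k : kcell) := match t with TNZ _ => ~~ k.2 | TCell _ P => P k.1.1 end.

(** An instruction is executed at the mark of its counter; elsewhere the head moves right to find
    it. A mark is moved by erasing it here and setting it on the neighbouring cell in phase [o2]. On
    the flagged cell a decrement does nothing, like truncated subtraction. At the end of the code
    the cell of [vO] is blanked and so delimits the output. *)
Definition act (pc : pcs) (g : sym) : option (option ctl * sym * bool) :=
  let k := view g in
  if pc < size code then
    let i := nth (IGoto 0) code pc in
    if ivar i \in k.1.2 then
      match i with
      | IInc v => Some (Some (inl (pc, o2)), inr (k.1.1, k.1.2 :\ v, k.2), true)
      | IDec v => if k.2 then Some (Some (inl (inord pc.+1, o0)), g, true)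
                  else Some (Some (inl (pc, o2)), inr (k.1.1, k.1.2 :\ v, k.2), false)
      | IUpd v f => Some (Some (inl (inord pc.+1, o0)), inr (f k.1.1, k.1.2, k.2), true)
      | IJmp t l => Some (Some (inl (inord (if evalk t k then pc.+1 else l), o0)), g, true)
      end
    else Some (Some (inl (pc, o1)), g, true)
  else if vO \in k.1.2 then Some (Some (inr (if k.2 then o1 else o0)), inl o0, false)
  else Some (Some (inl (pc, o1)), g, true).

(** The first step flags cell 0 and puts all marks on it, as all counters start at zero. Every step
    moves the head, so to halt on cell 0 it goes one cell beyond and returns. *)
Definition tdelta (s : option ctl) (g : sym) : option (option ctl * sym * bool) :=
  let k := view g in
  match s with
  | None => Some (Some (inl (inord 0, o0)), inr (k.1.1, setT, true), true)
  | Some (inl (pc, ph)) =>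
      if ph == o0 then (if k.2 then act pc g else Some (Some (inl (pc, o0)), g, false))
      else if ph == o1 then act pc g
      else Some (Some (inl (inord pc.+1, o0)),
             inr (k.1.1, ivar (nth (IGoto 0) code pc) |: k.1.2, k.2), true)
  | Some (inr ph) =>
      if ph == o0 then Some (Some (inr (if k.2 then o1 else o0)), inl (enc k.1.1), false)
      else if ph == o1 then Some (Some (inr o2), inl o0, true)
      else None
  end.

Local Arguments tdelta : simpl never.

Definition stenc (s : option ctl) : 'I_(#|{: ctl}|.+1) :=
  if s is Some x then lift ord0 (enum_rank x) else ord0.
Definition stdec (i : 'I_(#|{: ctl}|.+1)) : option ctl :=
  if unlift ord0 i is Some j then Some (enum_val j) else None.
(** Raw symbols keep the numbers 0, 1, 2 that the input and output conventions prescribe. *)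
Definition genc (g : sym) : 'I_(#|{: kcell}|.+3) :=
  match g with inl r => lshift #|{: kcell}| r | inr k => rshift 3 (enum_rank k) end.
Definition gdec (i : 'I_(#|{: kcell}|.+3)) : sym :=
  match split (i : 'I_(3 + #|{: kcell}|)) with inl r => inl r | inr j => inr (enum_val j) end.

Lemma stencK s : stdec (stenc s) = s.
Proof. by case: s => [x|]; rewrite /stdec /stenc ?liftK ?enum_rankK // unlift_none. Qed.

Lemma gencK g : gdec (genc g) = g.
Proof.
rewrite /gdec; case: g => [r|k] /=.
  by have -> : split (lshift #|{: kcell}| r) = inl r by exact: (unsplitK (inl r)).
have -> : split (rshift 3 (enum_rank k)) = inr (enum_rank k) by exact: (unsplitK (inr _)).
by rewrite enum_rankK.
Qed.

Definition machine : TM := @MkTM #|{: ctl}| #|{: kcell}| (fun s g =>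
  if tdelta (stdec s) (gdec g) is Some (s', g', b) then Some (stenc s', genc g', b) else None).

Lemma genc_blank : genc (inl o0) = blank machine.
Proof. by apply: val_inj => /=; rewrite /o0 inordK. Qed.

Lemma step_machine s L R g s' g' b : head (blank machine) R = genc g ->
  tdelta s g = Some (s', g', b) ->
  step (M := machine) (stenc s, L, R) = if b then (stenc s', genc g' :: L, behead R)
    else (stenc s', behead L, head (blank machine) L :: genc g' :: behead R).
Proof. by move=> h d; rewrite /step /= h stencK gencK d; case: b {d}. Qed.

Definition cfg s (T : nat -> sym) h (c : config machine) :=
  [/\ c.1.1 = stenc s, c.1.2 = rev [seq genc (T i) | i <- iota 0 h]
    & forall j, nth (blank machine) c.2 j = genc (T (h + j))].

Lemma cfg_right s T h c s' g' : cfg s T h c -> tdelta s (T h) = Some (s', g', true) ->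
  cfg s' (fupd T h g') h.+1 (step c).
Proof.
case: c => [[q L] R] [/= -> -> HR] d.
have h0 : head (blank machine) R = genc (T h) by rewrite -nth0 HR addn0.
rewrite h0 stencK gencK d; split=> //.
  rewrite rev_map_iotaS [LHS]/= /fupd eqxx; congr (_ :: rev _).
  apply/eq_in_map => i; rewrite mem_iota add0n => /andP[_ lt]; by rewrite ifF //; apply/eqP; lia.
by move=> j; rewrite [LHS]nth_behead HR /fupd ifF ?addnS ?addSn //; apply/eqP; lia.
Qed.

Lemma cfg_left s T h c s' g' : cfg s T h.+1 c -> tdelta s (T h.+1) = Some (s', g', false) ->
  cfg s' (fupd T h.+1 g') h (step c).
Proof.
case: c => [[q L] R] [/= -> -> HR] d.
have h0 : head (blank machine) R = genc (T h.+1) by rewrite -nth0 HR addn0.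
rewrite h0 stencK gencK d rev_map_iotaS; split=> //.
  congr rev.
  apply/eq_in_map => i; rewrite mem_iota add0n => /andP[_ lt]; by rewrite /fupd ifF //; apply/eqP; lia.
case=> [|[|j]] /=.
- rewrite addn0 /fupd ifF //; apply/eqP; lia.
- by rewrite addn1 /fupd eqxx.
- rewrite nth_behead HR /fupd ifF ?addSnnS //; apply/eqP; lia.
Qed.

Definition inv (T : nat -> sym) st :=
  forall j, view (T j) = (arr st j, [set v | ctr st v == j], j == 0).

Lemma inv_fupd T st j g st' : inv T st ->
  view g = (arr st' j, [set v | ctr st' v == j], j == 0) ->
  (forall i, i != j -> arr st' i = arr st i /\ forall v, (ctr st' v == i) = (ctr st v == i)) ->
  inv (fupd T j g) st'.
Proof.
move=> iT vg H i; rewrite /fupd; case: eqVneq => [-> //|/H[-> h]].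
by rewrite iT; congr (_, _, _); apply/setP => v; rewrite !inE h.
Qed.

Lemma inv_id T st j : inv T st -> inv (fupd T j (T j)) st.
Proof. by move=> iT; apply: inv_fupd. Qed.

(** The head rewinds to the flagged cell and then walks right to the mark. If the mark is on the
    flagged cell the phase is still [o0], hence the existential [ph]. *)
Lemma seek pc v T st h c : cfg (Some (inl (pc, o0))) T h c -> inv T st ->
  (forall g, v \notin (view g).1.2 -> act pc g = Some (Some (inl (pc, o1)), g, true)) ->
  exists k ph T', [/\ k <= h + ctr st v, cfg (Some (inl (pc, ph))) T' (ctr st v) (run_steps k c),
    inv T' st & tdelta (Some (inl (pc, ph))) (T' (ctr st v)) = act pc (T' (ctr st v))].
Proof.
move=> Hc iT Ha.
have o10 : (o1 == o0) = false by apply/eqP => /(congr1 val); rewrite /= !inordK.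
have [k1 [T1 [lek1 Hc1 iT1]]] : exists k T', [/\ k <= h, cfg (Some (inl (pc, o0))) T' 0 (run_steps k c)
    & inv T' st].
  elim: h T c Hc iT => [|h IH] T c Hc iT; first by exists 0, T.
  have d : tdelta (Some (inl (pc, o0))) (T h.+1) = Some (Some (inl (pc, o0)), T h.+1, false).
    by rewrite /tdelta eqxx iT.
  have [k [T' [h1 h2 h3]]] := IH _ _ (cfg_left Hc d) (inv_id _ iT).
  by exists k.+1, T'; rewrite /run_steps iterSr.
have : forall j, j <= ctr st v -> exists k ph T', [/\ k <= j,
   cfg (Some (inl (pc, ph))) T' j (run_steps k (run_steps k1 c)), inv T' st &
   tdelta (Some (inl (pc, ph))) (T' j) = act pc (T' j)].
  elim=> [_|j IH jv].
    by exists 0, o0, T1; split=> //; rewrite /tdelta eqxx iT1.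
  have [|k [ph [T' [h1 h2 h3 h4]]]] := IH; first by lia.
  have d : tdelta (Some (inl (pc, ph))) (T' j) = Some (Some (inl (pc, o1)), T' j, true).
    rewrite h4 Ha // h3 inE /=; apply/negP; lia.
  exists k.+1, o1, (fupd T' j (T' j)); split=> //.
  - exact: cfg_right h2 d.
  - exact: inv_id.
  - by rewrite /tdelta o10 eqxx.
case/(_ _ (leqnn _)) => k [ph [T' [h1 h2 h3 h4]]].
exists (k + k1), ph, T'; split=> //; first by lia.
by rewrite /run_steps iterD.
Qed.

Hypothesis tgt_ok : all (fun i => itgt i <= size code) code.

(** A rewind, a walk to the mark and at most two further steps; the bound on counters and head grows
    by one. *)
Lemma instr_sim (pc : pcs) st T h c B : pc < size code ->
  cfg (Some (inl (pc, o0))) T h c -> inv T st -> h <= B + 2 -> (forall v, ctr st v <= B) ->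
  exists k T' h', [/\ k <= 2 * B + 4,
    cfg (Some (inl (inord (istep code (pc : nat, st)).1, o0))) T' h' (run_steps k c),
    inv T' (istep code (pc : nat, st)).2, h' <= B.+1 + 2 &
    (istep code (pc : nat, st)).1 <= size code /\
    forall v, ctr (istep code (pc : nat, st)).2 v <= B.+1].
Proof.
move=> lt Hc iT hB cB.
have o20 : (o2 == o0) = false by apply/eqP => /(congr1 val); rewrite /= !inordK.
have o21 : (o2 == o1) = false by apply/eqP => /(congr1 val); rewrite /= !inordK.
pose i := nth (IGoto 0) code pc.
have Ei d : nth d code pc = i by apply: set_nth_default.
have [|k [ph [T1 [lek Hc1 iT1 d1]]]] := @seek pc (ivar i) T st h c Hc iT.
  by move=> g hg; rewrite /act lt -/i (negbTE hg).
have vT : view (T1 (ctr st (ivar i))) = (arr st (ctr st (ivar i)),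
   [set v | ctr st v == ctr st (ivar i)], ctr st (ivar i) == 0) by exact: iT1.
have ti : itgt i <= size code by apply: (all_nthP (IGoto 0) tgt_ok).
have kB : k <= 2 * B + 2 by have := cB (ivar i); lia.
have cB' v : ctr st v <= B.+1 by have := cB v; lia.
move: d1; rewrite /act lt -/i vT /= inE eqxx => d1; rewrite Ei.
have mv v u n : (u == v) = false -> forall j, (fupd (ctr st) v n u == j) = (ctr st u == j).
  by rewrite /fupd => ->.
have bump v n : n <= B.+1 -> forall u, fupd (ctr st) v n u <= B.+1.
  by move=> hn u; rewrite /fupd; case: ifP.
case Ii: i d1 Hc1 iT1 ti vT lek => [v|v|v f|t l] /= d1 Hc1 iT1 ti vT lek.
- have Hc2 := cfg_right Hc1 d1.
  set T2 := fupd _ _ _ in Hc2.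
  have T2v : view (T2 (ctr st v).+1) = (arr st (ctr st v).+1, [set u | ctr st u == (ctr st v).+1], false).
    rewrite /T2 /fupd ifF; last by apply/eqP; lia.
    exact: iT1.
  have d2 : tdelta (Some (inl (pc, o2))) (T2 (ctr st v).+1) = Some (Some (inl (inord pc.+1, o0)),
     inr (arr st (ctr st v).+1, v |: [set u | ctr st u == (ctr st v).+1], false), true).
    by rewrite /tdelta o20 o21 -/i Ii T2v.
  exists k.+2; eexists; exists (ctr st v).+2; split; last (split=> //).
  + by lia.
  + exact: cfg_right Hc2 d2.
  + move=> j /=; rewrite /T2 /fupd; case: eqVneq => [->|nj].
      rewrite /=; congr (_, _, _); apply/setP => u; rewrite !inE; case: (eqVneq u v) => //= _.
      by rewrite eqxx.
    case: eqVneq => [->|nj'].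
      rewrite /=; congr (_, _, _); apply/setP => u; rewrite !inE; case: (eqVneq u v) => //= _.
      by apply/esym/eqP; lia.
    rewrite iT1; congr (_, _, _); apply/setP => u; rewrite !inE; case: (eqVneq u v) => //= ->.
    by rewrite eq_sym (negbTE nj') eq_sym (negbTE nj).
  + by have := cB v; lia.
  + by apply: bump; have := cB v; lia.
- case: (eqVneq (ctr st v) 0) d1 => [z|nz] d1.
    exists k.+1; eexists; exists (ctr st v).+1; split; last (split=> //).
    + by lia.
    + exact: cfg_right Hc1 d1.
    + have -> : sdec v st = st.
        rewrite /sdec z /=; case: (st) z => ct ar /= z; congr Mst.
        by apply: functional_extensionality_dep => u; rewrite /fupd; case: eqVneq => // ->.
      exact: inv_id.
    + by lia.
    + by apply: bump; have := cB v; lia.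
  case cv: (ctr st v) nz d1 Hc1 vT lek => [//|p] _ d1 Hc1 vT lek.
  have Hc2 := cfg_left Hc1 d1.
  set T2 := fupd _ _ _ in Hc2.
  have T2v : view (T2 p) = (arr st p, [set u | ctr st u == p], p == 0).
    rewrite /T2 /fupd ifF; last by apply/eqP; lia.
    exact: iT1.
  have d2 : tdelta (Some (inl (pc, o2))) (T2 p) = Some (Some (inl (inord pc.+1, o0)),
     inr (arr st p, v |: [set u | ctr st u == p], p == 0), true).
    by rewrite /tdelta o20 o21 -/i Ii T2v.
  exists k.+2; eexists; exists p.+1; split; last (split=> //).
  + by lia.
  + exact: cfg_right Hc2 d2.
  + move=> j /=; rewrite /T2 /fupd; case: eqVneq => [->|nj].
      rewrite /=; congr (_, _, _); apply/setP => u; rewrite !inE; case: (eqVneq u v) => //= _.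
      by rewrite cv /= eqxx.
    case: eqVneq => [->|nj'].
      rewrite /=; congr (_, _, _); apply/setP => u; rewrite !inE; case: (eqVneq u v) => //= _.
      by rewrite cv; apply/esym/eqP; lia.
    rewrite iT1; congr (_, _, _); apply/setP => u; rewrite !inE; case: (eqVneq u v) => //= ->.
    by rewrite cv eq_sym (negbTE nj') eq_sym (negbTE nj).
  + by have := cB v; lia.
  + by apply: bump; have := cB v; lia.
- exists k.+1; eexists; exists (ctr st v).+1; split; last (split=> //).
  + by lia.
  + exact: cfg_right Hc1 d1.
  + apply: inv_fupd => //=; first by rewrite /fupd eqxx.
    by move=> j nj; rewrite /fupd (negbTE nj).
  + by have := cB v; lia.
- have ev : evalk t (arr st (ctr st (tvar t)), [set u | ctr st u == ctr st (tvar t)],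
     ctr st (tvar t) == 0) = evalt t st by case: (t).
  rewrite ev in d1.
  exists k.+1; eexists; exists (ctr st (tvar t)).+1; split; last (split=> //).
  + by lia.
  + exact: cfg_right Hc1 d1.
  + exact: inv_id.
  + by have := cB (tvar t); lia.
  + by case: ifP.
Qed.

Lemma code_sim n pc st T h c B : (pc : nat) <= size code ->
  (forall i, i < n -> (iter i (istep code) (pc, st)).1 < size code) ->
  cfg (Some (inl (inord pc, o0))) T h c -> inv T st -> h <= B + 2 -> (forall v, ctr st v <= B) ->
  exists k T' h', [/\ k <= n * (2 * (B + n) + 4),
    cfg (Some (inl (inord (iter n (istep code) (pc, st)).1, o0))) T' h' (run_steps k c),
    inv T' (iter n (istep code) (pc, st)).2, h' <= B + n + 2 &
    forall v, ctr (iter n (istep code) (pc, st)).2 v <= B + n].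
Proof.
elim: n pc st T h c B => [|n IH] pc st T h c B lepc lt Hc iT hB cB.
  by exists 0, T, h; rewrite addn0.
have p0 := lt 0 isT; rewrite /= in p0.
have E : (inord pc : pcs) = pc :> nat by rewrite inordK.
have [|k [T1 [h1 [lek Hc1 iT1 hB1 [tg cB1]]]]] := @instr_sim (inord pc) st T h c B _ Hc iT hB cB.
  by rewrite E.
rewrite E in Hc1 iT1 tg cB1.
have [|k2 [T2 [h2 [lek2 Hc2 iT2 hB2 cB2]]]] :=
  IH (istep code (pc, st)).1 (istep code (pc, st)).2 T1 h1 _ B.+1 tg _ Hc1 iT1 hB1 cB1.
  by move=> i lti; rewrite -surjective_pairing -iterSr; apply: lt.
rewrite -surjective_pairing -iterSr in Hc2 iT2 cB2.
exists (k2 + k), T2, h2; split=> //.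
- by nia.
- by rewrite /run_steps iterD.
- by lia.
- by move=> v; have := cB2 v; lia.
Qed.

Lemma clean_sim st T h c : cfg (Some (inr o0)) T h c ->
  (forall j, j <= h -> view (T j) = (arr st j, [set v | ctr st v == j], j == 0)) ->
  exists R, run_steps h.+2 c = (stenc (Some (inr o2)), [:: blank machine], R) /\
   forall j, nth (blank machine) R j = genc (if j <= h then inl (enc (arr st j)) else T j).
Proof.
have o10 : (o1 == o0) = false by apply/eqP => /(congr1 val); rewrite /= !inordK.
elim: h T c => [|h IH] T c Hc iT.
  have d : tdelta (Some (inr o0)) (T 0) = Some (Some (inr o1), inl (enc (arr st 0)), false).
    by rewrite /tdelta eqxx iT.
  case: c Hc => [[q L] R] [e1 e2 HR]; rewrite /= in e1 e2 HR; rewrite {}e1 {}e2.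
  have h0 : head (blank machine) R = genc (T 0) by rewrite -nth0 HR addn0.
  have d1 : tdelta (Some (inr o1)) (inl o0) = Some (Some (inr o2), inl o0, true).
    by rewrite /tdelta o10 eqxx.
  rewrite -[run_steps 2 _]/(step (step _)) (step_machine _ h0 d).
  rewrite (@step_machine _ _ _ (inl o0) _ _ _ _ d1) ?genc_blank //=.
  exists (genc (inl (enc (arr st 0))) :: behead R); split=> //.
  by case=> [|j] //=; rewrite nth_behead HR.
have d : tdelta (Some (inr o0)) (T h.+1) = Some (Some (inr o0), inl (enc (arr st h.+1)), false).
  by rewrite /tdelta eqxx iT.
have Hc1 := cfg_left Hc d.
have [|R [E HR]] := IH _ _ Hc1.
  by move=> j jh; rewrite /fupd ifF ?iT //; [lia|apply/eqP; lia].
exists R; split; first by rewrite -E /run_steps -iterSr.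
move=> j; rewrite HR; congr genc; rewrite /fupd; case: (eqVneq j h.+1) => [->|nj].
  by rewrite ltnn leqnn.
by rewrite [j <= h.+1]leq_eqVlt (negbTE nj) ltnS.
Qed.

(** All counters stay at most [n], so the instructions take at most [n * (2 * n + 4)] steps; the
    last search and the conversion of the output are linear, and 40 is a generous constant. *)
Lemma machine_correct x n st' : all (fun a => a < 3) x ->
  (forall i, i < n -> (iter i (istep code) (0, init_mst V dec x)).1 < size code) ->
  iter n (istep code) (0, init_mst V dec x) = (size code, st') ->
  (forall j, j < ctr st' vO -> enc (arr st' j) != o0) ->
  forall t, 40 * n.+1 ^ 2 <= t ->
  computes_within machine x t [seq nat_of_ord (enc (arr st' j)) | j <- iota 0 (ctr st' vO)].
Proof.
move=> xs lt E nz t tB.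
have o20 : (o2 == o0) = false by apply/eqP => /(congr1 val); rewrite /= !inordK.
have o21 : (o2 == o1) = false by apply/eqP => /(congr1 val); rewrite /= !inordK.
pose T0 j : sym := inl (inord (nth 0 x j)).
have c0 : cfg None T0 0 (init_config machine x).
  split=> // j; rewrite add0n /init_config /T0 /=; apply: val_inj; rewrite /=.
  have [lj|gj] := ltnP j (size x).
    rewrite (nth_map 0) //; have := all_nthP 0 xs j lj => a3.
    by rewrite !inordK //; apply: leq_trans a3 _.
  by rewrite !nth_default ?size_map //= inordK.
have d0 : tdelta None (T0 0) = Some (Some (inl (inord 0, o0)), inr (dec (inord (nth 0 x 0)), setT, true), true).
  by [].
have c1 := cfg_right c0 d0.
have i1 : inv (fupd T0 0 (inr (dec (inord (nth 0 x 0)), setT, true))) (init_mst V dec x).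
  move=> [|j]; rewrite /fupd /=; first by congr (_, _, _); apply/setP => v; rewrite !inE.
  by congr (_, _, _); apply/setP => v; rewrite !inE.
have [|k [T1 [h1 [lek Hc1 iT1 hB1 cB1]]]] :=
  @code_sim n 0 (init_mst V dec x) _ 1 _ 0 (leq0n _) lt c1 i1 isT; first by [].
rewrite E /= in Hc1 iT1 cB1; rewrite !add0n in lek hB1 cB1.
set pcN := inord (size code) in Hc1.
have pE : (pcN : nat) = size code by rewrite inordK.
have [|k2 [ph [T2 [lek2 Hc2 iT2 d2]]]] := @seek pcN vO T1 st' h1 _ Hc1 iT1.
  by move=> g hg; rewrite /act pE ltnn (negbTE hg).
move: d2; rewrite /act pE ltnn iT2 /= inE eqxx => d2.
have fin R : (forall j, nth (blank machine) R j =
      genc (if j < ctr st' vO then inl (enc (arr st' j)) else if j == ctr st' vO then inl o0 else T2 j)) ->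
    [seq nat_of_ord g | g <- take (find (fun g => g == blank machine) R) R]
      = [seq nat_of_ord (enc (arr st' j)) | j <- iota 0 (ctr st' vO)].
  move=> HR; set N := ctr st' vO in HR *.
  have nb j : j < N -> nth (blank machine) R j != blank machine.
    move=> jN; rewrite HR jN -genc_blank; apply: contra_neq (nz j jN) => e.
    by move: (congr1 gdec e); rewrite !gencK => -[].
  have bN : nth (blank machine) R N = blank machine by rewrite HR ltnn eqxx genc_blank.
  have szR : N <= size R.
    rewrite leqNgt; apply/negP => szN.
    by have := nb _ szN; rewrite nth_default ?eqxx.
  have fN : find (fun g => g == blank machine) R = N.
    apply/eqP; rewrite eqn_leq; apply/andP; split.
      rewrite leqNgt; apply/negP => /(before_find (blank machine)); by rewrite bN eqxx.
    rewrite leqNgt; apply/negP => fl.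
    have hs : has (fun g => g == blank machine) R by rewrite has_find; apply: leq_trans szR.
    by have := nth_find (blank machine) hs; rewrite (negbTE (nb _ fl)).
  rewrite fN; apply: (@eq_from_nth _ 0); rewrite !size_map size_takel ?size_iota //.
  move=> j jN; rewrite (nth_map (blank machine)) ?size_takel // nth_take // HR jN.
  by rewrite (nth_map 0) ?size_iota // nth_iota.
have done_ k3 R Lf : k3 <= 40 * n.+1 ^ 2 ->
    run_steps k3 (init_config machine x) = (stenc (Some (inr o2)), Lf, R) ->
    (forall j, nth (blank machine) R j =
      genc (if j < ctr st' vO then inl (enc (arr st' j)) else if j == ctr st' vO then inl o0 else T2 j)) ->
    computes_within machine x t [seq nat_of_ord (enc (arr st' j)) | j <- iota 0 (ctr st' vO)].
  move=> k3B E3 HR.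
  have hd g : tm_delta (t := machine) (stenc (Some (inr o2))) g = None.
    by rewrite /tm_delta /machine stencK /tdelta o20 o21.
  have Ef : run_steps t (init_config machine x) = (stenc (Some (inr o2)), Lf, R).
    rewrite -(subnK (leq_trans k3B tB)) /run_steps iterD; move: E3; rewrite /run_steps => ->.
    by rewrite iter_fix // /step hd.
  by split; rewrite Ef /halted /output ?hd //; apply: fin.
have cO := cB1 vO.
(* For an empty output the cell of [vO] is the flagged one, and no cell is converted. *)
case cv: (ctr st' vO) d2 Hc2 lek2 cO done_ => [|p] d2 Hc2 lek2 cO done_.
  have [a2 b2 r2] := Hc2.
  case e2: (run_steps k2 _) a2 b2 r2 => [[q L] R] e3 e4 r2; rewrite /= in e3 e4 r2; rewrite {}e3 {}e4 in e2.
  have h0 : head (blank machine) R = genc (T2 0) by rewrite -nth0 r2 addn0.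
  have o10 : (o1 == o0) = false by apply/eqP => /(congr1 val); rewrite /= !inordK.
  apply: (done_ (2 + (k2 + (k + 1))) (genc (inl o0) :: behead R) [:: blank machine]).
  - by nia.
  - rewrite /run_steps iterD iterD iterD -/(run_steps _ _); move: e2; rewrite /run_steps => ->.
    have d3 : tdelta (Some (inr o1)) (inl o0) = Some (Some (inr o2), inl o0, true).
      by rewrite /tdelta o10 eqxx.
    rewrite -[iter 2 _ _]/(step (step _)) (step_machine _ h0 d2).
    by rewrite (@step_machine _ _ _ (inl o0) _ _ _ _ d3) ?genc_blank.
  - by case=> [|j] //=; rewrite nth_behead r2.
rewrite /= in d2.
have Hc3 := cfg_left Hc2 d2.
have [|R [E3 HR]] := clean_sim (st := st') Hc3.
  by move=> j jp; rewrite /fupd ifF ?iT2 //; apply/eqP; lia.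
apply: (done_ (p.+2 + (1 + (k2 + (k + 1)))) R [:: blank machine]).
- by nia.
- rewrite -E3 /run_steps; by do 4 rewrite iterD.
- move=> j; rewrite HR /fupd ltnS; by case: (j <= p).
Qed.

End While.

Theorem while_machine (V cell : finType) (vO : V) (dec : 'I_3 -> cell) (enc : cell -> 'I_3)
  (prog : wprog V cell) : exists M : TM, forall x n st', all (fun a => a < 3) x ->
  exec prog (init_mst V dec x) n st' ->
  (forall j, j < ctr st' vO -> enc (arr st' j) != o0) ->
  forall t, 40 * n.+1 ^ 2 <= t ->
  computes_within M x t [seq nat_of_ord (enc (arr st' j)) | j <- iota 0 (ctr st' vO)].
Proof.
pose code := comp vO prog 0; exists (machine vO dec enc code) => x n st' xs ex nz t tB.
have tg : all (fun i => itgt i <= size code) code.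
  by rewrite size_comp -[wlen prog]add0n; apply: comp_tgt.
have E : iter n (istep vO code) (0, init_mst V dec x) = (size code, st').
  rewrite (comp_sim (vO := vO) ex) ?size_comp //; by exists [::], [::]; rewrite cats0.
have halt st : istep vO code (size code, st) = (size code, st).
  by rewrite /istep nth_default.
have exi : exists i, size code <= (iter i (istep vO code) (0, init_mst V dec x)).1.
  by exists n; rewrite E.
(* The machine stops at the first arrival at the end of the code, possibly before [n]; the end is a
   fixed point of [istep], so the state is the same. *)
case: (ex_minnP exi) => i ge min.
have le j : (iter j (istep vO code) (0, init_mst V dec x)).1 <= size code.
  elim: j => [//|j]; rewrite iterS; case: (iter j _ _) => pc st /= lepc.
  have [lt|gepc] := ltnP pc (size code); last first.
    by rewrite (_ : pc = size code) ?nth_default //; apply/eqP; rewrite eqn_leq lepc.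
  have := all_nthP (IGoto cell vO (size code)) tg pc lt.
  case: (nth _ _ _) => //= t' l h; by case: ifP.
have ni : i <= n by apply: min; rewrite E.
have Ei : iter i (istep vO code) (0, init_mst V dec x) = (size code, st').
  have e1 : (iter i (istep vO code) (0, init_mst V dec x)).1 = size code.
    by apply/eqP; rewrite eqn_leq ge le.
  move: E; rewrite -(subnK ni) iterD.
  case: (iter i _ _) e1 => pc st /= ->; by rewrite iter_fix.
apply: (machine_correct tg xs _ Ei nz).
  by move=> j ji; rewrite ltnNge; apply/negP => /min; rewrite leqNgt ji.
by apply: leq_trans tB; rewrite leq_mul2l leq_sqr ltnS ni orbT.
Qed.

(** * Relational programs *)

(* Programs over finite relations on the domain [0, L), where [L] is the length of the input.
   Variables are de Bruijn levels: the value of variable [i] is the [i]-th entry of [env]. *)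
Inductive fml :=
| FRel of nat & seq nat | FLt of nat & nat | FCur | FNot of fml | FAnd of fml & fml | FEx of fml.
Inductive stmt :=
| SSkip | SAsg of nat & seq nat & fml | SSeq of stmt & stmt | SFor of stmt
| SIf of fml & stmt & stmt | SEmit of bool | SAdv.

Record store := Store { rel : nat -> seq nat -> bool; ptr : nat; out : seq bool }.

Section Semantics.
Variable inp : seq nat.
Notation L := (size inp).

Fixpoint evalf (env : seq nat) (st : store) f : bool := match f with
  | FRel r vs => rel st r [seq nth 0 env v | v <- vs]
  | FLt x y => nth 0 env x < nth 0 env y
  | FCur => nth 0 inp (ptr st) == 1
  | FNot g => ~~ evalf env st g
  | FAnd g h => evalf env st g && evalf env st h
  | FEx g => has (fun x => evalf (rcons env x) st g) (iota 0 L)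
  end.

Definition setrel r vs b st := Store (fupd (rel st) r (fupd (rel st r) vs b)) (ptr st) (out st).

Fixpoint run (env : seq nat) s (st : store) : store := match s with
  | SSkip => st
  | SAsg r vs f => setrel r [seq nth 0 env v | v <- vs] (evalf env st f) st
  | SSeq a b => run env b (run env a st)
  | SFor a => foldl (fun st' x => run (rcons env x) a st') st (iota 0 L)
  | SIf f a b => if evalf env st f then run env a st else run env b st
  | SEmit b => Store (rel st) (ptr st) (rcons (out st) b)
  | SAdv => Store (rel st) (ptr st).+1 (out st)
  end.

End Semantics.

Section WellFormed.
Variables (nb : nat) (ar : nat -> nat).

Fixpoint wff d f := match f with
  | FRel r vs => [&& r < nb, size vs == ar r & all (fun v => v < d) vs]
  | FLt x y => (x < d) && (y < d)
  | FCur => true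
  | FNot g => wff d g
  | FAnd g h => wff d g && wff d h
  | FEx g => wff d.+1 g
  end.

Fixpoint wfs d s := match s with
  | SSkip => true
  | SAsg r vs f => [&& r < nb, size vs == ar r, all (fun v => v < d) vs & wff d f]
  | SSeq a b => wfs d a && wfs d b
  | SFor a => wfs d.+1 a
  | SIf f a b => [&& wff d f, wfs d a & wfs d b]
  | SEmit _ => true
  | SAdv => true
  end.

End WellFormed.

(** One constant is both factor and exponent, as in the final bound; the base [n.+2] exceeds 1, so
    powers grow with the exponent. *)
Definition poly_bounded (b : nat -> nat) := exists K, forall n, b n <= K * n.+2 ^ K.

Lemma poly_bounded_le b b' : (forall n, b n <= b' n) -> poly_bounded b' -> poly_bounded b.
Proof. by move=> h [K H]; exists K => n; apply: leq_trans (h n) (H n). Qed.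

Lemma pow_mono K K' n : K <= K' -> n.+2 ^ K <= n.+2 ^ K'.
Proof. by move=> h; rewrite leq_exp2l. Qed.

Lemma poly_boundedD b b' : poly_bounded b -> poly_bounded b' -> poly_bounded (fun n => b n + b' n).
Proof.
move=> [K H] [K' H']; exists (K + K') => n; rewrite mulnDl; apply: leq_add.
  by apply: leq_trans (H n) _; rewrite leq_mul2l pow_mono ?orbT // leq_addr.
by apply: leq_trans (H' n) _; rewrite leq_mul2l pow_mono ?orbT // leq_addl.
Qed.

Lemma poly_boundedM b b' : poly_bounded b -> poly_bounded b' -> poly_bounded (fun n => b n * b' n).
Proof.
move=> [K H] [K' H']; exists (K * K' + (K + K')) => n.
apply: leq_trans (leq_mul (H n) (H' n)) _; rewrite mulnACA -expnD.
by apply: leq_mul; rewrite ?leq_addr // pow_mono // leq_addl.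
Qed.

Lemma poly_bounded_const k : poly_bounded (fun=> k).
Proof. by exists k => n; rewrite leq_pmulr // expn_gt0. Qed.

Lemma poly_bounded_id : poly_bounded (fun n => n).
Proof. by exists 1 => n; rewrite mul1n expn1; lia. Qed.

Lemma poly_boundedX b k : poly_bounded b -> poly_bounded (fun n => b n ^ k).
Proof.
move=> h; elim: k => [|k IH]; first exact: (poly_bounded_const 1).
apply: (@poly_bounded_le _ (fun n => b n * b n ^ k)) => [n|]; first by rewrite expnS.
exact: poly_boundedM.
Qed.

(** * Compiling relational programs to counters and an array *)

Section Compile.
Variables (nb : nat) (ar : nat -> nat).

(* The components are the bits of the relations, the input symbol and the output symbol. *)
Definition rcell := ({ffun 'I_nb -> bool} * 'I_3 * 'I_3)%type.
Definition bit r (c : rcell) := if insub r is Some i then c.1.1 i else false.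
Definition setbit r b (c : rcell) : rcell :=
  ([ffun i : 'I_nb => if val i == r then b else c.1.1 i], c.1.2, c.2).
Definition setout (o : 'I_3) (c : rcell) : rcell := (c.1, o).

(** [kv]: loop variables; [kr]: remaining rounds of the loop at a depth; [kf]: truth values of
    subformulas; then the input length, the input pointer, the output length, an address, and three
    temporaries. *)
Definition key : eqType := (nat * nat)%type.
Definition kv i : key := (0, i).
Definition kr i : key := (1, i).
Definition kf i : key := (2, i).
Definition kL : key := (3, 0).
Definition kP : key := (3, 1).
Definition kO : key := (3, 2).
Definition kA : key := (3, 3).
Definition kT : key := (3, 4).
Definition kU : key := (3, 5).
Definition kW : key := (3, 6).

Notation wprog := (wprog key rcell).
Notation mst := (mst key rcell).
Notation inc k := (WInc rcell (k : key)).
Notation dec k := (WDec rcell (k : key)).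
Notation nz k := (TNZ rcell (k : key)).
Local Notation "a ;; b" := (WSeq a b) (at level 61, right associativity).

Definition clr k := WWhile (nz k) (dec k).
Definition mv k l := WWhile (nz k) (dec k ;; inc l).
(** Adding by decrements destroys the source, so a copy is collected in [t] and moved back. *)
Definition addc k l t := WWhile (nz k) (dec k ;; inc l ;; inc t) ;; mv t k.
Fixpoint addr vs : wprog := if vs is v :: vs' then
  (mv kA kT ;; WWhile (nz kT) (dec kT ;; addc kL kA kU) ;; addc (kv v) kA kU) ;; addr vs'
  else WSkip.

Definition loop d (body : wprog) : wprog :=
  addc kL (kr d) kT ;;
  WWhile (nz (kr d)) (body ;; inc (kv d) ;; dec (kr d)) ;; clr (kv d).

(** The value is left in the flag [kf i], which must be zero before; flags below [i] are not
    touched. *)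
Fixpoint cf f d i : wprog := match f with
  | FRel r vs => addr vs ;; WIf (TCell kA (bit r)) (inc (kf i)) WSkip ;; clr kA
  | FLt x y => addc (kv x) kT kW ;; addc (kv y) kU kW ;;
      WWhile (nz kT) (dec kT ;; dec kU) ;; WIf (nz kU) (inc (kf i)) WSkip ;; clr kU
  | FCur => WIf (TCell kP (fun c : rcell => c.1.2 == inord 1)) (inc (kf i)) WSkip
  | FNot g => cf g d i ;; WIf (nz (kf i)) (dec (kf i)) (inc (kf i))
  | FAnd g h => cf g d i ;; cf h d i.+1 ;;
      WIf (nz (kf i)) (WIf (nz (kf i.+1)) (dec (kf i.+1)) (dec (kf i))) (clr (kf i.+1))
  | FEx g => loop d (cf g d.+1 i.+1 ;;
      WIf (nz (kf i.+1)) (dec (kf i.+1) ;; WIf (nz (kf i)) WSkip (inc (kf i))) WSkip)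
  end.

Definition outsym (b : bool) : 'I_3 := if b then inord 1 else inord 2.

Fixpoint cs s d : wprog := match s with
  | SSkip => WSkip
  | SAsg r vs f => cf f d 0 ;; addr vs ;;
      WIf (nz (kf 0)) (WUpd kA (setbit r true) ;; dec (kf 0)) (WUpd kA (setbit r false)) ;; clr kA
  | SSeq a b => cs a d ;; cs b d
  | SFor a => loop d (cs a d.+1)
  | SIf f a b => cf f d 0 ;; WIf (nz (kf 0)) (dec (kf 0) ;; cs a d) (cs b d)
  | SEmit b => WUpd kO (setout (outsym b)) ;; inc kO
  | SAdv => inc kP
  end.

Definition exle (s : wprog) (st : mst) b (st' : mst) := exists2 n, exec s st n st' & n <= b.

Lemma exle_le s st b b' st' : exle s st b st' -> b <= b' -> exle s st b' st'.
Proof. by case=> n e h h'; exists n => //; apply: leq_trans h'. Qed.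

Lemma exle_conv s st b st' b' st'' : exle s st b st' -> st' = st'' -> b <= b' -> exle s st b' st''.
Proof. by move=> h <-; apply: exle_le. Qed.

Lemma exle_seq s1 s2 st b1 st1 b2 st2 : exle s1 st b1 st1 -> exle s2 st1 b2 st2 ->
  exle (s1 ;; s2) st (b1 + b2) st2.
Proof.
move=> [n1 e1 h1] [n2 e2 h2]; exists (n1 + n2); [exact: ExSeq e1 e2|exact: leq_add].
Qed.

Lemma exle_skip st : exle WSkip st 0 st.
Proof. by exists 0 => //; constructor. Qed.
Lemma exle_inc k st : exle (inc k) st 1 (sinc k st).
Proof. by exists 1 => //; constructor. Qed.
Lemma exle_dec k st : exle (dec k) st 1 (sdec k st).
Proof. by exists 1 => //; constructor. Qed.
Lemma exle_upd (k : key) g st : exle (WUpd k g) st 1 (swr k g st).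
Proof. by exists 1 => //; constructor. Qed.

Lemma exle_if t s1 s2 st b st' : (if evalt t st then exle s1 st b st' else exle s2 st b st') ->
  exle (WIf t s1 s2) st (b + 2) st'.
Proof.
case: ifP => h [n e le]; first by exists (n.+1 + 1); [exact: ExIfT|lia].
by exists n.+1; [apply: ExIfF => //; rewrite h|lia].
Qed.

Lemma exle_loop k s (S : nat -> mst) N b :
  (forall j, j <= N -> ctr (S j) k = N - j) ->
  (forall j, j < N -> exle s (S j) b (S j.+1)) ->
  exle (WWhile (nz k) s) (S 0) (N * (b + 2) + 1) (S N).
Proof.
elim: N S => [|N IH] S Hk Hs.
  by exists 1 => //; apply: ExWhF; rewrite /= Hk.
have [n1 e1 h1] := Hs 0 isT.
have [|//|n2 e2 h2] := IH (fun j => S j.+1).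
- by move=> j jN; rewrite Hk.
- by move=> j jN; apply: Hs.
exists ((n1.+1 + 1) + n2); last by lia.
by apply: ExWhT e1 e2; rewrite /= Hk.
Qed.

Lemma mst_eq (f f' : key -> nat) (a : nat -> rcell) : f =1 f' -> Mst f a = Mst f' a.
Proof. by move=> e; congr Mst; apply: functional_extensionality_dep. Qed.

Lemma clr_spec f a k : exle (clr k) (Mst f a) (3 * f k + 1) (Mst (fupd f k 0) a).
Proof.
have := @exle_loop k (dec k) (fun j => Mst (fupd f k (f k - j)) a) (f k) 1.
rewrite subnn subn0 => H; have E : fupd f k (f k) =1 f by move=> x; rewrite /fupd; case: eqVneq => // ->.
rewrite (mst_eq a E) in H; apply: exle_le (H _ _) _; last by lia.
  by move=> j _ /=; rewrite /fupd eqxx.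
move=> j lt; have := exle_dec k (Mst (fupd f k (f k - j)) a).
rewrite /sdec /=; congr exle; apply: mst_eq => x; rewrite /fupd eqxx; case: eqP => // _; lia.
Qed.

Lemma mv_spec f a k l : k != l ->
  exle (mv k l) (Mst f a) (4 * f k + 1) (Mst (fupd (fupd f k 0) l (f l + f k)) a).
Proof.
move=> kl; have lk : (l == k) = false by rewrite eq_sym (negbTE kl).
have := @exle_loop k (dec k ;; inc l)
  (fun j => Mst (fupd (fupd f k (f k - j)) l (f l + j)) a) (f k) 2.
rewrite subnn subn0 addn0 => H.
have E : fupd (fupd f k (f k)) l (f l) =1 f.
  by move=> x; rewrite /fupd; case: eqVneq => [->|_] //; case: eqVneq => // ->.
rewrite (mst_eq a E) in H; apply: exle_le (H _ _) _; last by lia.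
  by move=> j _ /=; rewrite /fupd (negbTE kl) eqxx.
move=> j lt; apply: (exle_seq (b1 := 1) (b2 := 1)) (exle_dec _ _) _.
set st := sdec _ _; have := exle_inc l st; rewrite /st /sdec /sinc /=; congr exle; apply: mst_eq => x.
rewrite /fupd ?eqxx ?(negbTE kl) ?lk ?eqxx; case: eqVneq => [_|nl]; first by lia.
case: eqVneq => [_|nk]; rewrite ?(negbTE nl) ?(negbTE nk) //; lia.
Qed.

Lemma addc_spec f a k l t : k != l -> k != t -> l != t -> f t = 0 ->
  exle (addc k l t) (Mst f a) (9 * f k + 2) (Mst (fupd f l (f l + f k)) a).
Proof.
move=> kl kt lt ft; have lk : (l == k) = false by rewrite eq_sym (negbTE kl).
have tk : (t == k) = false by rewrite eq_sym (negbTE kt).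
have tl : (t == l) = false by rewrite eq_sym (negbTE lt).
have := @exle_loop k (dec k ;; inc l ;; inc t)
  (fun j => Mst (fupd (fupd (fupd f k (f k - j)) l (f l + j)) t j) a) (f k) 3.
rewrite subnn subn0 addn0 => H.
have E : fupd (fupd (fupd f k (f k)) l (f l)) t 0 =1 f.
  move=> x; rewrite /fupd; case: eqVneq => [->|_] //; case: eqVneq => [->|_] //.
  by case: eqVneq => // ->.
rewrite (mst_eq a E) in H.
have H1 := mv_spec (fupd (fupd (fupd f k 0) l (f l + f k)) t (f k)) a (k := t) (l := k).
apply: exle_le (exle_seq (H _ _) _) _.
- by move=> j _ /=; rewrite /fupd (negbTE kt) (negbTE kl) eqxx.
- move=> j ltj; apply: (exle_seq (b1 := 1) (b2 := 2)) (exle_dec _ _) _.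
  apply: (exle_seq (b1 := 1) (b2 := 1)) (exle_inc _ _) _.
  set st := sinc _ _; have := exle_inc t st; rewrite /st /sdec /sinc /=; congr exle.
  apply: mst_eq => x; rewrite /fupd ?eqxx ?(negbTE kl) ?(negbTE kt) ?(negbTE lt) ?lk ?tk ?tl ?eqxx.
  case: eqVneq => [_|nt]; rewrite ?eqxx ?tl ?tk ?(negbTE nt) //.
  case: eqVneq => [_|nl]; rewrite ?eqxx ?lk ?(negbTE nl) ?(negbTE nt) //; first by lia.
  case: eqVneq => [_|nk]; rewrite ?(negbTE nk) ?(negbTE nl) ?(negbTE nt) //; lia.
- have := H1; rewrite eq_sym kt => /(_ isT); congr exle.
  apply: mst_eq => x; rewrite /fupd ?eqxx ?(negbTE kl) ?(negbTE kt) ?(negbTE lt) ?lk ?tk ?tl ?eqxx.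
  case: eqVneq => [->|nk]; rewrite ?(negbTE kl) ?add0n //.
  by case: eqVneq => [->|nt]; rewrite ?tl ?ft.
- by rewrite /fupd eqxx; lia.
Qed.

Definition horner L (vs : seq nat) := foldl (fun acc v => acc * L + v) 0 vs.

Lemma horner_rcons L vs v : horner L (rcons vs v) = horner L vs * L + v.
Proof. by rewrite /horner foldl_rcons. Qed.

Lemma horner_lt L vs : all (fun v => v < L) vs -> horner L vs < L ^ size vs.
Proof.
elim/last_ind: vs => [//|vs v IH]; rewrite all_rcons size_rcons horner_rcons => /andP[vL /IH h].
rewrite expnSr; apply: (@leq_trans ((horner L vs).+1 * L)); first by rewrite mulSn; lia.
by rewrite leq_mul2r h orbT.
Qed.

(** Tuples of different lengths may share a cell, which is harmless: each relation has one arity and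
    its own bit. *)
Lemma horner_inj L vs vs' : all (fun v => v < L) vs -> all (fun v => v < L) vs' ->
  size vs = size vs' -> horner L vs = horner L vs' -> vs = vs'.
Proof.
elim/last_ind: vs vs' => [|vs v IH] vs'; first by case: vs'.
case/lastP: vs' => [|vs' v']; first by rewrite size_rcons.
rewrite !all_rcons !size_rcons !horner_rcons => /andP[vL h] /andP[vL' h'] [sz] E.
have L0 : 0 < L by lia.
have Ev : v = v'.
  by move: (congr1 (modn^~ L) E); rewrite !modnMDl !modn_small.
rewrite -Ev in E *; congr rcons; apply: IH => //.
by move/eqP: E; rewrite eqn_add2r eqn_pmul2r // => /eqP.
Qed.

Fixpoint addr_cost L k A := if k is k'.+1 then
  (4 * A + 1 + (A * (9 * L + 2 + 1 + 2) + 1 + (9 * L + 2))) + addr_cost L k' (A * L + L) else 0.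

Lemma addr_cost_mono L k A A' : A <= A' -> addr_cost L k A <= addr_cost L k A'.
Proof.
elim: k A A' => //= k IH A A' h; apply: leq_add; last by apply: IH; nia.
by nia.
Qed.

Lemma addr_spec L vs f a : f kL = L -> f kT = 0 -> f kU = 0 -> (forall v, v \in vs -> f (kv v) <= L) ->
  exle (addr vs) (Mst f a) (addr_cost L (size vs) (f kA))
    (Mst (fupd f kA (foldl (fun acc v => acc * L + f (kv v)) (f kA) vs)) a).
Proof.
move=> fL; elim: vs f fL => [|v vs IH] f fL fT fU fv.
  rewrite /= (_ : Mst _ _ = Mst f a); first exact: exle_skip.
  by apply: mst_eq => x; rewrite /fupd; case: eqP => // ->.
have h1 := @mv_spec f a kA kT isT; rewrite fT add0n in h1.
pose f1 := fupd (fupd f kA 0) kT (f kA).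
have h2 : exle (WWhile (nz kT) (dec kT ;; addc kL kA kU)) (Mst f1 a)
   (f kA * ((9 * L + 2 + 1) + 2) + 1) (Mst (fupd f kA (f kA * L)) a).
  have := @exle_loop kT (dec kT ;; addc kL kA kU)
    (fun j => Mst (fupd (fupd f kA (j * L)) kT (f kA - j)) a) (f kA) (9 * L + 2 + 1).
  rewrite mul0n subn0 subnn => H.
  rewrite (_ : Mst (fupd f kA (f kA * L)) a =
     Mst (fupd (fupd f kA (f kA * L)) kT 0) a); last first.
    by apply: mst_eq => x; rewrite /fupd; case: (eqVneq x kT) => // ->.
  apply: H => [j _|j lt]; first by rewrite /= /fupd eqxx.
  pose g := ctr (sdec kT (Mst (fupd (fupd f kA (j * L)) kT (f kA - j)) a)).
  have hs := @addc_spec g a kL kA kU isT isT isT.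
  have gU : g kU = 0 by [].
  have gL : g kL = L by [].
  have gA : g kA = j * L by [].
  have E : fupd g kA (j * L + L) =1 fupd (fupd f kA (j.+1 * L)) kT (f kA - j.+1).
    move=> x; rewrite /g /= /fupd; case: (eqVneq x kA) => [->|nA] /=; first by lia.
    by case: (eqVneq x kT) => // _; rewrite ?eqxx /=; lia.
  rewrite gL gA (mst_eq a E) in hs.
  by apply: exle_le (exle_seq (exle_dec _ _) (hs gU)) _; lia.
have h3 := @addc_spec (fupd f kA (f kA * L)) a (kv v) kA kU isT isT isT.
rewrite /= in h3.
have fv' : f (kv v) <= L by apply: fv; rewrite inE eqxx.
have E1 : fupd f kA (f kA * L) (kv v) = f (kv v) by [].
have E2 : fupd f kA (f kA * L) kA = f kA * L by [].
have E3 : fupd f kA (f kA * L) kU = 0 by [].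
rewrite E1 E2 E3 in h3.
pose f2 := fupd f kA (f kA * L + f (kv v)).
have f2E : fupd (fupd f kA (f kA * L)) kA (f kA * L + f (kv v)) =1 f2.
  by move=> x; rewrite /f2 /fupd; case: eqP.
have h4 := IH f2 fL fT fU (fun u hu => fv u (mem_behead (s := v :: vs) hu)).
rewrite (mst_eq a f2E) in h3.
have h5 := exle_seq (exle_seq h1 (exle_seq h2 (h3 erefl))) h4.
have f2A : f2 kA = f kA * L + f (kv v) by [].
have f2F : fupd f2 kA (foldl (fun acc u => acc * L + f2 (kv u)) (f2 kA) vs) =1
  fupd f kA (foldl (fun acc u => acc * L + f (kv u)) (f kA) (v :: vs)).
  by move=> x; rewrite /= f2A /f2 /fupd; case: eqP.
rewrite (mst_eq a f2F) f2A in h5; apply: exle_le h5 _.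
apply: leq_add; first by rewrite -!addnA; lia.
by apply: addr_cost_mono; lia.
Qed.

Lemma exle_loop_inv k s N b (I : nat -> mst -> Prop) :
  (forall j st, I j st -> ctr st k = N - j) ->
  (forall j st, j < N -> I j st -> exists2 st', exle s st b st' & I j.+1 st') ->
  forall st, I 0 st -> exists2 st', exle (WWhile (nz k) s) st (N * (b + 2) + 1) st' & I N st'.
Proof.
elim: N I => [|N IH] I Hk Hs st I0.
  by exists st => //; exists 1 => //; apply: ExWhF; rewrite /= (Hk _ _ I0).
have [st1 [n1 e1 h1] I1] := Hs 0 st isT I0.
have [||st2 [n2 e2 h2] I2] := IH (fun j => I j.+1) _ _ st1 I1.
- by move=> j st' /Hk ->.
- by move=> j st' lt; apply: Hs.
exists st2 => //; exists ((n1.+1 + 1) + n2); last by lia.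
by apply: ExWhT e1 e2; rewrite /= (Hk _ _ I0).
Qed.

Lemma fupd_same (X : eqType) Y (f : X -> Y) x y : fupd f x y x = y.
Proof. by rewrite /fupd eqxx. Qed.
Lemma fupd_diff (X : eqType) Y (f : X -> Y) x y z : z != x -> fupd f x y z = f z.
Proof. by rewrite /fupd => /negbTE ->. Qed.
Lemma fupd_id (X : eqType) Y (f : X -> Y) x : fupd f x (f x) =1 f.
Proof. by move=> z; rewrite /fupd; case: eqP => // ->. Qed.

Variable inp : seq nat.
Hypothesis inp3 : all (fun a => a < 3) inp.
Notation L := (size inp).

(** Between subprograms all scratch counters are zero; [d] variables are bound, and the flags from
    [i] on are free. *)
Definition pre d i (env : seq nat) (st : store) (f : key -> nat) :=
  [/\ [/\ f kL = L, f kA = 0, f kT = 0, f kU = 0 & f kW = 0],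
      f kP = ptr st, forall j, f (kv j) = nth 0 env j, size env = d /\ all (fun v => v < L) env
    & (forall j, d <= j -> f (kr j) = 0) /\ (forall j, i <= j -> f (kf j) = 0)].

Definition amatch (st : store) (a : nat -> rcell) := 
  [/\ forall j, (a j).1.2 = inord (nth 0 inp j),
      forall j, (a j).2 = if j < size (out st) then outsym (nth false (out st) j) else inord 0
    & forall r vs, r < nb -> size vs = ar r -> all (fun v => v < L) vs ->
        bit r (a (horner L vs)) = rel st r vs].

Definition loop_cost b n := 9 * n + 2 + ((n * (b + 2 + 2) + 1) + (3 * n + 1)).

Lemma loop_spec d body (F : nat -> key -> nat) (A : nat -> (nat -> rcell) -> Prop) b a0 :
  (forall j, [/\ F j (kv d) = 0, F j (kr d) = 0, F j kL = L & F j kT = 0]) ->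
  A 0 a0 ->
  (forall j a, j < L -> A j a -> exists2 a', A j.+1 a' &
     exle body (Mst (fupd (fupd (F j) (kv d) j) (kr d) (L - j)) a) b
               (Mst (fupd (fupd (F j.+1) (kv d) j) (kr d) (L - j)) a')) ->
  exists2 a', A L a' & exle (loop d body) (Mst (F 0) a0) (loop_cost b L) (Mst (F L) a').
Proof.
move=> HF A0 Hb.
have [F1 F2 F3 F4] := HF 0.
have h1 := @addc_spec (F 0) a0 kL (kr d) kT isT isT isT F4; rewrite F2 F3 add0n in h1.
pose I j (st : mst) := exists2 a, A j a & st = Mst (fupd (fupd (F j) (kv d) j) (kr d) (L - j)) a.
have [|||stx h2 [a' Aa' E]] := @exle_loop_inv (kr d) (body ;; inc (kv d) ;; dec (kr d)) L (b + 2) I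
  _ _ (Mst (fupd (F 0) (kr d) L) a0).
- by move=> j st [a _ ->]; rewrite /= fupd_same.
- move=> j st lt [a Aa ->]; have [a' Aa' h] := Hb j a lt Aa.
  eexists; last by exists a'.
  apply: exle_le (exle_seq h (exle_seq (exle_inc _ _) _)) (leqnn _).
  set st' := sinc _ _; have := exle_dec (kr d) st'.
  congr exle; rewrite /st' /sdec /sinc /=; apply: mst_eq => x; rewrite /fupd.
  case: (eqVneq x (kr d)) => [_|n1] /=; first by rewrite !eqxx /=; lia.
  by case: (eqVneq x (kv d)) => [_|n2] //=; rewrite eqxx.
- exists a0 => //; rewrite subn0; apply: mst_eq => x; rewrite /fupd.
  by case: (eqVneq x (kv d)) => [->|//] /=; rewrite F1.
rewrite {}E in h2; exists a' => //.
apply: exle_le (exle_seq h1 (exle_seq h2 _)) (leqnn _).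
set f' := fupd _ _ _; have := clr_spec f' a' (kv d).
have [F5 F6 _ _] := HF L.
have -> : f' (kv d) = L by rewrite /f' /fupd eqxx /=.
congr exle; apply: mst_eq => x; rewrite /f' /fupd subnn.
case: (eqVneq x (kv d)) => [->|n1] //.
by case: eqVneq => // ->.
Qed.

Fixpoint fcost f n := match f with
  | FRel r vs => addr_cost n (size vs) 0 + (1 + 2 + (3 * n ^ size vs + 1))
  | FLt x y => 9 * n + 2 + (9 * n + 2 + ((n * (2 + 2) + 1) + (1 + 2 + (3 * n + 1))))
  | FCur => 1 + 2
  | FNot g => fcost g n + (1 + 2)
  | FAnd g h => fcost g n + (fcost h n + (4 + 2))
  | FEx g => loop_cost (fcost g n + ((1 + (1 + 2)) + 2)) n
  end.

Lemma pre_lt d i env st f v : pre d i env st f -> v < d -> f (kv v) < L.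
Proof.
case=> _ _ -> [<- /all_nthP h] _; exact: h.
Qed.

Lemma exle_flag (t : test key rcell) i f a (b : bool) : f (kf i) = 0 -> evalt t (Mst f a) = b ->
  exle (WIf t (inc (kf i)) WSkip) (Mst f a) (1 + 2) (Mst (fupd f (kf i) b) a).
Proof.
move=> fi e; apply: exle_if; rewrite e; case: b {e}.
  by have := exle_inc (kf i) (Mst f a); rewrite /sinc /= fi.
rewrite (_ : Mst (fupd f (kf i) false) a = Mst f a); first exact: exle_le (exle_skip _) _.
by rewrite /= -fi; apply: mst_eq; apply: fupd_id.
Qed.

Lemma addr_spec0 d i env st f a vs : pre d i env st f -> all (fun v => v < d) vs ->
  exle (addr vs) (Mst f a) (addr_cost L (size vs) 0)
    (Mst (fupd f kA (horner L [seq nth 0 env v | v <- vs])) a).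
Proof.
move=> P hv; have [[fL fA fT fU fW] _ fe _ _] := P.
have := @addr_spec L vs f a fL fT fU; rewrite fA => H.
have -> : horner L [seq nth 0 env v | v <- vs] = foldl (fun acc v => acc * L + f (kv v)) 0 vs.
  have aux z : foldl (fun acc v => acc * L + v) z [seq nth 0 env v | v <- vs] =
      foldl (fun acc v => acc * L + f (kv v)) z vs.
    by elim: vs z {H hv} => //= v vs IH z; rewrite IH fe.
  exact: aux.
by apply: H => v /(allP hv) /(pre_lt P) /ltnW.
Qed.

Lemma nth_vals_lt d i env st f vs : pre d i env st f -> all (fun v => v < d) vs ->
  all (fun v => v < L) [seq nth 0 env v | v <- vs].
Proof.
move=> P hv; have [_ _ fe _ _] := P; rewrite all_map; apply/allP => v /(allP hv) vd /=.
by rewrite -fe; apply: pre_lt P vd.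
Qed.

Lemma cf_spec fm d i env st f a : wff nb ar d fm -> pre d i env st f -> amatch st a ->
  exle (cf fm d i) (Mst f a) (fcost fm L) (Mst (fupd f (kf i) (evalf inp env st fm)) a).
Proof.
elim: fm d i env f => [r vs|x y||g IH|g IHg h IHh|g IH] d i env f /=.
- case/and3P=> rn /eqP sv hv P M.
  have h1 := addr_spec0 a P hv; set A := horner _ _ in h1.
  have [[fL fA fT fU fW] fP fe [sz ev] [fr ff]] := P.
  have [M1 M2 M3] := M.
  have h2 := @exle_flag (TCell kA (bit r)) i (fupd f kA A) a
    (rel st r [seq nth 0 env v | v <- vs]) (ff _ (leqnn _)) _.
  have e2 : evalt (TCell kA (bit r)) (Mst (fupd f kA A) a) = rel st r [seq nth 0 env v | v <- vs].
    by rewrite /= fupd_same M3 ?size_map //; apply: nth_vals_lt P hv.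
  apply: (exle_conv (exle_seq h1 (exle_seq (h2 e2) (clr_spec _ _ kA)))).
    by apply: mst_eq => x; rewrite /fupd; case: (eqVneq x kA) => [->|//] /=; rewrite fA.
  rewrite !leq_add2l leq_add2r leq_mul2l /=.
  have -> : fupd (fupd f kA A) (kf i) (rel st r [seq nth 0 env v | v <- vs]) kA = A by [].
  by have := horner_lt (nth_vals_lt P hv); rewrite size_map => /ltnW.
- case/andP=> xd yd P M; have [[fL fA fT fU fW] fP fe [sz ev] [fr ff]] := P.
  have hx := pre_lt P xd; have hy := pre_lt P yd.
  have h1 := @addc_spec f a (kv x) kT kW isT isT isT fW; rewrite fT add0n in h1.
  have h2 := @addc_spec (fupd f kT (f (kv x))) a (kv y) kU kW isT isT isT fW.
  have e1 : fupd f kT (f (kv x)) kU = 0 by [].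
  have e2 : fupd f kT (f (kv x)) (kv y) = f (kv y) by [].
  rewrite e1 e2 add0n in h2.
  have h3 : exle (WWhile (nz kT) (dec kT ;; dec kU))
     (Mst (fupd (fupd f kT (f (kv x))) kU (f (kv y))) a) (f (kv x) * (2 + 2) + 1)
     (Mst (fupd f kU (f (kv y) - f (kv x))) a).
    have := @exle_loop kT (dec kT ;; dec kU)
      (fun j => Mst (fupd (fupd f kT (f (kv x) - j)) kU (f (kv y) - j)) a) (f (kv x)) 2.
    rewrite !subn0 subnn => H.
    rewrite (_ : Mst (fupd f kU _) a = Mst (fupd (fupd f kT 0) kU (f (kv y) - f (kv x))) a).
      apply: H => [//|j lt].
      apply: exle_le (exle_seq (exle_dec _ _) _) (leqnn 2).
      set st' := sdec _ _; have := exle_dec kU st'; congr exle; rewrite /st' /sdec /=.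
      apply: mst_eq => z; rewrite /fupd; case: (eqVneq z kU) => [_|nU] /=; first by lia.
      by case: (eqVneq z kT) => //= _; lia.
    apply: mst_eq => z; rewrite /fupd; case: ifP => // _; by case: eqP => // ->.
  have h4 := @exle_flag (nz kU) i (fupd f kU (f (kv y) - f (kv x))) a
    (nth 0 env x < nth 0 env y) (ff _ (leqnn _)) _.
  have e4 : evalt (nz kU) (Mst (fupd f kU (f (kv y) - f (kv x))) a) = (nth 0 env x < nth 0 env y).
    by rewrite /= fupd_same -!fe -lt0n subn_gt0.
  apply: (exle_conv (exle_seq h1 (exle_seq h2 (exle_seq h3 (exle_seq (h4 e4) (clr_spec _ _ kU)))))).
    by apply: mst_eq => z; rewrite /fupd; case: (eqVneq z kU) => [->|//] /=; rewrite fU.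
  have -> : fupd (fupd f kU (f (kv y) - f (kv x))) (kf i) (nth 0 env x < nth 0 env y) kU
       = f (kv y) - f (kv x) by [].
  by lia.
- move=> _ P M; have [[fL fA fT fU fW] fP fe [sz ev] [fr ff]] := P; have [M1 M2 M3] := M.
  apply: exle_flag; first exact: ff.
  have lt3 : nth 0 inp (ptr st) < 3.
    have [lt|ge] := ltnP (ptr st) L; last by rewrite nth_default.
    exact: (all_nthP 0 inp3).
  by rewrite /= M1 fP -(inj_eq val_inj) /= !inordK.
- move=> wg P M; have h1 := IH d i env f wg P M.
  have [_ _ _ _ [_ ff]] := P.
  apply: exle_le (exle_seq h1 (exle_if (b := 1) _)) (leqnn _); rewrite /= fupd_same.
  case: (evalf inp env st g) => /=.
    have := exle_dec (kf i) (Mst (fupd f (kf i) 1) a); congr exle; rewrite /sdec /=.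
    by apply: mst_eq => z; rewrite /fupd; case: eqP => // _; rewrite eqxx.
  have := exle_inc (kf i) (Mst (fupd f (kf i) 0) a); congr exle; rewrite /sinc /=.
  by apply: mst_eq => z; rewrite /fupd; case: eqP => // _; rewrite eqxx.
- case/andP=> wg wh P M; have h1 := IHg d i env f wg P M.
  have [P0 fP fe Pe [fr ff]] := P; set bg := evalf inp env st g in h1 *.
  have P2 : pre d i.+1 env st (fupd f (kf i) bg).
    split=> //; split=> // j ij; rewrite fupd_diff; first by apply: ff; lia.
    by rewrite xpair_eqE /=; apply/eqP; lia.
  have h2 := IHh d i.+1 env _ wh P2 M; set bh := evalf inp env st h in h2 *.
  apply: exle_le (exle_seq h1 (exle_seq h2 (exle_if (b := 4) _))) (leqnn _).
  have n1 : (kf i == kf i.+1) = false by rewrite xpair_eqE /=; apply/eqP; lia.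
  have n2 : (kf i.+1 == kf i) = false by rewrite xpair_eqE /=; apply/eqP; lia.
  have f1 := ff i.+1 (leqnSn _).
  rewrite [evalt _ _]/= {1}/fupd n1 fupd_same; case: bg {h1 h2 P2} => /=.
    apply: exle_le (exle_if (b := 1) _) _ => //; rewrite /= fupd_same; case: bh => /=.
      have := exle_dec (kf i.+1) (Mst (fupd (fupd f (kf i) 1) (kf i.+1) 1) a); congr exle.
      rewrite /sdec /= fupd_same; apply: mst_eq => z; rewrite /fupd.
      by case: (eqVneq z (kf i.+1)) => [->|//]; rewrite n2 f1.
    have := exle_dec (kf i) (Mst (fupd (fupd f (kf i) 1) (kf i.+1) 0) a); congr exle.
    rewrite /sdec /= [fupd _ (kf i.+1) _ (kf i)]fupd_diff ?n1 // fupd_same.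
    apply: mst_eq => z; rewrite /fupd.
    case: (eqVneq z (kf i)) => [//|_]; by case: eqVneq => [->|//]; rewrite f1.
  apply: (exle_conv (clr_spec _ _ (kf i.+1))); last by rewrite fupd_same; case: bh.
  apply: mst_eq => z; rewrite /fupd; case: (eqVneq z (kf i.+1)) => [->|//]; by rewrite n2 f1.
- move=> wg P M; have [P0 fP fe [sz ev] [fr ff]] := P.
  pose hs j := has (fun x => evalf inp (rcons env x) st g) (iota 0 j).
  have n1 : (kf i == kf i.+1) = false by rewrite xpair_eqE /=; apply/eqP; lia.
  have n2 : (kf i.+1 == kf i) = false by rewrite xpair_eqE /=; apply/eqP; lia.
  have f1 := ff i.+1 (leqnSn _).
  have [fL fA fT fU fW] := P0.
  have [||a' -> H] := @loop_spec d (cf g d.+1 i.+1 ;;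
      WIf (nz (kf i.+1)) (dec (kf i.+1) ;; WIf (nz (kf i)) WSkip (inc (kf i))) WSkip)
    (fun j => fupd f (kf i) (hs j)) (fun j a' => a' = a) (fcost g L + ((1 + (1 + 2)) + 2)) a _ erefl.
  + by move=> j; rewrite !fupd_diff // fe nth_default ?sz // fr.
  + move=> j _ lt ->; exists a => //.
    set f' := fupd (fupd _ (kv d) _) _ _.
    have P2 : pre d.+1 i.+1 (rcons env j) st f'.
      split=> //.
      * move=> x; rewrite /f' fupd_diff // /fupd xpair_eqE /= nth_rcons sz.
        by case: (ltngtP x d) => // h; rewrite fe ?nth_default ?sz // ltnW.
      * by rewrite size_rcons sz all_rcons lt.
      split=> x dx; rewrite /f' /fupd /kf /kr !xpair_eqE /=.
        rewrite ifF; last by apply/eqP; lia.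
        by apply: fr; lia.
      rewrite ifF; last by apply/eqP; lia.
      by apply: ff; lia.
    have h1 := IH d.+1 i.+1 _ f' wg P2 M; set bg := evalf inp (rcons env j) st g in h1.
    have hS : hs j.+1 = hs j || bg by rewrite /hs -addn1 iotaD has_cat /= orbF.
    apply: exle_le (exle_seq h1 (exle_if (b := 1 + (1 + 2)) _)) (leqnn _).
    rewrite /= fupd_same hS; case: bg {h1 hS} => /=; last first.
      rewrite orbF; apply: (exle_conv (exle_skip _)) => //.
      apply: mst_eq => z; rewrite {1}/fupd; case: eqP => // ->.
      by have := f1; rewrite /f' /fupd n2 /=.
    rewrite orbT.
    apply: exle_le (exle_seq (exle_dec _ _) (exle_if (b := 1) _)) (leqnn _).
    have E : sdec (kf i.+1) (Mst (fupd f' (kf i.+1) 1) a) = Mst f' a.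
      rewrite /sdec /= fupd_same; apply: mst_eq => z; rewrite /fupd; case: eqP => // ->.
      by have := f1; rewrite /f' /fupd n2 /=.
    rewrite E [evalt _ _]/=.
    have -> : f' (kf i) = hs j by rewrite /f' fupd_diff // fupd_diff // fupd_same.
    case hj : (hs j) => /=.
      by apply: (exle_conv (exle_skip _)) => //; rewrite /f' hj.
    have := exle_inc (kf i) (Mst f' a); congr exle; rewrite /sinc /f' hj /=.
    apply: mst_eq => z; rewrite /fupd.
    by case: (eqVneq z (kf i)) => [->|_] //; rewrite /= eqxx.
  move: H; congr exle; apply: mst_eq => z; rewrite /fupd /hs /=.
  by case: eqP => // ->; rewrite ff.
Qed.

Fixpoint scost s n := match s with
  | SSkip => 0
  | SAsg r vs f => fcost f n + (addr_cost n (size vs) 0 + (2 + 2 + (3 * n ^ size vs + 1)))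
  | SSeq s1 s2 => scost s1 n + scost s2 n
  | SFor s1 => loop_cost (scost s1 n) n
  | SIf f s1 s2 => fcost f n + (1 + scost s1 n + scost s2 n + 2)
  | SEmit _ => 1 + 1
  | SAdv => 1
  end.

Definition post (f : key -> nat) st := fupd (fupd f kP (ptr st)) kO (size (out st)).

Lemma bit_setbit r r' b (c : rcell) : r' < nb ->
  bit r' (setbit r b c) = if r' == r then b else bit r' c.
Proof.
move=> lt; rewrite /bit /setbit; case: insubP => [i _ <-|]; last by rewrite lt.
by rewrite /= ffunE.
Qed.

Lemma pre_post d i env st st' f : pre d i env st f -> pre d i env st' (post f st').
Proof.
case=> [[? ? ? ? ?] ? fe ? [? ?]]; split=> //.
Qed.

Lemma cs_spec s d env st f a : wfs nb ar d s -> pre d 0 env st f -> f kO = size (out st) ->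
  amatch st a -> exists2 a', amatch (run inp env s st) a' &
   exle (cs s d) (Mst f a) (scost s L) (Mst (post f (run inp env s st)) a').
Proof.
elim: s d env st f a => [|r vs fm|s1 IH1 s2 IH2|s1 IH|fm s1 IH1 s2 IH2|b|] d env st f a /=.
- move=> _ P fO M; exists a => //; apply: (exle_conv (exle_skip _)) => //.
  apply: mst_eq => z; rewrite /post; case: P => _ <- _ _ _; rewrite -fO /fupd.
  by case: (eqVneq z kO) => [->|_] //; case: eqVneq => [->|].
- case/and4P=> rn /eqP sv hv wf P fO M.
  have [[fL fA fT fU fW] fP fe [sz ev] [fr ff]] := P.
  have h1 := cf_spec wf P M; set b := evalf inp env st fm in h1 *.
  have P1 : pre d 1 env st (fupd f (kf 0) b).
    split=> //; split=> // j j1; rewrite fupd_diff; first exact: ff.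
    by rewrite xpair_eqE /=; apply/eqP; lia.
  have h2 := addr_spec0 a P1 hv; set vals := [seq nth 0 env v | v <- vs] in h2 *.
  have hvals := nth_vals_lt P hv; rewrite -/vals in hvals.
  set A := horner L vals in h2.
  pose a' := fupd a A (setbit r b (a A)).
  exists a'.
    have [M1 M2 M3] := M; split.
    + by move=> j; rewrite /a' /fupd; case: eqP => // ->; rewrite /= M1.
    + by move=> j; rewrite /a' /fupd; case: eqP => [->|_]; rewrite -M2.
    + move=> r' vs' rn' sv' hv'.
      have -> : rel (setrel r vals b st) r' vs' =
          if (r' == r) && (vs' == vals) then b else rel st r' vs'.
        by rewrite /= /fupd; case: eqVneq => [->|].
      (* A different entry at the same address can only belong to another relation, whose bit is
         left alone. *)
      rewrite /a' /fupd; case: (eqVneq (horner L vs') A) => [E|n]; last first.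
        rewrite M3 // ifF //; apply/negP => /andP[_ /eqP e]; by rewrite e eqxx in n.
      rewrite bit_setbit // -E M3 //; case: eqVneq => [e|//] /=.
      rewrite ifT //; apply/eqP; apply: (horner_inj hv' hvals _ E).
      by rewrite sv' /vals size_map sv e.
  have h3 : exle (WIf (nz (kf 0)) (WUpd kA (setbit r true) ;; dec (kf 0)) (WUpd kA (setbit r false)))
     (Mst (fupd (fupd f (kf 0) b) kA A) a) (2 + 2) (Mst (fupd f kA A) a').
    apply: exle_if; rewrite /= fupd_diff // fupd_same.
    have f0 : f (kf 0) = 0 by apply: ff.
    rewrite /a'; case: b {h1 h2 P1 a'} => /=.
      apply: (exle_conv (exle_seq (exle_upd _ _ _) (exle_dec _ _))) => //.
      rewrite /sdec /swr /= fupd_same; apply: mst_eq => z; rewrite /fupd /=.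
      by case: (eqVneq z (kf 0)) => [->|].
    apply: (exle_conv (exle_upd _ _ _)) => //.
    rewrite /swr /= fupd_same; apply: mst_eq => z; rewrite /fupd /=.
    by case: (eqVneq z (kf 0)) => [->|].
  apply: (exle_conv (exle_seq h1 (exle_seq h2 (exle_seq h3 (clr_spec _ _ kA))))).
    apply: mst_eq => z; rewrite /post /= /fupd /=.
    case: (eqVneq z kA) => [->|_] //=; case: (eqVneq z kO) => [->|_] //.
    by case: (eqVneq z kP) => [->|].
  rewrite !leq_add2l fupd_same leq_add2r leq_mul2l /=.
  by have := horner_lt hvals; rewrite /vals size_map => /ltnW.
- case/andP=> w1 w2 P fO M; have [a1 M1 h1] := IH1 d env st f a w1 P fO M.
  have [a2 M2 h2] := IH2 d env _ _ a1 w2 (pre_post _ P) (fupd_same _ _ _) M1.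
  exists a2 => //; apply: (exle_conv (exle_seq h1 h2)) => //.
  apply: mst_eq => z; rewrite /post /fupd /=; do 2 case: eqP => //.
- move=> w P fO M; have [[fL fA fT fU fW] fP fe [sz ev] [fr ff]] := P.
  pose sg j := foldl (fun st' x => run inp (rcons env x) s1 st') st (iota 0 j).
  have sgS j : sg j.+1 = run inp (rcons env j) s1 (sg j).
    by rewrite /sg -addn1 iotaD foldl_cat.
  have [|||a' Ma' H] := @loop_spec d (cs s1 d.+1) (fun j => post f (sg j))
     (fun j a' => amatch (sg j) a') (scost s1 L) a.
  + by move=> j; split; rewrite //= /post /fupd /= ?fe ?nth_default ?sz ?fr.
  + by [].
  + move=> j a1 lt M1; set f' := fupd _ (kr d) _.
    have P' : pre d.+1 0 (rcons env j) (sg j) f'.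
      split=> //.
      * move=> x; rewrite /f' fupd_diff // {1}/fupd xpair_eqE /= nth_rcons sz.
        rewrite -[post f _ _]/(f (kv x)).
        by case: (ltngtP x d) => // h; rewrite fe ?nth_default ?sz // ltnW.
      * by rewrite size_rcons sz all_rcons lt.
      split=> x dx; rewrite /f' /post /fupd /kf /kr !xpair_eqE /=; last exact: ff.
      rewrite ifF; last by apply/eqP; lia.
      by apply: fr; lia.
    have [a2 M2 h2] := IH d.+1 (rcons env j) (sg j) f' a1 w P' erefl M1.
    rewrite -sgS in M2 h2; exists a2 => //; apply: (exle_conv h2) => //.
    apply: mst_eq => z; rewrite /f' /post /fupd.
    by case: (eqVneq z kO) => [->|n1] //=; case: (eqVneq z kP) => [->|n2].
  exists a' => //; move: H; congr exle; apply: mst_eq => z; rewrite /post /fupd /sg /=.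
  by case: (eqVneq z kO) => [->|_] //; case: eqVneq => [->|].
- case/and3P=> wf w1 w2 P fO M; have [[fL fA fT fU fW] fP fe [sz ev] [fr ff]] := P.
  have h1 := cf_spec wf P M; case: (evalf inp env st fm) h1 => /= h1.
    have [a1 M1 h2] := IH1 d env st f a w1 P fO M; exists a1 => //.
    apply: exle_le (exle_seq h1 (exle_if (b := 1 + scost s1 L) _)) _; last by lia.
    rewrite /= ?fupd_same; apply: exle_seq (exle_dec _ _) _; move: h2; congr exle.
    rewrite /sdec /= ?fupd_same; apply: mst_eq => z; rewrite /fupd; case: eqVneq => [->|//].
    by rewrite ff.
  have [a1 M1 h2] := IH2 d env st f a w2 P fO M; exists a1 => //.
  apply: exle_le (exle_seq h1 (exle_if (b := scost s2 L) _)) _; last by lia.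
  rewrite /= ?fupd_same; move: h2; congr exle; apply: mst_eq => z; rewrite /fupd.
  by case: eqVneq => [->|//]; rewrite ff.
- move=> _ P fO M; have [_ fP _ _ _] := P; have [M1 M2 M3] := M.
  exists (fupd a (size (out st)) (setout (outsym b) (a (size (out st))))).
    split=> [j|j|r vs rn sv hv] /=.
    + by rewrite /fupd; case: eqP => // ->; rewrite /= M1.
    + rewrite /fupd size_rcons nth_rcons ltnS; case: eqVneq => [->|n].
        by rewrite /= leqnn ltnn ?eqxx.
      by move: n; rewrite M2; case: (ltngtP j (size (out st))).
    + by rewrite -M3 // /fupd; case: eqP => // ->.
  apply: (exle_conv (exle_seq (exle_upd _ _ _) (exle_inc _ _))) => //.
  rewrite /sinc /swr /= fO; apply: mst_eq => z; rewrite /post /fupd /= size_rcons.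
  by case: eqVneq => // _; case: eqVneq => [->|].
- move=> _ P fO M; have [_ fP _ _ _] := P; exists a => //.
  apply: (exle_conv (exle_inc _ _)) => //.
  rewrite /sinc /= fP; apply: mst_eq => z; rewrite /post /fupd /=.
  by case: (eqVneq z kO) => [->|_].
Qed.

End Compile.

Ltac poly_tac := repeat first [ eassumption | exact: poly_bounded_id | exact: poly_bounded_const
  | apply: poly_boundedD | apply: poly_boundedM | apply: poly_boundedX ].

Lemma poly_bounded_addr k A : poly_bounded A -> poly_bounded (fun n => addr_cost n k (A n)).
Proof.
elim: k A => [|k IH] A hA /=; first exact: poly_bounded_const.
apply: poly_boundedD; first by poly_tac.
by apply: (IH (fun n => A n * n + n)); poly_tac.
Qed.

Lemma poly_bounded_addr0 k : poly_bounded (fun n => addr_cost n k 0).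
Proof. exact: (poly_bounded_addr _ (poly_bounded_const 0)). Qed.

Lemma poly_bounded_fcost f : poly_bounded (fcost f).
Proof.
elim: f => [r vs|x y||g IH|g IHg h IHh|g IH] /=; try by poly_tac.
by have ha := poly_bounded_addr0 (size vs); poly_tac.
Qed.

Lemma poly_bounded_scost s : poly_bounded (scost s).
Proof.
elim: s => [|r vs f|s1 IH1 s2 IH2|s1 IH|f s1 IH1 s2 IH2|b|] /=; try by poly_tac.
- by have hf := poly_bounded_fcost f; have ha := poly_bounded_addr0 (size vs); poly_tac.
- by have hf := poly_bounded_fcost f; poly_tac.
Qed.

(** * From a program to a polynomial-time machine *)

Section Final.
Variables (nb : nat) (ar : nat -> nat).
Notation rcell := (rcell nb).

Definition rdec (r : 'I_3) : rcell := ([ffun=> false], r, inord 0).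
Definition renc (c : rcell) : 'I_3 := c.2.
(** Input symbols are nonzero, so the first 0 marks the end, and [kL] receives the length. *)
Definition prologue : wprog key rcell :=
  WWhile (TCell kL (fun c : rcell => c.1.2 != inord 0)) (WInc rcell kL).

Lemma prologue_spec inp : all (fun a => (a == 1) || (a == 2)) inp ->
  exle prologue (init_mst key rdec inp) (3 * size inp + 1)
    (Mst (fupd (fun=> 0) kL (size inp)) (arr (init_mst key rdec inp))).
Proof.
move=> h; set a := arr _.
have H n : n <= size inp -> exle prologue (Mst (fupd (fun=> 0) kL (size inp - n)) a) (3 * n + 1)
    (Mst (fupd (fun=> 0) kL (size inp)) a).
  elim: n => [|n IH] le.
    rewrite subn0; exists 1 => //; apply: ExWhF; rewrite /= /fupd eqxx /a /= nth_default //.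
    by rewrite negbK.
  have [|n' e' le'] := IH; first by lia.
  exists (2.+1 + n'); last by lia.
  apply: (@ExWhT _ _ _ _ _ 1 (Mst (fupd (fun=> 0) kL (size inp - n)) a)) => //.
    rewrite /= /fupd eqxx /a /=; have lt : size inp - n.+1 < size inp by lia.
    have := all_nthP 0 h _ lt; rewrite -(inj_eq val_inj) /=.
    by case/orP=> /eqP ->; rewrite !inordK.
  have -> : Mst (fupd (fun=> 0) kL (size inp - n)) a =
    sinc kL (Mst (fupd (fun=> 0) kL (size inp - n.+1)) a).
    rewrite /sinc /=; apply: mst_eq => z; rewrite /fupd; case: (eqVneq z kL) => // _.
    by rewrite eqxx -subSn.
  exact: ExInc.
have := H _ (leqnn _); rewrite subnn; congr exle; apply: mst_eq => z; rewrite /fupd.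
by case: eqP.
Qed.

Definition within N (k : key) := (k.1 <= N) && (k.2 <= N).

Lemma wdom_ex (s : wprog key rcell) : exists N, forall N', N <= N' -> wdom (within N') s.
Proof.
have one (v : key) : exists N, forall N', N <= N' -> within N' v.
  by exists (maxn v.1 v.2) => N'; rewrite geq_max /within.
have tst (t : test key rcell) : exists N, forall N', N <= N' -> tdom (within N') t.
  by case: t => [v|v P]; apply: one.
have two (P Q : pred nat) : (exists N, forall N', N <= N' -> P N') -> (exists N, forall N', N <= N' -> Q N') ->
    exists N, forall N' : nat, N <= N' -> P N' && Q N'.
  move=> [N1 h1] [N2 h2]; exists (maxn N1 N2) => N'; rewrite geq_max => /andP[/h1 -> /h2 ->] //.
elim: s => [|v|v|v g|a IHa b IHb|t a IHa b IHb|t a IHa] /=; try exact: one.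
- by exists 0.
- exact: two.
- by apply: (two) => //; apply: (two).
- exact: two.
Qed.

Definition empty_store := Store (fun _ _ => false) 0 [::].

Theorem program_machine s : wfs nb ar 0 s -> exists M : TM, exists2 b, poly_bounded b &
  forall inp, all (fun a => (a == 1) || (a == 2)) inp -> forall t, b (size inp) <= t ->
  computes_within M inp t [seq if o then 1 else 2 | o <- out (run inp [::] s empty_store)].
Proof.
move=> ws; pose prog := WSeq prologue (cs nb s 0).
(* The added 3 also covers the output counter [kO], which is [(3, 2)]. *)
have [N0 hN0] := wdom_ex prog; pose N := N0 + 3.
have hN : wdom (within N) prog by apply: hN0; apply: leq_addr.
pose V := ('I_N.+1 * 'I_N.+1)%type.
pose ren (k : key) : V := (inord k.1, inord k.2).
have ren_inj : {in within N &, injective ren}.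
  move=> [x y] [x' y']; move=> /andP[h1 h2] /andP[h3 h4] [/(congr1 val) e1].
  move=> /(congr1 val) e2; by move: e1 e2; rewrite /= !inordK // => -> ->.
have [M HM] := while_machine (ren kO) rdec renc (rename ren prog).
pose b n := 40 * ((3 * n + 1) + scost s n).+1 ^ 2.
exists M, b.
  apply: (poly_boundedM (poly_bounded_const 40)); apply: (@poly_boundedX (fun n => _.+1)).
  apply: (@poly_bounded_le _ (fun n => (3 * n + 1) + scost s n + 1)); first by move=> n; lia.
  have := poly_bounded_scost s => hs; poly_tac.
move=> inp h t tB.
have h3 : all (fun a => a < 3) inp by apply: sub_all h => a /orP[] /eqP ->.
have p1 := prologue_spec h.
set f := fupd (fun=> 0) kL (size inp) in p1.
have P : pre inp 0 0 [::] empty_store f by split=> // j; rewrite nth_nil.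
have Ma : amatch ar inp empty_store (arr (init_mst key rdec inp)).
  split=> // r vs rn sv hv; rewrite /bit; case: insubP => // i _ _; by rewrite ffunE.
have [a' [Ma1 Ma2 Ma3] [n2 e2 le2]] := cs_spec h3 ws P erefl Ma.
have [n1 e1 le1] := p1.
have ex : exec prog (init_mst key rdec inp) (n1 + n2)
   (Mst (post f (run inp [::] s empty_store)) a') by apply: ExSeq e1 e2.
set st' := run inp [::] s empty_store in ex Ma2 *.
have [|t' ext [Et1 Et2]] := exec_rename ren_inj ex hN (t := init_mst V rdec inp).
  by split.
have NO : kO \in within N by apply/andP; rewrite /N /=; lia.
have cO : ctr t' (ren kO) = size (out st').
  by rewrite -Et2 // /post fupd_same.
have := HM inp (n1 + n2) t' h3 ext.
rewrite cO -Et1 /= => H.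
have -> : [seq if o then 1 else 2 | o <- out st'] = [seq nat_of_ord (renc (a' j)) | j <- iota 0 (size (out st'))].
  apply: (@eq_from_nth _ 0); rewrite !size_map ?size_iota // => j lt.
  rewrite (nth_map false) // (nth_map 0) ?size_iota // nth_iota // /renc Ma2 add0n lt /outsym.
  by case: nth; rewrite inordK.
apply: H.
  move=> j lt; rewrite /renc Ma2 lt /outsym /o0 -(inj_eq val_inj) /=.
  by case: nth; rewrite /= !inordK.
apply: leq_trans tB; rewrite /b leq_mul2l /= leq_sqr ltnS; exact: leq_add.
Qed.

End Final.

Fixpoint freads f := match f with
  | FRel r _ => [:: r] | FLt _ _ => [::] | FCur => [::] | FNot g => freads g
  | FAnd g h => freads g ++ freads h | FEx g => freads g end.
Fixpoint writes s := match s with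
  | SAsg r _ _ => [:: r] | SSeq a b => writes a ++ writes b | SFor a => writes a
  | SIf _ a b => writes a ++ writes b | _ => [::] end.

(** * Invariants for relational programs *)

Section Programs.
Variable inp : seq nat.
Notation L := (size inp).
Implicit Types (env vs us : seq nat) (st : store).

Lemma evalf_agree f env st st' : {in freads f, rel st =1 rel st'} -> ptr st = ptr st' ->
  evalf inp env st f = evalf inp env st' f.
Proof.
move=> + ep; elim: f env => [r vs|x y||g IH|g IHg h IHh|g IH] env //= H.
- by rewrite H ?inE.
- by rewrite ep.
- by rewrite IH.
- by rewrite IHg ?IHh // => r hr; apply: H; rewrite mem_cat hr ?orbT.
- by apply: eq_has => x; apply: IH.
Qed.

Lemma run_frame s env st r : r \notin writes s -> rel (run inp env s st) r = rel st r.
Proof.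
elim: s env st => [|r' vs f|a IHa b IHb|a IH|f a IHa b IHb|b|] env st //=.
- by rewrite inE => /negbTE h; rewrite /fupd h.
- by rewrite mem_cat negb_or => /andP[ha hb]; rewrite IHb ?IHa.
- by move=> h; elim: (iota 0 L) st => //= x l IHl st; rewrite IHl IH.
- by rewrite mem_cat negb_or => /andP[ha hb]; case: ifP => _; rewrite ?IHa ?IHb.
Qed.

Lemma for_inv env s st (J : nat -> store -> Prop) : J 0 st ->
  (forall x st, x < L -> J x st -> J x.+1 (run inp (rcons env x) s st)) ->
  J L (run inp env (SFor s) st).
Proof.
move=> J0 H /=; have : forall k, k <= L ->
    J k (foldl (fun st' x => run inp (rcons env x) s st') st (iota 0 k)).
  elim=> [//|k IH] kL; rewrite -addn1 iotaD foldl_cat /= add0n addn1.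
  by apply: H => //; apply: IH; apply: ltnW.
exact.
Qed.

Lemma forg_inv U n env s st (J : nat -> store -> Prop) : n <= L ->
  (forall x st, J x st -> forall y, y < L -> rel st U [:: y] = (y < n)) -> J 0 st ->
  (forall x st, x < n -> J x st -> J x.+1 (run inp (rcons env x) s st)) ->
  J n (run inp env (SFor (SIf (FRel U [:: size env]) s SSkip)) st).
Proof.
move=> nL HU J0 H.
pose J' x st := J (minn x n) st.
have : J' L (run inp env (SFor (SIf (FRel U [:: size env]) s SSkip)) st).
  apply: for_inv; first by rewrite /J' min0n.
  move=> x st' xL; rewrite /J' /= nth_rcons ltnn eqxx => Jx; rewrite (HU _ _ Jx) //.
  case: ltnP => xn; last by rewrite (minn_idPr xn) in Jx; rewrite (minn_idPr _) // ltnW.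
  by rewrite (minn_idPl (ltnW xn)) in Jx; rewrite (minn_idPl xn); apply: H.
by rewrite /J' (minn_idPr nL).
Qed.

(** Nested loops with ignored variables are a device for repetition: [j] of them give [L ^ j]
    rounds. *)
Lemma rep_inv j s env st i (J : nat -> store -> Prop) : J i st ->
  (forall i st us, size us = j -> J i st -> J i.+1 (run inp (env ++ us) s st)) ->
  J (i + L ^ j) (run inp env (iter j SFor s) st).
Proof.
elim: j env st i => [|j IH] env st i Ji H.
  by rewrite addn1 /=; have := H i st [::] erefl Ji; rewrite cats0.
rewrite iterS expnS.
have := @for_inv env (iter j SFor s) st (fun x st => J (i + x * L ^ j) st); apply.
  by rewrite mul0n addn0.
move=> x st' xL Jx; rewrite mulSnr addnA; apply: IH => // i' st1 us su J1.
by rewrite cat_rcons; apply: H => //=; rewrite su.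
Qed.

Definition same_rest r st st' :=
  [/\ forall r', r' != r -> rel st' r' = rel st r', ptr st' = ptr st & out st' = out st].

(** As [f] does not read [r], the order of the assignments is immaterial. The induction fixes the
    first components [us] of the tuple. *)
Lemma nest_assign_gen r f d env st k us : r \notin freads f -> size env = d ->
  let st' := run inp (env ++ us) (iter k SFor (SAsg r (iota d (size us + k)) f)) st in
  [/\ forall vs, size vs = k -> all (fun v => v < L) vs ->
        rel st' r (us ++ vs) = evalf inp (env ++ (us ++ vs)) st f,
      forall ws, take (size us) ws != us -> rel st' r ws = rel st r ws & same_rest r st st'].
Proof.
move=> rf sd; elim: k us st => [|k IH] us st.
  rewrite addn0 /=.
  have -> : [seq nth 0 (env ++ us) v | v <- iota d (size us)] = us.
    rewrite -sd -{1}[size env]addn0 iotaDl -map_comp.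
    transitivity [seq nth 0 us i | i <- iota 0 (size us)]; last exact: mkseq_nth.
    by apply: eq_map => i /=; rewrite nth_cat ltnNge leq_addr /= addKn.
  split.
  - by case=> // _ _; rewrite cats0 !fupd_same.
  - move=> ws n; rewrite fupd_same fupd_diff //; apply: contra n => /eqP ->.
    by rewrite take_size.
  - by split=> // r' h; rewrite /= fupd_diff.
pose s := iter k SFor (SAsg r (iota d (size us + k.+1)) f).
rewrite -[iter k.+1 SFor _]/(SFor s).
pose J y st1 := [/\ forall x vs, x < y -> size vs = k -> all (fun v => v < L) vs ->
     rel st1 r (us ++ x :: vs) = evalf inp (env ++ (us ++ x :: vs)) st f,
   forall ws, take (size us) ws != us -> rel st1 r ws = rel st r ws & same_rest r st st1].
have : J L (run inp (env ++ us) (SFor s) st).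
  apply: for_inv; first by split.
  move=> y st1 yL [J1 J2 [J3 J4 J5]].
  rewrite rcons_cat /s addnS -addSn -(size_rcons us y).
  have [I1 I2 [I3 I4 I5]] := IH (rcons us y) st1.
  have ag e : evalf inp e st1 f = evalf inp e st f.
    apply: evalf_agree => // r' hr'; rewrite J3 //; by apply: contraNneq rf => <-.
  split.
  - move=> x vs; rewrite ltnS leq_eqVlt => /orP[/eqP ->|xy] sv av.
      by rewrite -cat_rcons I1 // ag.
    rewrite I2 ?J1 // -cat_rcons take_size_cat ?size_rcons //.
    by apply/eqP => /rcons_inj[] e; rewrite e ltnn in xy.
  - move=> ws nw; rewrite I2 ?J2 //; apply: contra nw => /eqP e.
    have := congr1 (take (size us)) e; rewrite size_rcons take_takel //.
    by rewrite -cats1 take_size_cat // => ->.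
  - by split; rewrite ?I4 ?I5 // => r' hr; rewrite I3 // J3.
case=> J1 J2 J3; split=> //.
by case=> // x vs [sv] /= /andP[xL av]; apply: J1.
Qed.

Definition assign r k (f : seq nat -> nat -> fml) d :=
  iter k SFor (SAsg r (iota d k) (f (iota d k) (d + k))).
(* The auxiliary relation [t] makes the assignment simultaneous. *)
Definition setr r t k (f : seq nat -> nat -> fml) d :=
  SSeq (assign t k f d) (assign r k (fun vs _ => FRel t vs) d).

Lemma setr_spec r t k f env st d : size env = d -> t \notin freads (f (iota d k) (d + k)) -> r != t ->
  let st' := run inp env (setr r t k f d) st in
  [/\ forall vs, size vs = k -> all (fun v => v < L) vs ->
        rel st' r vs = evalf inp (env ++ vs) st (f (iota d k) (d + k)),
      forall r', r' != r -> r' != t -> rel st' r' = rel st r', ptr st' = ptr st & out st' = out st].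
Proof.
move=> sd tf rt; rewrite /=.
have [A1 A2 [A3 A4 A5]] := @nest_assign_gen t _ d env st k [::] tf sd.
rewrite cats0 add0n in A1 A2 A3 A4 A5; set st1 := run inp env (assign t k f d) st.
have tf' : r \notin freads (FRel t (iota d k)) by rewrite inE.
have [B1 B2 [B3 B4 B5]] := @nest_assign_gen r _ d env st1 k [::] tf' sd.
rewrite cats0 add0n in B1 B2 B3 B4 B5.
split; [|by move=> r' h1 h2; rewrite B3 ?A3|by rewrite B4 A4|by rewrite B5 A5].
move=> vs sv av; rewrite [LHS](B1 vs) // /=.
have -> : [seq nth 0 (env ++ vs) v | v <- iota d k] = vs.
  rewrite -sd -sv -{1}[size env]addn0 iotaDl -map_comp.
  transitivity [seq nth 0 vs i | i <- iota 0 (size vs)]; last exact: mkseq_nth.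
  by apply: eq_map => i /=; rewrite nth_cat ltnNge leq_addr /= addKn.
exact: A1.
Qed.

Lemma has_guard n (U P : nat -> bool) (P' : pred 'I_n) : n <= L ->
  (forall y, y < L -> U y = (y < n)) -> (forall q : 'I_n, P q = P' q) ->
  has (fun x => U x && P x) (iota 0 L) = [exists q : 'I_n, P' q].
Proof.
move=> nL HU HP; apply/hasP/existsP => [[x]|[q hq]].
  rewrite mem_iota add0n => /andP[_ xL] /andP[]; rewrite HU // => xn hx.
  by exists (Ordinal xn); rewrite -HP.
have qL := leq_trans (ltn_ord q) nL.
exists (val q); first by rewrite mem_iota add0n.
by rewrite HU // HP hq ltn_ord.
Qed.

Fixpoint emits env st s : seq bool := match s with
  | SEmit b => [:: b]
  | SSeq a b => emits env st a ++ emits env st b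
  | SFor a => flatten [seq emits (rcons env x) st a | x <- iota 0 L]
  | SIf f a b => if evalf inp env st f then emits env st a else emits env st b
  | _ => [::]
  end.
Fixpoint pure_out s := match s with
  | SSkip | SEmit _ => true
  | SSeq a b => pure_out a && pure_out b | SFor a => pure_out a
  | SIf _ a b => pure_out a && pure_out b | _ => false end.

Lemma run_emits s env st : pure_out s ->
  run inp env s st = Store (rel st) (ptr st) (out st ++ emits env st s).
Proof.
have E st' st1 e s1 : rel st' = rel st1 -> ptr st' = ptr st1 -> emits e st' s1 = emits e st1 s1.
  move=> er ep; elim: s1 e => //= [a IHa b IHb|a IH|f a IHa b IHb] e.
  - by rewrite IHa IHb.
  - by congr flatten; apply: eq_map => x; apply: IH.
  - rewrite (@evalf_agree f e st' st1) ?IHa ?IHb // => r _; by rewrite er.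
elim: s env st => [|r vs f|a IHa b IHb|a IH|f a IHa b IHb|b|] env st //=.
- by move=> _; rewrite cats0; case: st.
- move=> /andP[ha hb]; rewrite IHa // IHb //= (E _ st) //.
  by rewrite catA.
- move=> ha; elim: (iota 0 L) st => [|x l IHl] st /=; first by rewrite cats0; case: st.
  rewrite IH // IHl /= catA; congr Store; congr (_ ++ _); congr flatten.
  by apply: eq_map => y; apply: E.
- by case/andP=> ha hb; case: ifP => _; [apply: IHa|apply: IHb].
- by move=> _; rewrite cats1.
Qed.

Lemma flatten_guard n (U : nat -> bool) (P : nat -> seq bool) (P' : 'I_n -> seq bool) : n <= L ->
  (forall y, y < L -> U y = (y < n)) -> (forall q : 'I_n, P q = P' q) ->
  flatten [seq if U x then P x else [::] | x <- iota 0 L] = flatten [seq P' q | q <- enum 'I_n].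
Proof.
move=> nL HU HP; rewrite -(subnKC nL) iotaD map_cat flatten_cat add0n.
have -> : flatten [seq if U x then P x else [::] | x <- iota n (L - n)] = [::].
  have : {in iota n (L - n), forall x, U x = false}.
    move=> x; rewrite mem_iota subnKC // => /andP[nx xL]; rewrite HU // ltnNge nx //.
  elim: (iota _ _) => //= x l IH H; rewrite H ?inE ?eqxx //= IH // => y hy.
  by apply: H; rewrite inE hy orbT.
rewrite cats0 -val_enum_ord -map_comp; congr flatten; apply: eq_map => q /=.
by rewrite HU ?ltn_ord ?HP // (leq_trans (ltn_ord q) nL).
Qed.

End Programs.

(** * The minimisation program *)

(* A builder maps the number of variables in scope to a formula. *)
Notation fb := (nat -> fml).
Definition fR r (vs : seq nat) : fb := fun=> FRel r vs.
Definition fL x y : fb := fun=> FLt x y.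
Definition fN (f : fb) : fb := fun d => FNot (f d).
Definition fA (f g : fb) : fb := fun d => FAnd (f d) (g d).
Definition fO (f g : fb) : fb := fN (fA (fN f) (fN g)).
Definition fI (f g : fb) : fb := fN (fA f (fN g)).
Definition fE (f : nat -> fb) : fb := fun d => FEx (f d d.+1).
Definition fEg U (f : nat -> fb) : fb := fE (fun x => fA (fR U [:: x]) (f x)).
Definition fAg U (f : nat -> fb) : fb := fN (fEg U (fun x => fN (f x))).
Definition fT x : fb := fN (fL x x).
Definition feq x y : fb := fA (fN (fL x y)) (fN (fL y x)).
Definition fzero x : fb := fN (fE (fun z => fL z x)).
Definition fsucc y x : fb := fA (fL y x) (fN (fE (fun z => fA (fL y z) (fL z x)))).

Definition guard U d s := SFor (SIf (FRel U [:: d]) s SSkip).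

Notation v_ := (fun vs i => nth 0 vs i).

(* Names of relations, whose meaning is given by [spec]; those from [rNX] on are scratch space. *)
Notation rUQ := 0 (only parsing).
Notation rUM := 1 (only parsing).
Notation rUC := 2 (only parsing).
Notation rU0 := 3 (only parsing).
Notation rDL := 4 (only parsing).
Notation rCW := 5 (only parsing).
Notation rUK := 6 (only parsing).
Notation rCL := 7 (only parsing).
Notation rX := 8 (only parsing).
Notation rGD := 9 (only parsing).
Notation rGO := 10 (only parsing).
Notation rEQ := 11 (only parsing).
Notation rSR := 12 (only parsing).
Notation rGG := 13 (only parsing).
Notation rPL := 14 (only parsing).
Notation rTM := 15 (only parsing).
Notation rDG := 16 (only parsing).
Notation rDR := 17 (only parsing).
Notation rFA := 18 (only parsing).
Notation rRP := 19 (only parsing).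
Notation rCQ := 20 (only parsing).
Notation rCR := 21 (only parsing).
Notation rIM := 22 (only parsing).
Notation rQB := 23 (only parsing).
Notation rDB := 24 (only parsing).
Notation rSB := 25 (only parsing).
Notation rB0 := 26 (only parsing).
Notation rNX := 30 (only parsing).
Notation rY := 31 (only parsing).
Notation rNY := 32 (only parsing).
Notation rZ := 33 (only parsing).
Notation t1 := 34 (only parsing).
Notation t2 := 35 (only parsing).
Notation t3 := 36 (only parsing).
Notation t4 := 37 (only parsing).
Notation t5 := 38 (only parsing).

Definition arity r := nth 0 [:: 1; 1; 1; 1; 3; 4; 1; 4; 2; 3; 1; 2; 3; 4; 4; 2; 4; 3; 3; 3; 3; 5;
  4; 1; 3; 5; 1; 0; 0; 0; 2; 2; 2; 2; 1; 2; 3; 4; 5] r.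

Fixpoint seqs l := if l is s :: l' then SSeq s (seqs l') else SSkip.

(** The loop index equals the number of 1s read so far; at the closing 2 the pointer rests for the
    remaining rounds, and the last [SAdv] skips it. *)
Definition readnum U := SSeq (SFor (SIf FCur (SSeq (SAsg U [:: 0] (FNot (FLt 0 0))) SAdv) SSkip)) SAdv.

(** A bit is written 12 or 2: its first symbol shows its value, and the pointer moves by two or
    one. *)
Definition parse_colours :=
  guard rUC 3 (SSeq (SAsg rCW [:: 0; 1; 2; 3] FCur) (SSeq (SIf FCur SAdv SSkip) SAdv)).
Definition parse_trans :=
  SSeq (SAsg rDL [:: 0; 1; 2] FCur) (SIf FCur (SSeq SAdv (SSeq SAdv parse_colours)) SAdv).
Definition parse := seqs [:: readnum rUQ; readnum rUM; readnum rUC; readnum rU0;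
  guard rUQ 0 (guard rUM 1 (guard rUQ 2 parse_trans))].

Definition PhiF c d vs : fb := let p := v_ vs 0 in let q := v_ vs 1 in
  fAg rUM (fun a => fAg rUQ (fun p' => fI (fR rDL [:: p; a; p'])
    (fEg rUQ (fun q' => fA (fR rDL [:: q; a; q'])
       (fO (fA (fR rCL [:: p; a; p'; c]) (fR rX [:: p'; q']))
           (fA (fN (fR rCL [:: p; a; p'; c]))
               (fO (fA (fN (fR rCL [:: q; a; q'; d])) (fR rZ [:: p'; q'])) (fR rY [:: p'; q'])))))))).
Definition set2 r f d := setr r t2 2 f d.
(** Numbers are variable levels: 2 holds the claim and 5 the answer; 6 variables are in scope, and
    two loops for repetition make it 8. *)
Definition loopD := seqs [:: set2 rZ (fun vs => fT (v_ vs 0)) 6;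
  iter 2 SFor (set2 rZ (PhiF 2 5) 8);
  set2 rNY (fun vs => fO (fR rNY vs) (fR rZ vs)) 6].
Definition loopY := seqs [:: set2 rNY (fun vs => fN (fT (v_ vs 0))) 5; guard rUK 5 loopD;
  set2 rY (fun vs => fR rNY vs) 5].
Definition loopC := seqs [:: set2 rY (fun vs => fN (fT (v_ vs 0))) 3; iter 2 SFor loopY;
  set2 rNX (fun vs => fA (fR rNX vs) (fR rY vs)) 3].
Definition loopX := seqs [:: set2 rNX (fun vs => fT (v_ vs 0)) 2; guard rUK 2 loopC;
  set2 rX (fun vs => fR rNX vs) 2].
Definition stX := seqs [:: set2 rX (fun vs => fT (v_ vs 0)) 0; iter 2 SFor loopX].

(** Adding the first index outside [rUC] accounts for the extra colour of [plus]. *)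
Definition stUK := setr rUK t1 1 (fun vs => fO (fR rUC vs)
  (fA (fN (fR rUC vs)) (fN (fE (fun z => fA (fL z (v_ vs 0)) (fN (fR rUC [:: z]))))))) 0.
Definition stCL := setr rCL t4 4 (fun vs => fO (fN (fR rUC [:: v_ vs 3]))
  (fA (fR rDL [:: v_ vs 0; v_ vs 1; v_ vs 2]) (fR rCW vs))) 0.
Definition stGD := setr rGD t3 3 (fun vs => fA (fR rDL vs) (fAg rUQ (fun z =>
  fI (fR rDL [:: v_ vs 0; v_ vs 1; z]) (fR rX [:: z; v_ vs 2])))) 0.
Definition isq0 x : fb := fA (fN (fR rU0 [:: x])) (fN (fE (fun z => fA (fL z x) (fN (fR rU0 [:: z]))))).
Definition stGO := seqs [:: setr rGO t1 1 (fun vs => isq0 (v_ vs 0)) 0;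
  SFor (setr rGO t1 1 (fun vs => fO (fR rGO vs) (fEg rUQ (fun z => fA (fR rGO [:: z])
     (fEg rUM (fun a => fR rGD [:: z; a; v_ vs 0]))))) 1)].
Definition stEQ := setr rEQ t2 2 (fun vs => let p := v_ vs 0 in let q := v_ vs 1 in
  fA (fR rGO [:: p]) (fA (fR rGO [:: q]) (fA (fR rX [:: p; q]) (fR rX [:: q; p])))) 0.
Definition closure r edge := seqs [:: setr r t3 3 (fun vs => feq (v_ vs 1) (v_ vs 2)) 0;
  SFor (setr r t3 3 (fun vs => fO (fR r vs) (fEg rUQ (fun z => fA (fR r [:: v_ vs 0; v_ vs 1; z])
     (fEg rUM (fun a => edge (v_ vs 0) z a (v_ vs 2)))))) 1)].
Definition stSR := closure rSR (fun c q a q' => fA (fR rGD [:: q; a; q']) (fN (fR rCL [:: q; a; q'; c]))).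
Definition stGG := setr rGG t4 4 (fun vs =>
  let c := v_ vs 0 in let q := v_ vs 1 in let a := v_ vs 2 in let q' := v_ vs 3 in
  fA (fA (fR rGD [:: q; a; q']) (fN (fR rCL [:: q; a; q'; c]))) (fR rSR [:: c; q'; q])) 0.
Definition pleFF vs : fb :=
  let p := v_ vs 0 in let c := v_ vs 1 in let q := v_ vs 2 in let d := v_ vs 3 in
  fA (fR rEQ [:: p; q]) (fAg rUM (fun a => fAg rUQ (fun p' => fI (fR rGG [:: c; p; a; p'])
    (fEg rUQ (fun q' => fA (fR rGG [:: d; q; a; q']) (fR rPL [:: p'; c; q'; d])))))).
Definition stPL := seqs [:: setr rPL t4 4 (fun vs => fT (v_ vs 0)) 0;
  iter 4 SFor (setr rPL t4 4 pleFF 4)].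
Definition stTM := setr rTM t2 2 (fun vs => let q := v_ vs 0 in let c := v_ vs 1 in
  fA (fR rGO [:: q]) (fAg rUQ (fun q' => fAg rUK (fun c' =>
    fI (fR rPL [:: q; c; q'; c']) (fR rPL [:: q'; c'; q; c]))))) 0.
Definition stDG := setr rDG t4 4 (fun vs =>
  let c := v_ vs 0 in let q := v_ vs 1 in let a := v_ vs 2 in let q' := v_ vs 3 in
  fA (fR rGG vs) (fAg rUQ (fun z => fI (fR rGG [:: c; q; a; z]) (fR rPL [:: z; c; q'; c])))) 0.
Definition stDR := closure rDR (fun c q a q' => fR rDG [:: c; q; a; q']).
Definition stFA := setr rFA t3 3 (fun vs => fA (fR rTM [:: v_ vs 0; v_ vs 1])
  (fR rDR [:: v_ vs 1; v_ vs 0; v_ vs 2])) 0.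
Definition fpeq c e e' : fb := fA (fR rPL [:: e; c; e'; c]) (fR rPL [:: e'; c; e; c]).
Definition stRP := setr rRP t3 3 (fun vs => let q := v_ vs 0 in let c := v_ vs 1 in let e := v_ vs 2 in
  fA (fR rFA vs) (fAg rUQ (fun z => fI (fA (fL z e) (fR rFA [:: q; c; z])) (fN (fpeq c z e))))) 0.
(** Cardinalities without arithmetic: [r] relates [ws], [x] and [i] when [i] elements before [x]
    satisfy [P]. Each pass settles one more value of [x]. *)
Definition count r t k (P : seq nat -> nat -> fb) := SFor (setr r t k.+2 (fun vs =>
  let x := v_ vs k in let i := v_ vs k.+1 in let ws := take k vs in
  fO (fA (fzero x) (fzero i)) (fE (fun y => fA (fsucc y x)
    (fO (fA (P ws y) (fE (fun j => fA (fsucc j i) (fR r (ws ++ [:: y; j])))))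
        (fA (fN (P ws y)) (fR r (ws ++ [:: y; i]))))))) 1).
Definition stCQ := count rCQ t3 1 (fun ws y => fR rEQ [:: y; v_ ws 0]).
Definition stCR := count rCR t5 3 (fun ws y => fA (fR rRP [:: v_ ws 0; v_ ws 1; y]) (fR rEQ [:: y; v_ ws 2])).
Definition stIM := setr rIM t4 4 (fun vs =>
  let q := v_ vs 0 in let c := v_ vs 1 in let e := v_ vs 2 in let s := v_ vs 3 in
  fA (fR rFA [:: q; c; e]) (fEg rUQ (fun z => fA (fR rRP [:: q; c; z]) (fA (fpeq c z e)
    (fA (fR rEQ [:: z; s]) (fE (fun i => fA (fR rCR [:: q; c; z; z; i]) (fR rCQ [:: s; s; i])))))))) 0.
Definition rk0 s : fb := fE (fun z => fA (fzero z) (fR rCQ [:: s; s; z])).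
Definition stQB := setr rQB t1 1 (fun vs => let s := v_ vs 0 in
  fA (fR rGO [:: s]) (fO (rk0 s) (fEg rUQ (fun q => fEg rUK (fun c => fEg rUQ (fun e =>
    fR rIM [:: q; c; e; s])))))) 0.
Definition stDB := setr rDB t3 3 (fun vs => fEg rUQ (fun r =>
  fA (fR rGD [:: v_ vs 0; v_ vs 1; r]) (fR rEQ [:: r; v_ vs 2]))) 0.
Definition stSB := setr rSB t5 5 (fun vs =>
  let q := v_ vs 0 in let c := v_ vs 1 in let s := v_ vs 2 in let a := v_ vs 3 in let s' := v_ vs 4 in
  fEg rUQ (fun e => fEg rUQ (fun e' => fA (fR rIM [:: q; c; e; s])
    (fA (fR rDG [:: c; e; a; e']) (fR rIM [:: q; c; e'; s']))))) 0.
Definition stB0 := setr rB0 t1 1 (fun vs => let s := v_ vs 0 in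
  fA (fEg rUQ (fun z => fA (isq0 z) (fR rEQ [:: s; z]))) (rk0 s)) 0.

Definition e1 := SEmit true.
Definition e2 := SEmit false.
Definition guardB d s := guard rUQ d (SIf (FRel rQB [:: d]) s SSkip).
(** The initial state is printed as the number of kept states before it; a transition in [rSB] lacks
    the colour, so its bit is 0. *)
Definition emit := seqs [::
  guardB 0 e1; e2;
  guard rUM 0 e1; e2;
  guard rUQ 0 (guard rUK 1 e1); e2;
  guardB 0 (SIf (fEg rUQ (fun b => fA (fR rB0 [:: b]) (fL 0 b)) 1) e1 SSkip); e2;
  guardB 0 (guard rUM 1 (guardB 2 (SIf (FRel rDB [:: 0; 1; 2])
    (seqs [:: e1; e2; guard rUQ 3 (guard rUK 4
       (SIf (FRel rSB [:: 3; 4; 0; 1; 2]) e2 (SSeq e1 e2)))]) e2)))].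

Definition stages := [:: stUK; stCL; stX; stGD; stGO; stEQ; stSR; stGG; stPL; stTM; stDG; stDR; stFA;
  stRP; stCQ; stCR; stIM; stQB; stDB; stSB; stB0].
Definition minimiser := SSeq parse (SSeq (seqs stages) emit).

Lemma minimiser_wf : wfs 39 arity 0 minimiser.
Proof. by vm_compute. Qed.

Lemma implyNN a b : ~~ (a && ~~ b) = (a ==> b).
Proof. by case: a b => [] []. Qed.
Lemma orNN a b : ~~ (~~ a && ~~ b) = a || b.
Proof. by case: a b => [] []. Qed.

(** * Each stage computes the relation that it names *)

Section Stages.
Variables (m : nat) (A : gcb m) (inp : seq nat).
Notation L := (size inp).
Notation P := (plus A).
Notation n := (nQ P).
Notation k := (nC P).
Notation Q := 'I_n.
Notation C := 'I_k.
Hypothesis nL : n <= L.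
Hypothesis mL : m <= L.
Hypothesis kL : k <= L.
Hypothesis colN : forall t : trans_t (nQ A) m, t \notin delta A -> col t = set0.

Notation cnt S x := #|[set y : Q | (y < x) && S y]|.

Definition spec (r : nat) (R : seq nat -> bool) : Prop := match r with
  | rUQ => forall y, y < L -> R [:: y] = (y < n)
  | rUM => forall y, y < L -> R [:: y] = (y < m)
  | rUC => forall y, y < L -> R [:: y] = (y < nC A)
  | rU0 => forall y, y < L -> R [:: y] = (y < qinit A)
  | rDL => forall (q : Q) (a : 'I_m) (q' : Q), R [:: val q; val a; val q'] = ((q, a, q') \in delta P)
  | rCW => forall (q : Q) (a : 'I_m) (q' : Q) (c : 'I_(nC A)), (q, a, q') \in delta A ->
      R [:: val q; val a; val q'; val c] = (c \in col (g := A) (q, a, q'))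
  | rUK => forall y, y < L -> R [:: y] = (y < k)
  | rCL => forall (q : Q) (a : 'I_m) (q' : Q) (c : C), R [:: val q; val a; val q'; val c] =
      (c \in col (g := P) (q, a, q'))
  | rX => forall p q : Q, R [:: val p; val q] = ((p, q) \in sim P)
  | rGD => forall (q : Q) (a : 'I_m) (q' : Q), R [:: val q; val a; val q'] = gd q a q'
  | rGO => forall q : Q, R [:: val q] = good q
  | rEQ => forall p q : Q, R [:: val p; val q] = eqv p q
  | rSR => forall (c : C) (q q' : Q), R [:: val c; val q; val q'] = connect (erel (sg gd c)) q q'
  | rGG => forall (c : C) (q : Q) (a : 'I_m) (q' : Q), R [:: val c; val q; val a; val q'] = G c q a q'
  | rPL => forall (p : Q) (c : C) (q : Q) (d : C), R [:: val p; val c; val q; val d] = ple (p, c) (q, d)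
  | rTM => forall (q : Q) (c : C), R [:: val q; val c] = tmax (q, c)
  | rDG => forall (c : C) (q : Q) (a : 'I_m) (q' : Q), R [:: val c; val q; val a; val q'] = dg c q a q'
  | rDR => forall (c : C) (q q' : Q), R [:: val c; val q; val q'] = connect (erel (dg c)) q q'
  | rFA => forall (q : Q) (c : C) (e : Q), R [:: val q; val c; val e] = fam (q, c) e
  | rRP => forall (q : Q) (c : C) (e : Q), R [:: val q; val c; val e] = rep (q, c) e
  | rCQ => forall (q x : Q) i, i < L -> R [:: val q; val x; i] = (cnt (fun y => eqv y q) x == i)
  | rCR => forall (q : Q) (c : C) (e x : Q) i, i < L -> R [:: val q; val c; val e; val x; i] =
      (cnt (fun y => rep (q, c) y && eqv y e) x == i)
  | rIM => forall (q : Q) (c : C) (e s : Q), R [:: val q; val c; val e; val s] = img (q, c) e s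
  | rQB => forall s : Q, R [:: val s] = (s \in QB P)
  | rDB => forall (s : Q) (a : 'I_m) (s' : Q), R [:: val s; val a; val s'] = dB s a s'
  | rSB => forall (q : Q) (c : C) (s : Q) (a : 'I_m) (s' : Q),
      R [:: val q; val c; val s; val a; val s'] = sB (q, c) s a s'
  | rB0 => forall s : Q, R [:: val s] = eqv s (qinit P) && (rk s == 0)
  | _ => True
  end.

Definition ok r s := forall st, (forall r', r' < r -> spec r' (rel st r')) ->
  spec r (rel (run inp [::] s st) r).

Lemma qltL (q : Q) : q < L. Proof. exact: leq_trans nL. Qed.
Lemma altL (a : 'I_m) : a < L. Proof. exact: leq_trans mL. Qed.
Lemma cltL (c : C) : c < L. Proof. exact: leq_trans kL. Qed.
Let ltL := (qltL, altL, cltL).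

Lemma setr_at r t l f vs st : t \notin freads (f (iota 0 l) l) -> r != t -> size vs = l ->
  all (fun v => v < L) vs ->
  rel (run inp [::] (setr r t l f 0) st) r vs = evalf inp vs st (f (iota 0 l) l).
Proof.
by move=> tf rt sv av; have [E _ _ _] := @setr_spec inp r t l f [::] st 0 erefl tf rt; apply: E.
Qed.

Lemma all_guard l (U R : nat -> bool) (R' : pred 'I_l) : l <= L ->
  (forall y, y < L -> U y = (y < l)) -> (forall q : 'I_l, R q = R' q) ->
  ~~ has (fun x => U x && ~~ R x) (iota 0 L) = [forall q : 'I_l, R' q].
Proof.
move=> lL HU HR; rewrite (has_guard (P' := fun q => ~~ R' q) lL HU).
  by rewrite negb_exists; apply: eq_forallb => q; rewrite negbK.
by move=> q; rewrite HR.
Qed.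

Lemma ok_GD : ok rGD stGD.
Proof.
move=> st H q a q'; rewrite /stGD setr_at //=; last by rewrite !ltL.
rewrite (H rDL) //; congr (_ && _).
apply: (all_guard nL (H rUQ isT)) => z; by rewrite /= implyNN (H rDL) // (H rX).
Qed.

Lemma ok_EQ : ok rEQ stEQ.
Proof.
move=> st H p q; rewrite /stEQ setr_at //=; last by rewrite !ltL.
by rewrite !(H rGO) // !(H rX).
Qed.

Lemma ok_GG : ok rGG stGG.
Proof.
move=> st H c q a q'; rewrite /stGG setr_at //=; last by rewrite !ltL.
by rewrite (H rGD) // (H rCL) // (H rSR).
Qed.

Lemma ok_TM : ok rTM stTM.
Proof.
move=> st H q c; rewrite /stTM setr_at //=; last by rewrite !ltL.
rewrite (H rGO) //; congr (_ && _).
apply: etrans (all_guard nL (H rUQ isT) (R' := fun q' => [forall c', ple (q, c) (q', c') ==> ple (q', c') (q, c)]) _) _.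
  move=> q'; apply: (all_guard kL (H rUK isT)) => c'; by rewrite /= implyNN !(H rPL).
apply/forallP/forallP => h; first by case=> q' c'; apply/(forallP (h q')).
by move=> q'; apply/forallP => c'; apply: h.
Qed.

Lemma ok_DG : ok rDG stDG.
Proof.
move=> st H c q a q'; rewrite /stDG setr_at //=; last by rewrite !ltL.
rewrite (H rGG) //; congr (_ && _).
apply: (all_guard nL (H rUQ isT)) => z; by rewrite /= implyNN (H rGG) // (H rPL).
Qed.

Lemma ok_FA : ok rFA stFA.
Proof.
move=> st H q c e; rewrite /stFA setr_at //=; last by rewrite !ltL.
by rewrite (H rTM) // (H rDR).
Qed.

Lemma ok_RP : ok rRP stRP.
Proof.
move=> st H q c e; rewrite /stRP setr_at //=; last by rewrite !ltL.
rewrite (H rFA) //; congr (_ && _).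
by apply: (all_guard nL (H rUQ isT)) => z; rewrite /= implyNN (H rFA) // !(H rPL).
Qed.

Lemma ok_DB : ok rDB stDB.
Proof.
move=> st H s a s'; rewrite /stDB setr_at //=; last by rewrite !ltL.
by apply: (has_guard nL (H rUQ isT)) => z; rewrite /= (H rGD) // (H rEQ).
Qed.

Lemma ok_SB : ok rSB stSB.
Proof.
move=> st H q c s a s'; rewrite /stSB setr_at //=; last by rewrite !ltL.
apply: (has_guard nL (H rUQ isT)) => e; apply: (has_guard nL (H rUQ isT)) => e'.
by rewrite /= !(H rIM) // (H rDG).
Qed.

(** A number given by the set of smaller indices is recovered as the first index outside that
    set. *)
Lemma first_out l (U : nat -> bool) y : y < L -> (forall x, x < L -> U x = (x < l)) ->
  ~~ U y && ~~ has (fun z => (z < y) && ~~ U z) (iota 0 L) = (y == l).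
Proof.
move=> yL HU; rewrite HU //; apply/andP/eqP => [[h1 /hasPn h2]|->].
  apply/eqP; rewrite eqn_leq [l <= y]leqNgt h1 andbT leqNgt; apply/negP => ly.
  have := h2 l; rewrite mem_iota ly HU ?ltnn; last by lia.
  by move/(_ (ltn_trans ly yL)).
rewrite ltnn; split=> //; apply/hasPn => z; rewrite mem_iota => /andP[_ zL].
by rewrite HU // andbN.
Qed.

Lemma ok_UK : ok rUK stUK.
Proof.
move=> st H y yL; rewrite /stUK setr_at //=; last by rewrite yL.
rewrite orNN (first_out (l := nC A) (U := fun z => rel st rUC [:: z])) //; last exact: (H rUC).
by rewrite (H rUC) // ltnS [y <= _]leq_eqVlt orbC.
Qed.

Lemma ok_CL : ok rCL stCL.
Proof.
move=> st H q a q' c; rewrite /stCL setr_at //=; last by rewrite !ltL.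
rewrite orNN (H rUC) ?ltL // (H rDL) // inE.
case: insubP => [c' lt e|nlt] /=; last by rewrite nlt.
rewrite lt /= -e; have [t|t] := boolP (_ \in delta A); first by rewrite (H rCW).
by rewrite (colN t) inE.
Qed.

Lemma q0_sem st (q : Q) : spec rU0 (rel st rU0) ->
  ~~ rel st rU0 [:: val q] && ~~ has (fun z => (z < q) && ~~ rel st rU0 [:: z]) (iota 0 L) =
  (q == qinit P).
Proof.
move=> H0; rewrite (first_out (l := qinit A) (U := fun z => rel st rU0 [:: z])) ?ltL //.
Qed.

Lemma setr_env r t l f d env vs st : size env = d -> t \notin freads (f (iota d l) (d + l)) ->
  r != t -> size vs = l -> all (fun v => v < L) vs ->
  rel (run inp env (setr r t l f d) st) r vs = evalf inp (env ++ vs) st (f (iota d l) (d + l)).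
Proof.
by move=> sd tf rt sv av; have [E _ _ _] := @setr_spec inp r t l f env st d sd tf rt; apply: E.
Qed.

Definition below r st := forall r', r' < r -> spec r' (rel st r').

(** Stages only write relations with numbers from their own on, so earlier results survive. *)
Lemma keep r s env st : all (fun w => r <= w) (writes s) -> below r st -> below r (run inp env s st).
Proof.
move=> hw H r' lt; rewrite run_frame; first exact: H.
by apply/negP => /(allP hw); rewrite leqNgt lt.
Qed.

Fixpoint reach_in (T : finType) (e : T -> pred T) i x y :=
  if i is i'.+1 then reach_in e i' x y || [exists z, reach_in e i' x z && e z y] else x == y.

(** A path without repetitions has fewer edges than there are vertices. *)
Lemma reach_in_connect (T : finType) (e : T -> pred T) i x y : #|T| <= i ->
  reach_in e i x y = connect e x y.
Proof.
move=> le; apply/idP/connectP.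
  have H : reach_in e i x y -> connect e x y.
    elim: i y {le} => [|i IH] y /=; first by move/eqP->.
    case/orP=> [/IH //|/existsP[z /andP[/IH h hz]]]; apply: connect_trans h _; exact: connect1.
  by move/H/connectP.
case=> p; case/shortenP=> p' hp' up' _ ->.
have {}le : size p' <= i.
  by apply: leq_trans le; have := max_card (mem (x :: p')); rewrite (card_uniqP up') /=; lia.
elim/last_ind: p' i {up'} hp' le => [|p' z IH] i.
  by move=> _ _ /=; elim: i => [|i IH] /=; rewrite ?eqxx ?IH.
rewrite rcons_path size_rcons last_rcons => /andP[/IH h1 h2]; case: i => // i /h1 h3 /=.
by apply/orP; right; apply/existsP; exists (last x p'); rewrite h3.
Qed.

Lemma ok_GO : ok rGO stGO.
Proof.
move=> st H; rewrite /stGO; set s1 := setr _ _ _ _ 0; set s2 := setr _ _ _ _ 1.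
change (spec rGO (rel (run inp [::] (SFor s2) (run inp [::] s1 st)) rGO)).
pose J i st := below rGO st /\ forall q : Q, rel st rGO [:: val q] = reach_in (erel gd) i (qinit P) q.
have [_ h] : J L (run inp [::] (SFor s2) (run inp [::] s1 st)).
  apply: for_inv.
    split; first exact: keep.
    by move=> q; rewrite setr_at //=; [rewrite q0_sem 1?eq_sym //; apply: H|rewrite !ltL].
  move=> x st1 xL [B1 H1]; split; first exact: keep.
  move=> q; rewrite setr_env //=; last by rewrite !ltL.
  rewrite orNN H1; congr (_ || _).
  apply: (has_guard nL (B1 rUQ isT)) => z; rewrite H1; congr (_ && _).
  by apply: (has_guard mL (B1 rUM isT)) => a; rewrite (B1 rGD).
move=> q; rewrite h.
by rewrite reach_in_connect // card_ord.
Qed.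

Lemma closure_ok r edge (g : C -> Q -> 'I_m -> Q -> bool) st : 2 < r -> r < t1 ->
  (forall c z a y d, (t3 \notin freads (edge c z a y d))) ->
  (forall st1 (c : C) (q q' : Q) (a : 'I_m) x w, below r st1 ->
     evalf inp [:: x; val c; w; val q'; val q; val a] st1 (edge 1 4 5 3 6) = g c q a q') ->
  below r st -> forall (c : C) (q q' : Q),
  rel (run inp [::] (closure r edge) st) r [:: val c; val q; val q'] = connect (erel (g c)) q q'.
Proof.
move=> r2 rt t3e He H; rewrite /closure; set s1 := setr _ _ _ _ 0; set s2 := setr _ _ _ _ 1.
change (forall (c : C) (q q' : Q), rel (run inp [::] (SFor s2) (run inp [::] s1 st)) r
  [:: val c; val q; val q'] = connect (erel (g c)) q q').
have r36 : r != t3 by rewrite neq_ltn (ltn_trans rt).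
have w1 : all (fun w => r <= w) (writes s1) by rewrite /= leqnn andbT ltnW // (ltn_trans rt).
have w2 : all (fun w => r <= w) (writes s2) by rewrite /= leqnn andbT ltnW // (ltn_trans rt).
pose J i st := below r st /\ forall (c : C) (q q' : Q),
  rel st r [:: val c; val q; val q'] = reach_in (erel (g c)) i q q'.
have [_ h] : J L (run inp [::] (SFor s2) (run inp [::] s1 st)).
  apply: for_inv.
    split; first exact: keep.
    move=> c q q'; rewrite setr_at //=; last by rewrite !ltL.
    by rewrite -(inj_eq val_inj) /= -!leqNgt andbC -eqn_leq.
  move=> x st1 xL [B1 H1]; split; first exact: keep.
  move=> c q q'; rewrite setr_env //=; last by rewrite !ltL.
    rewrite orNN H1; congr (_ || _).
    have B0 : spec rUQ (rel st1 rUQ) by apply: B1; lia.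
    have B2 : spec rUM (rel st1 rUM) by apply: B1; lia.
    apply: (has_guard nL B0) => z; rewrite H1; congr (_ && _).
    by apply: (has_guard mL B2) => a; rewrite He.
  by rewrite !inE [36 == r]eq_sym (negbTE r36) /= (negbTE (t3e _ _ _ _ _)).
move=> c q q'; rewrite h.
by rewrite reach_in_connect // card_ord.
Qed.

Lemma ok_SR : ok rSR stSR.
Proof.
move=> st H; apply: closure_ok => // st1 c q q' a x w B1 /=.
by rewrite (B1 rGD) // (B1 rCL).
Qed.

Lemma ok_DR : ok rDR stDR.
Proof.
move=> st H; apply: closure_ok => // st1 c q q' a x w B1 /=.
by rewrite (B1 rDG).
Qed.

Lemma ok_PL : ok rPL stPL.
Proof.
move=> st H; rewrite /stPL; set s1 := setr _ _ _ _ 0; set s2 := setr _ _ _ _ 4.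
change (spec rPL (rel (run inp [::] (iter 4 SFor s2) (run inp [::] s1 st)) rPL)).
pose J i st := below rPL st /\ forall (p : Q) (c : C) (q : Q) (d : C),
  rel st rPL [:: val p; val c; val q; val d] = (((p, c), (q, d)) \in iter i (@pleF _ P) setT).
have [_ h] : J (0 + L ^ 4) (run inp [::] (iter 4 SFor s2) (run inp [::] s1 st)).
  apply: rep_inv.
    split; first exact: keep.
    move=> p c q d; rewrite setr_at //=; last by rewrite !ltL.
    by rewrite inE ltnn.
  move=> i st1 us su [B1 H1]; split; first exact: keep.
  case: us su => [|u1 [|u2 [|u3 [|u4 [|]]]]] // _ p c q d.
  rewrite setr_env //=; last by rewrite !ltL.
  rewrite inE /= (B1 rEQ) //; congr (_ && _).
  apply: (all_guard mL (B1 rUM isT)) => a; apply: (all_guard nL (B1 rUQ isT)) => p'.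
  rewrite /= implyNN (B1 rGG) //; congr (_ ==> _).
  by apply: (has_guard nL (B1 rUQ isT)) => q'; rewrite /= (B1 rGG) // H1.
move=> p c q d; rewrite h.
rewrite iter_gfp //; first exact: pleF_mono.
(* The [L ^ 4] rounds are at least as many as the pairs of pairs. *)
by rewrite !card_prod !card_ord add0n -[4]/(2 * 2) expnM -!mulnn !leq_mul.
Qed.

Definition R2 st r (S : {set Q * Q}) := forall p q : Q, rel st r [:: val p; val q] = ((p, q) \in S).

Lemma set2_R2 r f d env st (S : {set Q * Q}) : size env = d -> t2 \notin freads (f (iota d 2) (d + 2)) ->
  r != t2 -> (forall p q : Q, evalf inp (env ++ [:: val p; val q]) st (f (iota d 2) (d + 2)) = ((p, q) \in S)) ->
  R2 (run inp env (set2 r f d) st) r S.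
Proof. by move=> sd tf rt H p q; rewrite /set2 setr_env // ?H //= !ltL. Qed.

Lemma R2_frame r s env st S : r \notin writes s -> R2 st r S -> R2 (run inp env s st) r S.
Proof. by move=> h H p q; rewrite run_frame. Qed.

Lemma ltS_neq x (xk : x < k) (d : C) : (d < x.+1) && (d != Ordinal xk) = (d < x).
Proof. by rewrite ltnS [d < x]ltn_neqAle andbC. Qed.

Lemma bigcup_ltS (F : C -> {set Q * Q}) x (xk : x < k) :
  \bigcup_(d : C | d < x.+1) F d = (\bigcup_(d : C | d < x) F d) :|: F (Ordinal xk).
Proof.
rewrite (bigD1 (Ordinal xk)) ?ltnSn //= setUC; congr (_ :|: _).
by apply: eq_bigl => d; apply: ltS_neq.
Qed.

Lemma bigcap_ltS (F : C -> {set Q * Q}) x (xk : x < k) :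
  \bigcap_(d : C | d < x.+1) F d = (\bigcap_(d : C | d < x) F d) :&: F (Ordinal xk).
Proof.
rewrite (bigD1 (Ordinal xk)) ?ltnSn //= setIC; congr (_ :&: _).
by apply: eq_bigl => d; apply: ltS_neq.
Qed.

(** The nested fixpoints are verified from the inside out; each level leaves the relations of the
    outer ones intact. *)
Lemma loopD_ok (X Y S : {set Q * Q}) (c d : C) (u1 u2 u3 u4 : nat) st : below rX st -> R2 st rX X ->
  R2 st rY Y -> R2 st rNY S ->
  let st' := run inp [:: u1; u2; val c; u3; u4; val d] loopD st in
  [/\ below rX st', R2 st' rX X, R2 st' rY Y & R2 st' rNY (S :|: simZ X Y c d)].
Proof.
move=> B HX HY HS; set env := [:: u1; u2; val c; u3; u4; val d].
set s1 := set2 rZ (fun vs => fT (v_ vs 0)) 6; set s2 := set2 rZ (PhiF 2 5) 8.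
set s3 := set2 rNY (fun vs => fO (fR rNY vs) (fR rZ vs)) 6.
move=> st'; rewrite {}/st'; have -> : run inp env loopD st = run inp env s3 (run inp env (iter 2 SFor s2) (run inp env s1 st)) by [].
pose J i st := [/\ below rX st, R2 st rX X, R2 st rY Y, R2 st rNY S
  & R2 st rZ (iter i (Phi X Y c d) setT)].
have [B1 X1 Y1 S1 Z1] : J (0 + L ^ 2) (run inp env (iter 2 SFor s2) (run inp env s1 st)).
  apply: rep_inv.
    split; try by [apply: keep|apply: R2_frame].
    by apply: set2_R2 => // p q; rewrite /= inE ltnn.
  move=> i st1 us su [B1 X1 Y1 S1 Z1].
  split; try by [apply: keep|apply: R2_frame].
  case: us su => [|v1 [|v2 [|]]] // _.
  apply: set2_R2 => // p q; rewrite /= inE /=.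
  apply: (all_guard mL (B1 rUM isT)) => a; apply: (all_guard nL (B1 rUQ isT)) => p'.
  rewrite /= implyNN (B1 rDL) //; congr (_ ==> _).
  apply: (has_guard nL (B1 rUQ isT)) => q'; rewrite /= !orNN !(B1 rDL) // !(B1 rCL) // X1 Y1 Z1.
  by congr (_ && _); case: ifP => _ /=; rewrite ?orbF.
rewrite iter_gfp in Z1; [|exact: Phi_mono|by rewrite card_prod !card_ord add0n -mulnn leq_mul].
split; try by [apply: keep|apply: R2_frame].
by apply: set2_R2 => // p q; rewrite /= orNN S1 Z1 !inE.
Qed.

Lemma loopY_ok (X Y : {set Q * Q}) (c : C) (u1 u2 u3 u4 : nat) st : below rX st -> R2 st rX X ->
  R2 st rY Y ->
  let st' := run inp [:: u1; u2; val c; u3; u4] loopY st in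
  [/\ below rX st', R2 st' rX X & R2 st' rY (simYF X c Y)].
Proof.
move=> B HX HY; set env := [:: u1; u2; val c; u3; u4].
set s1 := set2 rNY (fun vs => fN (fT (v_ vs 0))) 5.
set s3 := set2 rY (fun vs => fR rNY vs) 5.
move=> st'; rewrite {}/st'; have -> : run inp env loopY st = run inp env s3 (run inp env (guard rUK 5 loopD) (run inp env s1 st)) by [].
pose J i st := [/\ below rX st, R2 st rX X, R2 st rY Y
  & R2 st rNY (\bigcup_(d : C | d < i) simZ X Y c d)].
have [B1 X1 Y1 S1] : J k (run inp env (guard rUK 5 loopD) (run inp env s1 st)).
  apply: (forg_inv (U := rUK) kL).
  - by move=> x st1 [B1 _ _ _]; apply: (B1 rUK isT).
  - split; try by [apply: keep|apply: R2_frame].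
    by apply: set2_R2 => // p q; rewrite /= ltnn big_pred0 ?inE // => d.
  move=> x st1 xk [B1 X1 Y1 S1].
  have [B2 X2 Y2 S2] := loopD_ok c (Ordinal xk) u1 u2 u3 u4 B1 X1 Y1 S1.
  by split=> // p q; rewrite [LHS]S2 bigcup_ltS.
split; try by [apply: keep|apply: R2_frame].
apply: set2_R2 => // p q; rewrite /= S1 (eq_bigl xpredT) // => d; by rewrite ltn_ord.
Qed.

Lemma loopC_ok (X S : {set Q * Q}) (c : C) (u1 u2 : nat) st : below rX st -> R2 st rX X ->
  R2 st rNX S ->
  let st' := run inp [:: u1; u2; val c] loopC st in
  [/\ below rX st', R2 st' rX X & R2 st' rNX (S :&: simY X c)].
Proof.
move=> B HX HS; set env := [:: u1; u2; val c].
set s1 := set2 rY (fun vs => fN (fT (v_ vs 0))) 3.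
set s3 := set2 rNX (fun vs => fA (fR rNX vs) (fR rY vs)) 3.
move=> st'; rewrite {}/st'; have -> : run inp env loopC st = run inp env s3 (run inp env (iter 2 SFor loopY) (run inp env s1 st)) by [].
pose J i st := [/\ below rX st, R2 st rX X, R2 st rNX S & R2 st rY (iter i (simYF X c) set0)].
have [B1 X1 S1 Y1] : J (0 + L ^ 2) (run inp env (iter 2 SFor loopY) (run inp env s1 st)).
  apply: rep_inv.
    split; try by [apply: keep|apply: R2_frame].
    by apply: set2_R2 => // p q; rewrite /= ltnn inE.
  move=> i st1 us su [B1 X1 S1 Y1].
  case: us su => [|v1 [|v2 [|]]] // _.
  have [B2 X2 Y2] := loopY_ok c u1 u2 v1 v2 B1 X1 Y1.
  by split=> //; apply: R2_frame.
rewrite iter_lfp in Y1; [|exact: simYF_mono|by rewrite card_prod !card_ord add0n -mulnn leq_mul].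
split; try by [apply: keep|apply: R2_frame].
by apply: set2_R2 => // p q; rewrite /= S1 Y1 inE.
Qed.

Lemma loopX_ok (X : {set Q * Q}) (u1 u2 : nat) st : below rX st -> R2 st rX X ->
  let st' := run inp [:: u1; u2] loopX st in below rX st' /\ R2 st' rX (simXF X).
Proof.
move=> B HX; set env := [:: u1; u2].
set s1 := set2 rNX (fun vs => fT (v_ vs 0)) 2.
set s3 := set2 rX (fun vs => fR rNX vs) 2.
move=> st'; rewrite {}/st'; have -> : run inp env loopX st = run inp env s3 (run inp env (guard rUK 2 loopC) (run inp env s1 st)) by [].
pose J i st := [/\ below rX st, R2 st rX X & R2 st rNX (\bigcap_(c : C | c < i) simY X c)].
have [B1 X1 S1] : J k (run inp env (guard rUK 2 loopC) (run inp env s1 st)).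
  apply: (forg_inv (U := rUK) kL).
  - by move=> x st1 [B1 _ _]; apply: (B1 rUK isT).
  - split; try by [apply: keep|apply: R2_frame].
    by apply: set2_R2 => // p q; rewrite /= ltnn big_pred0 ?inE // => d.
  move=> x st1 xk [B1 X1 S1].
  have [B2 X2 S2] := loopC_ok (Ordinal xk) u1 u2 B1 X1 S1.
  by split=> // p q; rewrite [LHS]S2 bigcap_ltS.
split; first exact: keep.
apply: set2_R2 => // p q; rewrite /= S1 (eq_bigl xpredT) // => d; by rewrite ltn_ord.
Qed.

Lemma ok_X : ok rX stX.
Proof.
move=> st H; rewrite /stX; set s1 := set2 _ _ _.
change (spec rX (rel (run inp [::] (iter 2 SFor loopX) (run inp [::] s1 st)) rX)).
pose J i st := below rX st /\ R2 st rX (iter i (@simXF _ P) setT).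
have [B1 X1] : J (0 + L ^ 2) (run inp [::] (iter 2 SFor loopX) (run inp [::] s1 st)).
  apply: rep_inv.
    split; first exact: keep.
    by apply: set2_R2 => // p q; rewrite /= ltnn inE.
  move=> i st1 us su [B1 X1]; case: us su => [|v1 [|v2 [|]]] // _.
  exact: loopX_ok.
rewrite iter_gfp in X1; [|exact: simXF_mono|by rewrite card_prod !card_ord add0n -mulnn leq_mul].
exact: X1.
Qed.

Lemma zero_sem x : x < L -> ~~ has (fun z => z < x) (iota 0 L) = (x == 0).
Proof.
move=> xL; case: x xL => [|x] xL.
  by apply/hasPn => z.
by apply/negbTE/negPn/hasP; exists 0 => //; rewrite mem_iota /=; lia.
Qed.

Lemma has_succ x (R : nat -> bool) : x < L ->
  has (fun y => (y < x) && ~~ has (fun z => (y < z) && (z < x)) (iota 0 L) && R y) (iota 0 L) =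
  if x is y.+1 then R y else false.
Proof.
move=> xL; apply/hasP/idP => [[y]|].
  rewrite mem_iota => /andP[_ yL] /andP[/andP[yx /hasPn h] Ry].
  case: x xL yx h => // x xL yx h; suff -> : x = y by [].
  apply/eqP; rewrite eqn_leq [y <= x](yx : y < x.+1) andbT leqNgt; apply/negP => ltyx.
  by have := h x; rewrite mem_iota add0n /= (ltnW xL) ltyx ltnSn => /(_ isT).
case: x xL => // x xL Rx; exists x; first by rewrite mem_iota /= add0n ltnW.
by rewrite ltnSn Rx andbT /=; apply/hasPn => z _; apply/negP; lia.
Qed.

Lemma cntS (S : pred Q) (y : Q) : cnt S y.+1 = cnt S y + S y.
Proof.
rewrite (cardsD1 y) inE ltnSn /= addnC; congr (_ + _); apply: eq_card => z; rewrite !inE ltnS.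
by rewrite [z < y]ltn_neqAle -andbA; congr (_ && _).
Qed.

Lemma count_step (S : pred Q) (E : nat -> bool) (R : nat -> nat -> bool) (x : Q) i : i < L ->
  (forall y : Q, E y = S y) -> (forall (y : Q) j, y < x -> j < L -> R y j = (cnt S y == j)) ->
  (val x == 0) && (i == 0) || (if val x is y.+1 then
    ~~ (~~ (E y && has (fun j => (j < i) && ~~ has (fun z => j < z < i) (iota 0 L) && R y j) (iota 0 L))
        && ~~ (~~ E y && R y i)) else false) = (cnt S x == i).
Proof.
move=> iL HE HR; case: x HR => [[|y] yn] /= HR.
  have z : [set y : Q | (y < 0) && S y] = set0 by apply/setP => z; rewrite !inE.
  by rewrite orbF z cards0 eq_sym.
rewrite has_succ //; pose y' : Q := Ordinal (ltnW yn).
rewrite -[y]/(val y') cntS HE orNN; case: (S y') => /=.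
  rewrite orbF addn1; case: i iL => [|i] iL; first by rewrite eqn0Ngt.
  by rewrite (HR y' i) //= ?eqSS // ltnW.
by rewrite addn0 (HR y' i).
Qed.

Lemma ok_CQ : ok rCQ stCQ.
Proof.
move=> st H; rewrite /stCQ /count; set s := setr _ _ _ _ _.
pose J t st := below rCQ st /\ forall (q x : Q) i, x < t -> i < L ->
  rel st rCQ [:: val q; val x; i] = (cnt (fun y => eqv y q) x == i).
have [_ h] : J L (run inp [::] (SFor s) st).
  apply: for_inv; first by split.
  move=> t st1 tL [B1 H1]; split; first exact: keep.
  move=> q x i xt iL; rewrite setr_env //=; last by rewrite !ltL iL.
  rewrite !orNN !zero_sem ?ltL // (@has_succ x) ?ltL //.
  apply: (count_step (E := fun y => rel st1 rEQ [:: y; val q])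
    (R := fun y j => rel st1 rCQ [:: val q; y; j])) => // [y|y j yx jL]; first by rewrite (B1 rEQ).
  by apply: H1 => //; apply: leq_trans yx _.
by move=> q x i iL; apply: h => //; apply: qltL.
Qed.

Lemma ok_CR : ok rCR stCR.
Proof.
move=> st H; rewrite /stCR /count; set s := setr _ _ _ _ _.
pose J t st := below rCR st /\ forall (q : Q) (c : C) (e x : Q) i, x < t -> i < L ->
  rel st rCR [:: val q; val c; val e; val x; i] = (cnt (fun y => rep (q, c) y && eqv y e) x == i).
have [_ h] : J L (run inp [::] (SFor s) st).
  apply: for_inv; first by split.
  move=> t st1 tL [B1 H1]; split; first exact: keep.
  move=> q c e x i xt iL; rewrite setr_env //=; last by rewrite !ltL iL.
  rewrite !orNN !zero_sem ?ltL // (@has_succ x) ?ltL //.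
  apply: (count_step (E := fun y => rel st1 rRP [:: val q; val c; y] && rel st1 rEQ [:: y; val e])
    (R := fun y j => rel st1 rCR [:: val q; val c; val e; y; j])) => // [y|y j yx jL].
    by rewrite (B1 rRP) // (B1 rEQ).
  by apply: H1 => //; apply: leq_trans yx _.
by move=> q c e x i iL; apply: h => //; apply: qltL.
Qed.

(** Formulas quantify over numbers below [L], so counts must stay in that range. *)
Lemma cnt_ltL (S : pred Q) (x : Q) : cnt S x < L.
Proof.
apply: leq_trans nL; apply: leq_trans (_ : #|[set~ x]|.+1 <= _).
  by rewrite ltnS; apply: subset_leq_card; apply/subsetP => y; rewrite !inE => /andP[h _]; apply/eqP => e; rewrite e ltnn in h.
by rewrite cardsC1 card_ord (ltn_predK (ltn_ord x)).
Qed.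

Lemma ok_IM : ok rIM stIM.
Proof.
move=> st H q c e s; rewrite /stIM setr_at //=; last by rewrite !ltL.
rewrite (H rFA) //; congr (_ && _).
apply: (has_guard nL (H rUQ isT)) => z; rewrite (H rRP) // !(H rPL) // (H rEQ) //=.
congr [&& _, _, _ & _]; rewrite /rkf /rk /rank.
apply/hasP/eqP => [[i]|E].
  by rewrite mem_iota add0n => /andP[_ iL]; rewrite (H rCR) // (H rCQ) // => /andP[/eqP -> /eqP ->].
exists (cnt (fun y => eqv y s) s); first by rewrite mem_iota add0n cnt_ltL.
by rewrite (H rCR) ?cnt_ltL // (H rCQ) ?cnt_ltL // E !eqxx.
Qed.

Lemma rk0_sem st (s : Q) : spec rCQ (rel st rCQ) ->
  has (fun z => ~~ has (fun y => y < z) (iota 0 L) && rel st rCQ [:: val s; val s; z]) (iota 0 L) =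
  (rk s == 0).
Proof.
move=> H; apply/hasP/eqP => [[z]|E].
  rewrite mem_iota add0n => /andP[_ zL]; rewrite zero_sem // => /andP[/eqP -> ].
  by rewrite H ?(leq_ltn_trans _ zL) // => /eqP.
have L0 : 0 < L by apply: leq_ltn_trans (qltL s).
exists 0; first by rewrite mem_iota add0n.
have E' : cnt (fun y => eqv y s) s = 0 by exact: E.
by rewrite zero_sem // H // E'.
Qed.

Lemma ok_QB : ok rQB stQB.
Proof.
move=> st H s; rewrite /stQB setr_at //=; last by rewrite !ltL.
rewrite (H rGO) // inE; congr (_ && _); rewrite orNN rk0_sem; last exact: (H rCQ).
congr (_ || _).
apply: etrans (has_guard nL (H rUQ isT) (P' := fun q => [exists c, [exists e, img (q, c) e s]]) _) _.
  move=> q; apply: (has_guard kL (H rUK isT)) => c; apply: (has_guard nL (H rUQ isT)) => e.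
  by rewrite /= (H rIM).
apply/existsP/existsP => [[q /existsP[c h]]|[[q c] h]]; first by exists (q, c).
by exists q; apply/existsP; exists c.
Qed.

Lemma ok_B0 : ok rB0 stB0.
Proof.
move=> st H s; rewrite /stB0 setr_at //=; last by rewrite !ltL.
rewrite rk0_sem; last exact: (H rCQ).
congr (_ && _).
apply: etrans (has_guard nL (H rUQ isT) (P' := fun q => (q == qinit P) && eqv s q) _) _.
  by move=> q; rewrite q0_sem ?(H rEQ) //; apply: (H rU0).
apply/existsP/idP => [[q /andP[/eqP -> //]]|h]; by exists (qinit P); rewrite eqxx.
Qed.

Lemma stages_ok st : below rUK st -> below 27 (run inp [::] (seqs stages) st).
Proof.
move=> H; have nxt r s st1 : all (fun w => r <= w) (writes s) -> ok r s -> below r st1 ->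
    below r.+1 (run inp [::] s st1).
  move=> hw hs B r'; rewrite ltnS leq_eqVlt => /orP[/eqP ->|lt]; first exact: hs.
  by have K := @keep r s [::] st1 hw B; apply: K.
have seqE a l st1 : run inp [::] (seqs (a :: l)) st1 = run inp [::] (seqs l) (run inp [::] a st1).
  by [].
rewrite /stages !seqE -[run _ _ (seqs [::]) _]/(run _ _ stB0 _).
apply: (nxt _ _ _ _ ok_B0) => //; apply: (nxt _ _ _ _ ok_SB) => //.
apply: (nxt _ _ _ _ ok_DB) => //; apply: (nxt _ _ _ _ ok_QB) => //.
apply: (nxt _ _ _ _ ok_IM) => //; apply: (nxt _ _ _ _ ok_CR) => //.
apply: (nxt _ _ _ _ ok_CQ) => //; apply: (nxt _ _ _ _ ok_RP) => //.
apply: (nxt _ _ _ _ ok_FA) => //; apply: (nxt _ _ _ _ ok_DR) => //.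
apply: (nxt _ _ _ _ ok_DG) => //; apply: (nxt _ _ _ _ ok_TM) => //.
apply: (nxt _ _ _ _ ok_PL) => //; apply: (nxt _ _ _ _ ok_GG) => //.
apply: (nxt _ _ _ _ ok_SR) => //; apply: (nxt _ _ _ _ ok_EQ) => //.
apply: (nxt _ _ _ _ ok_GO) => //; apply: (nxt _ _ _ _ ok_GD) => //.
apply: (nxt _ _ _ _ ok_X) => //; apply: (nxt _ _ _ _ ok_CL) => //.
by apply: (nxt _ _ _ _ ok_UK).
Qed.

End Stages.

(** Products are enumerated lexicographically, in the order of nested loops. *)
Lemma flatten_enum_prod (T1 T2 : finType) R (F : T1 * T2 -> seq R) :
  flatten [seq F t | t <- enum {: T1 * T2}] =
  flatten [seq flatten [seq F (x, y) | y <- enum T2] | x <- enum T1].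
Proof.
have -> : enum {: T1 * T2} = [seq (x, y) | x <- enum T1, y <- enum T2].
  by rewrite [LHS]enumT [in LHS]unlock.
elim: (enum T1) => //= x l IH.
by rewrite map_cat flatten_cat IH -map_comp.
Qed.

Lemma drop_enum_ord n x (xn : x < n) : drop x (enum 'I_n) = Ordinal xn :: drop x.+1 (enum 'I_n).
Proof.
rewrite (drop_nth (Ordinal xn)) ?size_enum_ord //; congr (_ :: _).
by apply: val_inj; rewrite /= nth_enum_ord.
Qed.

(** * Reading the encoded automaton *)

Section Parse.
Variables (m : nat) (A : gcb m).
Notation inp := (encode A).
Notation L := (size inp).
Notation n := (nQ A).
Notation k := (nC A).

Definition enc_trans (t : trans_t n m) := enc_nat (t \in delta A) ++
  (if t \in delta A then flatten [seq enc_nat (c \in col t) | c <- enum 'I_k] else [::]).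

Lemma encodeE : inp = enc_nat n ++ enc_nat m ++ enc_nat k ++ enc_nat (qinit A) ++
  flatten [seq flatten [seq flatten [seq enc_trans (q, a, q') | q' <- enum 'I_n]
    | a <- enum 'I_m] | q <- enum 'I_n].
Proof.
by rewrite /encode flatten_enum_prod flatten_enum_prod.
Qed.

Lemma size_enc_nat j : size (enc_nat j) = j.+1.
Proof. by rewrite /enc_nat size_rcons size_nseq. Qed.

Lemma drop_enc p j s : drop p inp = enc_nat j ++ s -> drop (p + j.+1) inp = s /\
  forall i, i <= j -> (nth 0 inp (p + i) == 1) = (i < j).
Proof.
move=> E; split; first by rewrite addnC -drop_drop E drop_size_cat // size_enc_nat.
move=> i ij; rewrite -nth_drop E nth_cat size_enc_nat ltnS ij /enc_nat nth_rcons size_nseq.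
case: (ltngtP i j) ij => // h _; first by rewrite nth_nseq h.
Qed.

Lemma readnum_ok U j s st : drop (ptr st) inp = enc_nat j ++ s -> (forall y, rel st U [:: y] = false) ->
  let st' := run inp [::] (readnum U) st in
  [/\ drop (ptr st') inp = s, forall y, rel st' U [:: y] = (y < j) &
    forall r, r != U -> rel st' r = rel st r].
Proof.
move=> E Z; have [E1 E2] := drop_enc E.
have jL : j < L.
  by have := size_drop (ptr st) inp; rewrite E size_cat size_enc_nat; lia.
pose J x st1 := [/\ ptr st1 = ptr st + minn x j, forall y, rel st1 U [:: y] = (y < minn x j) &
  forall r, r != U -> rel st1 r = rel st r].
have [J1 J2 J3] : J L (run inp [::] (SFor (SIf FCur (SSeq (SAsg U [:: 0] (FNot (FLt 0 0))) SAdv) SSkip)) st).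
  apply: for_inv.
    by split=> //; rewrite min0n ?addn0 // => y; rewrite Z.
  move=> x st1 xL [K1 K2 K3]; rewrite /= K1 E2 ?geq_minr //.
  case: (ltnP x j) => xj.
    rewrite (minn_idPl (ltnW xj)) in K1 K2 *; rewrite xj /J (minn_idPl xj) ltnn /=; split.
    - by rewrite addnS.
    - move=> y; rewrite /= fupd_same /fupd eqseq_cons andbT; case: eqVneq => [->|ny].
        by rewrite ltnSn.
      by rewrite K2 ltnS [RHS]leq_eqVlt (negbTE ny).
    - by move=> r h; rewrite /= fupd_diff // K3.
  rewrite (minn_idPr xj) in K1 K2 *; rewrite ltnn /J (minn_idPr (leqW xj)); by split.
have mj : minn L j = j by apply/minn_idPr/ltnW.
rewrite mj in J1 J2; split=> //=.
by rewrite J1 -addnS.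
Qed.

Definition fact st (q : 'I_n) (a : 'I_m) (q' : 'I_n) :=
  rel st rDL [:: val q; val a; val q'] = ((q, a, q') \in delta A) /\
  ((q, a, q') \in delta A -> forall c : 'I_k,
     rel st rCW [:: val q; val a; val q'; val c] = (c \in col (g := A) (q, a, q'))).

(** A parsing step only fills [rDL] and [rCW], at tuples that begin with the current loop indices
    [ws]; what was read earlier begins differently. *)
Definition frm l (ws : seq nat) st st' := (forall r, r != rDL -> r != rCW -> rel st' r = rel st r) /\
  forall vs, take l vs != ws -> rel st' rDL vs = rel st rDL vs /\ rel st' rCW vs = rel st rCW vs.

Definition base st := forall r, r < rDL -> spec A inp r (rel st r).

Lemma frm_base l ws st st' : frm l ws st st' -> base st -> base st'.
Proof.
move=> [F _] B r lt; have r4 : r != 4 by rewrite neq_ltn lt.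
have r5 : r != 5 by rewrite neq_ltn (ltn_trans lt).
by rewrite F //; apply: B.
Qed.

Lemma frm_fact l ws st st' q a q' : l <= 3 -> frm l ws st st' ->
  take l [:: val q; val a; val q'] != ws -> fact st q a q' -> fact st' q a q'.
Proof.
move=> l3 [_ F] nw [h1 h2]; split; first by have [-> _] := F _ nw.
move=> t c; have nw' : take l [:: val q; val a; val q'; val c] != ws.
  by case: l l3 nw {F} => [|[|[|[|]]]].
by have [_ ->] := F _ nw'; apply: h2.
Qed.

Lemma frm_trans l ws st1 st2 st3 : frm l ws st1 st2 -> frm l ws st2 st3 -> frm l ws st1 st3.
Proof.
move=> [F1 F2] [G1 G2]; split; first by move=> r h1 h2; rewrite G1 // F1.
by move=> vs h; have [-> ->] := G2 vs h; apply: F2.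
Qed.

Lemma frm_weak l l' ws ws' st st' : l' <= l -> take l' ws = ws' -> frm l ws st st' -> frm l' ws' st st'.
Proof.
move=> ll <- [F1 F2]; split=> // vs h; apply: F2; apply: contra h => /eqP <-.
by rewrite take_takel.
Qed.

Hypothesis nL : n <= L.
Hypothesis mL : m <= L.
Hypothesis kL : k <= L.

Lemma parse_colours_ok (q : 'I_n) (a : 'I_m) (q' : 'I_n) s st : base st ->
  drop (ptr st) inp = flatten [seq enc_nat (c \in col (g := A) (q, a, q')) | c <- enum 'I_k] ++ s ->
  let st' := run inp [:: val q; val a; val q'] parse_colours st in
  [/\ drop (ptr st') inp = s, rel st' rDL = rel st rDL,
    (forall c : 'I_k, rel st' rCW [:: val q; val a; val q'; val c] = (c \in col (g := A) (q, a, q')))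
    & frm 3 [:: val q; val a; val q'] st st'].
Proof.
move=> B E.
pose J y st1 := [/\ drop (ptr st1) inp =
    flatten [seq enc_nat (c \in col (g := A) (q, a, q')) | c <- drop y (enum 'I_k)] ++ s,
  rel st1 rDL = rel st rDL,
  (forall c : 'I_k, c < y -> rel st1 rCW [:: val q; val a; val q'; val c] = (c \in col (g := A) (q, a, q')))
  & frm 3 [:: val q; val a; val q'] st st1].
have [J1 J2 J3 J4] : J k (run inp [:: val q; val a; val q'] parse_colours st).
  apply: (forg_inv (U := rUC) kL).
  - by move=> x st1 [_ _ _ F]; apply: (frm_base F B (r := rUC)).
  - by rewrite /J drop0; split.
  move=> y st1 yk [J1 J2 J3 J4].
  rewrite (drop_enum_ord yk) /= -catA in J1.
  set b := (Ordinal yk \in _) in J1.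
  have cur : (nth 0 inp (ptr st1) == 1) = b.
    by have [_ /(_ 0)] := drop_enc J1; rewrite addn0 => ->; case: (b).
  have [J1' _] := drop_enc J1.
  pose st2 := setrel rCW [:: val q; val a; val q'; y] b st1.
  set res := run _ _ _ _; have -> : res = Store (rel st2) (ptr st1 + b.+1) (out st2).
    by rewrite /res /st2 /= cur; case: (b); rewrite /= ?addn1 ?addn2.
  have F2 : frm 3 [:: val q; val a; val q'] st1 st2.
    split; first by move=> r _ h; rewrite /= fupd_diff.
    move=> vs h /=; split; first by rewrite fupd_diff.
    by rewrite fupd_same fupd_diff //; apply: contra h => /eqP ->.
  have R2 : rel st2 rDL = rel st rDL by rewrite /= fupd_diff.
  have R3 (c : 'I_k) : c < y.+1 ->
      rel st2 rCW [:: val q; val a; val q'; val c] = (c \in col (g := A) (q, a, q')).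
    rewrite /= fupd_same /fupd ltnS leq_eqVlt => /orP[/eqP cy|cy].
      by have e : c = Ordinal yk by [exact: val_inj]; rewrite e eqxx.
    rewrite ifF; first exact: J3.
    by apply/eqP => -[e]; rewrite e ltnn in cy.
  have F3 := frm_trans J4 F2.
  by split.
rewrite [drop k _]drop_oversize ?size_enum_ord // in J1; split=> // c.
exact: J3 (ltn_ord c).
Qed.

Lemma parse_trans_ok (q : 'I_n) (a : 'I_m) (q' : 'I_n) s st : base st ->
  drop (ptr st) inp = enc_trans (q, a, q') ++ s ->
  let st' := run inp [:: val q; val a; val q'] parse_trans st in
  [/\ drop (ptr st') inp = s, fact st' q a q' & frm 3 [:: val q; val a; val q'] st st'].
Proof.
move=> B; rewrite /enc_trans -catA => E; have [E1 /(_ 0 isT)] := drop_enc E.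
rewrite addn0 [0 < _]lt0b => cur.
pose st1 := setrel rDL [:: val q; val a; val q'] ((q, a, q') \in delta A) st.
set res := run _ _ _ _.
have resE : res = if (q, a, q') \in delta A
    then run inp [:: val q; val a; val q'] parse_colours (Store (rel st1) (ptr st + 2) (out st1))
    else Store (rel st1) (ptr st + 1) (out st1).
  rewrite /res /parse_trans; set pc := parse_colours; rewrite /= cur /st1.
  by case: (_ \in _); rewrite ?addn1 ?addn2.
have F1 p : frm 3 [:: val q; val a; val q'] st (Store (rel st1) p (out st1)).
  split; first by move=> r h _; rewrite /= fupd_diff.
  move=> vs h /=; split; last by rewrite fupd_diff.
  by rewrite fupd_same fupd_diff //; apply: contra h => /eqP ->.
have D1 : rel st1 rDL [:: val q; val a; val q'] = ((q, a, q') \in delta A).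
  by rewrite /= !fupd_same.
rewrite {}resE; case: ifP cur E1 => t cur E1; last by split=> //; split=> //; rewrite t.
have [|P1 P2 P3 P4] := parse_colours_ok (q := q) (a := a) (q' := q') (s := s)
  (frm_base (F1 (ptr st + 2)) B); first exact: E1.
split=> //; first by split; rewrite ?P2.
exact: frm_trans (F1 _) P4.
Qed.

Lemma parse_row_ok (q : 'I_n) (a : 'I_m) s st : base st ->
  drop (ptr st) inp = flatten [seq enc_trans (q, a, q') | q' <- enum 'I_n] ++ s ->
  let st' := run inp [:: val q; val a] (guard rUQ 2 parse_trans) st in
  [/\ drop (ptr st') inp = s, forall q', fact st' q a q' & frm 2 [:: val q; val a] st st'].
Proof.
move=> B E.
pose J y st1 := [/\ drop (ptr st1) inp = flatten [seq enc_trans (q, a, q') | q' <- drop y (enum 'I_n)] ++ s,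
  forall q' : 'I_n, q' < y -> fact st1 q a q' & frm 2 [:: val q; val a] st st1].
have [J1 J2 J3] : J n (run inp [:: val q; val a] (guard rUQ 2 parse_trans) st).
  apply: (forg_inv (U := rUQ) nL).
  - by move=> x st1 [_ _ F]; apply: (frm_base F B (r := rUQ)).
  - by rewrite /J drop0; split.
  move=> y st1 yn [J1 J2 J3]; rewrite (drop_enum_ord yn) /= -catA in J1.
  have [P1 P2 P3] := parse_trans_ok (q' := Ordinal yn) (frm_base J3 B) J1.
  split=> //; last by apply: frm_trans J3 _; apply: frm_weak P3.
  move=> q'; rewrite ltnS leq_eqVlt => /orP[/eqP e|lt].
    by have -> : q' = Ordinal yn by apply: val_inj.
  apply: frm_fact P3 _ (J2 _ lt) => //; by apply/eqP => -[e]; rewrite e ltnn in lt.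
rewrite [drop n _]drop_oversize ?size_enum_ord // in J1; split=> // q'.
exact: J2 (ltn_ord q').
Qed.

Lemma parse_state_ok (q : 'I_n) s st : base st ->
  drop (ptr st) inp = flatten [seq flatten [seq enc_trans (q, a, q') | q' <- enum 'I_n] | a <- enum 'I_m] ++ s ->
  let st' := run inp [:: val q] (guard rUM 1 (guard rUQ 2 parse_trans)) st in
  [/\ drop (ptr st') inp = s, forall a q', fact st' q a q' & frm 1 [:: val q] st st'].
Proof.
move=> B E.
pose J y st1 := [/\ drop (ptr st1) inp = flatten [seq flatten [seq enc_trans (q, a, q') | q' <- enum 'I_n]
    | a <- drop y (enum 'I_m)] ++ s,
  forall (a : 'I_m) q', a < y -> fact st1 q a q' & frm 1 [:: val q] st st1].
have [J1 J2 J3] : J m (run inp [:: val q] (guard rUM 1 (guard rUQ 2 parse_trans)) st).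
  apply: (forg_inv (U := rUM) mL).
  - by move=> x st1 [_ _ F]; apply: (frm_base F B (r := rUM)).
  - by rewrite /J drop0; split.
  move=> y st1 yn [J1 J2 J3]; rewrite (drop_enum_ord yn) /= -catA in J1.
  have [P1 P2 P3] := parse_row_ok (a := Ordinal yn) (frm_base J3 B) J1.
  split=> //; last by apply: frm_trans J3 _; apply: frm_weak P3.
  move=> a q'; rewrite ltnS leq_eqVlt => /orP[/eqP e|lt].
    by have -> : a = Ordinal yn by apply: val_inj.
  apply: frm_fact P3 _ (J2 _ _ lt) => //; by apply/eqP => -[e]; rewrite e ltnn in lt.
rewrite [drop m _]drop_oversize ?size_enum_ord // in J1; split=> // a q'.
exact: J2 (ltn_ord a).
Qed.

Lemma parse_ok : forall r, r < rUK -> spec A inp r (rel (run inp [::] parse empty_store) r).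
Proof.
have Z : forall r y, rel empty_store r [:: y] = false by [].
have E := encodeE; rewrite -{1}(drop0 inp) -[0]/(ptr empty_store) in E.
have [E1 U1 F1] := readnum_ok (U := rUQ) E (Z _).
set st1 := run _ _ _ _ in E1 U1 F1.
have [|E2 U2 F2] := readnum_ok (U := rUM) E1; first by move=> y; rewrite F1.
set st2 := run _ _ _ _ in E2 U2 F2.
have [|E3 U3 F3] := readnum_ok (U := rUC) E2; first by move=> y; rewrite F2 // F1.
set st3 := run _ _ _ _ in E3 U3 F3.
have [|E4 U4 F4] := readnum_ok (U := rU0) E3; first by move=> y; rewrite F3 // F2 // F1.
set st4 := run _ _ _ _ in E4 U4 F4.
have B : base st4.
  case=> [|[|[|[|r]]]] //= _ y _.
  - by rewrite F4 // F3 // F2 // U1.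
  - by rewrite F4 // F3 // U2.
  - by rewrite F4 // U3.
  - by rewrite U4.
rewrite -[run inp [::] parse empty_store]/(run inp [::] (guard rUQ 0 (guard rUM 1 (guard rUQ 2 parse_trans))) st4).
pose J y st1 := [/\ drop (ptr st1) inp = flatten [seq flatten [seq flatten [seq enc_trans (q, a, q')
     | q' <- enum 'I_n] | a <- enum 'I_m] | q <- drop y (enum 'I_n)],
  forall (q : 'I_n) a q', q < y -> fact st1 q a q' & frm 0 [::] st4 st1].
have [_ J2 [J3 _]] : J n (run inp [::] (guard rUQ 0 (guard rUM 1 (guard rUQ 2 parse_trans))) st4).
  apply: (forg_inv (U := rUQ) nL).
  - by move=> x st5 [_ _ F]; apply: (frm_base F B (r := rUQ)).
  - by rewrite /J drop0; split.
  move=> y st5 yn [J1 J2 J3]; rewrite (drop_enum_ord yn) /= in J1.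
  have [P1 P2 P3] := parse_state_ok (q := Ordinal yn) (frm_base J3 B) J1.
  split=> //; last by apply: frm_trans J3 _; apply: frm_weak P3.
  move=> q a q'; rewrite ltnS leq_eqVlt => /orP[/eqP e|lt].
    by have -> : q = Ordinal yn by apply: val_inj.
  apply: frm_fact P3 _ (J2 _ _ _ lt) => //; by apply/eqP => -[e]; rewrite e ltnn in lt.
case=> [|[|[|[|[|[|r]]]]]] // _.
- by rewrite J3 //; apply: (B rUQ).
- by rewrite J3 //; apply: (B rUM).
- by rewrite J3 //; apply: (B rUC).
- by rewrite J3 //; apply: (B rU0).
- by move=> q a q'; case: (J2 q a q' (ltn_ord q)).
- by move=> q a q' c; case: (J2 q a q' (ltn_ord q)) => _ h /h.
Qed.

End Parse.

(** * Printing the minimal automaton *)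

Lemma flatten_enum_val (T : finType) (S : {pred T}) R (F : T -> seq R) :
  flatten [seq F (enum_val i) | i <- enum 'I_#|S|] = flatten [seq F x | x <- enum S].
Proof.
rewrite [LHS](_ : _ = flatten (map F [seq enum_val i | i <- enum 'I_#|S|])); last first.
  by rewrite -map_comp.
congr (flatten (map F _)); case: (pickP S) => [x0 _|S0]; last first.
  have e : #|S| = 0 by apply: eq_card0.
  have /size0nil -> : size (enum S) = 0 by rewrite -cardE.
  by apply: size0nil; rewrite size_map size_enum_ord e.
rewrite -[RHS](mkseq_nth x0) -cardE /mkseq -val_enum_ord -map_comp.
by apply: eq_map => i; rewrite /= (enum_val_nth x0).
Qed.

Lemma flatten_enum_set (T : finType) (S : {set T}) R (F : T -> seq R) :
  flatten [seq F x | x <- enum S] = flatten [seq if x \in S then F x else [::] | x <- enum T].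
Proof.
by rewrite {1}/enum_mem -enumT; elim: (enum T) => //= x l IH; case: ifP => _ /=; rewrite IH.
Qed.

Lemma flatten_nseq1 n R (x : R) : flatten [seq [:: x] | _ <- enum 'I_n] = nseq n x.
Proof.
rewrite -[X in nseq X](size_enum_ord n); by elim: (enum 'I_n) => //= i l ->.
Qed.

Lemma nseq_ord n (j : 'I_n) R (x : R) :
  nseq j x = flatten [seq if i < j then [:: x] else [::] | i : 'I_n <- enum 'I_n].
Proof.
transitivity (flatten [seq if i < j then [:: x] else [::] | i <- iota 0 n]); last first.
  by rewrite -val_enum_ord -map_comp.
rewrite -[X in iota 0 X](subnKC (ltnW (ltn_ord j))) iotaD map_cat flatten_cat add0n.
have -> : flatten [seq if i < j then [:: x] else [::] | i <- iota j (n - j)] = [::].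
  have : {in iota j (n - j), forall i, (i < j) = false}.
    by move=> i; rewrite mem_iota => /andP[ji _]; rewrite ltnNge ji.
  elim: (iota j _) => //= i l IH H; rewrite H ?inE ?eqxx //= IH // => y hy.
  by apply: H; rewrite inE hy orbT.
have : {in iota 0 j, forall i, i < j} by move=> i; rewrite mem_iota.
rewrite cats0 -[X in nseq X](size_iota 0 j); elim: (iota 0 j) => //= i l IH H.
rewrite H ?inE ?eqxx //= -IH // => y hy.
by apply: H; rewrite inE hy orbT.
Qed.

(** Numbering a subset preserves the order, so the new index of a state counts the kept states
    before it. *)
Lemma enum_val_ltn n (S : {set 'I_n}) (i j : 'I_#|S|) : (enum_val i < enum_val j) = (i < j).
Proof.
have srt : sorted ltn [seq val x | x <- enum S].
  rewrite sorted_map {1}/enum_mem -enumT; apply: sorted_filter.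
    by move=> y x z; apply: ltn_trans.
  by rewrite -sorted_map val_enum_ord iota_ltn_sorted.
have homo (i1 j1 : 'I_#|S|) : i1 < j1 -> enum_val i1 < enum_val j1.
  move=> lt; set x0 := enum_val i1; rewrite /x0 !(enum_val_nth x0).
  have sz (k : 'I_#|S|) : k < size (enum S) by rewrite -cardE.
  have := sorted_ltn_nth ltn_trans 0 srt; move/(_ i1 j1); rewrite !inE size_map !sz.
  by move/(_ isT isT lt); rewrite !(nth_map x0).
apply/idP/idP => [|/homo //]; apply: contraTT; rewrite -!leqNgt leq_eqVlt => /orP[/eqP e|/homo/ltnW //].
by have -> : j = i by apply: val_inj.
Qed.

Fixpoint silent s := match s with
  | SEmit _ => false | SSeq a b => silent a && silent b | SFor a => silent a
  | SIf _ a b => silent a && silent b | _ => true end.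

Lemma run_silent inp s env st : silent s -> out (run inp env s st) = out st.
Proof.
elim: s env st => [|r vs f|a IHa b IHb|a IH|f a IHa b IHb|b|] env st //=.
- by case/andP=> ha hb; rewrite IHb ?IHa.
- by move=> h; elim: (iota _ _) st => //= x l IHl st; rewrite IHl IH.
- by case/andP=> ha hb; case: ifP => _; rewrite ?IHa ?IHb.
Qed.

Definition symbol (o : bool) := if o then 1 else 2.
Definition unary j := rcons (nseq j true) false.
Definition trans_bits m (A : gcb m) (t : trans_t (nQ A) m) := unary (t \in delta A) ++
  (if t \in delta A then flatten [seq unary (c \in col t) | c <- enum 'I_(nC A)] else [::]).

Lemma map_symbol_unary j : map symbol (unary j) = enc_nat j.
Proof. by rewrite /unary map_rcons map_nseq. Qed.

Lemma encode_bits m (A : gcb m) : encode A = map symbol (unary (nQ A) ++ unary m ++ unary (nC A) ++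
  unary (qinit A) ++ flatten [seq flatten [seq flatten [seq trans_bits (q, a, q') | q' <- enum 'I_(nQ A)]
    | a <- enum 'I_m] | q <- enum 'I_(nQ A)]).
Proof.
rewrite encodeE !map_cat !map_symbol_unary; do 4!congr (_ ++ _).
rewrite map_flatten -map_comp; congr flatten; apply: eq_map => q /=.
rewrite map_flatten -map_comp; congr flatten; apply: eq_map => a /=.
rewrite map_flatten -map_comp; congr flatten; apply: eq_map => q' /=.
rewrite /trans_bits map_cat map_symbol_unary; congr (_ ++ _); case: ifP => // _.
rewrite map_flatten -map_comp; congr flatten; apply: eq_map => c /=.
by rewrite map_symbol_unary.
Qed.

Section Emission.
Variables (m : nat) (A : gcb m) (inp : seq nat).
Notation L := (size inp).
Notation P := (plus A).
Notation n := (nQ P).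
Notation k := (nC P).
Hypothesis nL : n <= L.
Hypothesis mL : m <= L.
Hypothesis kL : k <= L.
Variable st : store.
Hypothesis S : below A inp 27 st.

Lemma emits_guard l U (env : seq nat) d s P' : l <= L -> (forall y, y < L -> rel st U [:: y] = (y < l)) ->
  size env = d -> (forall q : 'I_l, emits inp (rcons env q) st s = P' q) ->
  emits inp env st (guard U d s) = flatten [seq P' q | q <- enum 'I_l].
Proof.
move=> lL HU <- HP /=.
rewrite -(flatten_guard (U := fun x => rel st U [:: x]) (P := fun x => emits inp (rcons env x) st s) lL HU HP).
by congr flatten; apply: eq_map => x; rewrite nth_rcons ltnn eqxx.
Qed.

Lemma emits_guardB (env : seq nat) d s P' : size env = d ->
  (forall q : 'I_n, q \in QB P -> emits inp (rcons env q) st s = P' q) ->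
  emits inp env st (guardB d s) = flatten [seq P' (enum_val i) | i <- enum 'I_#|QB P|].
Proof.
move=> sd HP; rewrite flatten_enum_val flatten_enum_set.
apply: emits_guard => //; first exact: (S (isT : rUQ < 27)).
move=> q /=; rewrite nth_rcons sd ltnn eqxx (S (isT : rQB < 27)) //.
by case: ifP => // /HP.
Qed.

Hypothesis H : b0 P \in QB P.
Hypothesis b0E : forall s : 'I_n, eqv s (qinit P) && (rk s == 0) = (s == b0 P).

Lemma emits_emit : map symbol (emits inp [::] st emit) = encode (mkB H).
Proof.
rewrite encode_bits; congr map.
set g1 := guardB 0 e1; set g2 := guard rUM 0 e1; set g3 := guard rUQ 0 (guard rUK 1 e1).
set g4 := guardB 0 (SIf (fEg rUQ (fun b => fA (fR rB0 [:: b]) (fL 0 b)) 1) e1 SSkip).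
pose gc := guard rUQ 3 (guard rUK 4 (SIf (FRel rSB [:: 3; 4; 0; 1; 2]) e2 (SSeq e1 e2))).
pose g5 := guardB 0 (guard rUM 1 (guardB 2 (SIf (FRel rDB [:: 0; 1; 2]) (seqs [:: e1; e2; gc]) e2))).
have -> : emits inp [::] st emit = emits inp [::] st g1 ++ [:: false] ++ emits inp [::] st g2 ++ [:: false] ++
  emits inp [::] st g3 ++ [:: false] ++ emits inp [::] st g4 ++ [:: false] ++ emits inp [::] st g5.
  by rewrite -[X in _ = _ ++ _ ++ _ ++ _ ++ _ ++ _ ++ _ ++ _ ++ X]cats0.
have U j : unary j = nseq j true ++ [:: false] by rewrite cats1.
rewrite !U -!catA; congr (_ ++ _).
  by rewrite -flatten_nseq1; apply: (emits_guardB (P' := fun=> [:: true])).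
congr (_ ++ _); congr (_ ++ _).
  by rewrite -flatten_nseq1; apply: emits_guard => //; apply: (S (isT : rUM < 27)).
congr (_ ++ _); congr (_ ++ _).
  rewrite -flatten_nseq1 (flatten_enum_val _ (fun=> [:: true])) flatten_enum_prod.
  apply: emits_guard => //; first exact: (S (isT : rUQ < 27)).
  by move=> q; apply: emits_guard => //; apply: (S (isT : rUK < 27)).
congr (_ ++ _); congr (_ ++ _).
  have -> : qinit (mkB H) = enum_rank_in H (b0 P) by [].
  rewrite nseq_ord.
  have -> : [seq if i < enum_rank_in H (b0 P) then [:: true] else [::] | i : 'I_#|QB P| <- enum 'I_#|QB P|] =
    [seq if enum_val i < b0 P then [:: true] else [::] | i : 'I_#|QB P| <- enum 'I_#|QB P|].
    by apply: eq_map => i; rewrite -enum_val_ltn enum_rankK_in.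
  apply: (emits_guardB (P' := fun q => if q < b0 P then [:: true] else [::])) => // q _.
  rewrite /=; congr (if _ then _ else _).
  apply: etrans (has_guard nL (S (isT : rUQ < 27)) (P' := fun b => (b == b0 P) && (q < b)) _) _.
    by move=> b; rewrite /= (S (isT : rB0 < 27)) // b0E.
  by apply/existsP/idP => [[b /andP[/eqP ->]]|h] //; exists (b0 P); rewrite eqxx.
congr (_ ++ _).
pose cols s a s' := flatten [seq unary (~~ sB c s a s') | c <- enum {: 'I_n * 'I_k}].
pose tr s a s' := unary (dB s a s') ++ (if dB s a s' then cols s a s' else [::]).
have trE (z : trans_t #|QB P| m) :
    trans_bits (A := mkB H) z = tr (enum_val z.1.1) z.1.2 (enum_val z.2).
  rewrite /trans_bits /tr inE; congr (_ ++ _); case: ifP => // _.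
  rewrite /cols -[RHS]flatten_enum_val; congr flatten; apply: eq_map => c /=; by rewrite inE.
under eq_map => q do under eq_map => a do under eq_map => q' do rewrite trE /=.
apply: (emits_guardB (P' := fun s => flatten [seq flatten [seq tr s a (enum_val s')
   | s' <- enum 'I_#|QB P|] | a <- enum 'I_m])) => // s _.
apply: emits_guard => // [|a]; first exact: (S (isT : rUM < 27)).
apply: (emits_guardB (P' := fun s' => tr s a s')) => // s' _.
have gcE : emits inp [:: nat_of_ord s; nat_of_ord a; nat_of_ord s'] st gc = cols s a s'.
  rewrite /cols flatten_enum_prod; apply: emits_guard => // [|q]; first exact: (S (isT : rUQ < 27)).
  apply: emits_guard => // [|c]; first exact: (S (isT : rUK < 27)).
  by rewrite /= (S (isT : rSB < 27)); case: sB.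
rewrite /tr; move: (gc) gcE => gc' gcE /=; rewrite (S (isT : rDB < 27)).
by case: dB => //=; rewrite gcE cats0.
Qed.

End Emission.

(** * Normalised labels, size bounds and the final theorem *)

Section Normalise.
Variables (m : nat) (A : gcb m).

(* The encoding forgets the colours of the triples that are not transitions. *)
Definition normalise : gcb m := @GCB m (nQ A) (nC A) (qinit A) (delta A)
  (fun t => if t \in delta A then col t else set0).

Lemma encode_normalise : encode normalise = encode A.
Proof.
rewrite /encode /=; do 4!congr (_ ++ _); congr flatten; apply: eq_map => t.
by case: ifP => // ->.
Qed.

Lemma accepting_normalise w r : is_run A w r -> accepting_run normalise r <-> accepting_run A r.
Proof.
move=> [_ R]; split=> -[c [N h]]; exists c, N => i /h /=; by have [-> _] := R i.
Qed.

Lemma accepts_normalise w : accepts normalise w <-> accepts A w.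
Proof. by split=> -[r [R /(accepting_normalise R) a]]; exists r. Qed.

Lemma normalise_hd : history_deterministic A -> history_deterministic normalise.
Proof.
move=> [s H]; exists s => w; have [R h] := H w; split=> // /accepts_normalise /h a.
exact/(accepting_normalise R).
Qed.

End Normalise.

Lemma size_flatten_le T R (F : T -> seq R) B s : (forall x, size (F x) <= B) ->
  size (flatten [seq F x | x <- s]) <= size s * B.
Proof. by move=> h; elim: s => //= x s IH; rewrite size_cat mulSn leq_add. Qed.

Lemma encode_size_ge m (A : gcb m) : [/\ nQ A <= size (encode A), m <= size (encode A)
  & (nC A).+1 <= size (encode A)].
Proof. by rewrite /encode !size_cat !size_enc_nat; split; lia. Qed.

(** Four unary numbers of at most [N + 1] symbols, then at most [N ^ 3] triples, each with a
    membership bit and [N] colour bits of at most two symbols. *)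
Definition size_bound N := 4 * (N + 1) + N * N * N * (2 + N * 2).

Lemma encode_size_le m (A : gcb m) : size (encode A) <= size_bound (nQ A + m + nC A).
Proof.
set N := nQ A + m + nC A.
have enc b : size (enc_nat (b : bool)) <= 2 by rewrite size_enc_nat; case: b.
have body : size (flatten [seq enc_nat (t \in delta A) ++
    (if t \in delta A then flatten [seq enc_nat (c \in col (g := A) t) | c <- enum 'I_(nC A)] else [::])
    | t <- enum (trans_t (nQ A) m)]) <= N * N * N * (2 + N * 2).
  apply: leq_trans (size_flatten_le _ (B := 2 + N * 2) _) _.
    move=> t; rewrite size_cat leq_add //; case: ifP => // _.
    apply: leq_trans (size_flatten_le _ (B := 2) _) _ => //.
    by rewrite size_enum_ord leq_mul2r /N; lia.
  rewrite leq_mul2r -cardE !card_prod !card_ord; apply/orP; right.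
  by rewrite !leq_mul // /N; lia.
rewrite /encode !size_cat !size_enc_nat /size_bound.
move: body; have := ltn_ord (qinit A); rewrite /N; lia.
Qed.

Lemma poly_bounded_size_bound : poly_bounded size_bound.
Proof. by rewrite /size_bound; poly_tac. Qed.

Lemma encode_symbols m (A : gcb m) : all (fun a => (a == 1) || (a == 2)) (encode A).
Proof. by rewrite encode_bits all_map; apply/allP => -[]. Qed.

Lemma run_minimiser m (A : gcb m) (H : b0 (plus A) \in QB (plus A)) :
  (forall t, t \notin delta A -> col (g := A) t = set0) ->
  (forall s : 'I_(nQ (plus A)), eqv s (qinit (plus A)) && (rk s == 0) = (s == b0 (plus A))) ->
  map symbol (out (run (encode A) [::] minimiser empty_store)) = encode (mkB H).
Proof.
move=> colN HB; have [nL mL kL] := encode_size_ge A.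
have S1 := parse_ok nL mL (ltnW kL).
rewrite -[run _ _ minimiser _]/(run (encode A) [::] emit (run (encode A) [::] (seqs stages)
   (run (encode A) [::] parse empty_store))).
set st1 := run _ _ parse _ in S1 *.
have S2 : below A (encode A) 27 (run (encode A) [::] (seqs stages) st1).
  by apply: stages_ok.
rewrite run_emits ?run_silent //=.
exact: (emits_emit nL mL kL S2).
Qed.

Theorem theorem11 :
  exists (M : TM) (c : nat),
    forall (m : nat) (A : gcb m),
      history_deterministic A ->
      exists B : gcb m,
        [/\ history_deterministic B,
            (forall w, accepts B w <-> accepts A w),
            (forall B' : gcb m, history_deterministic B' ->
               (forall w, accepts B' w <-> accepts A w) -> nQ B <= nQ B')
          & computes_within M (encode A)
              (c * (nQ A + m + nC A).+1 ^ c) (encode B)].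
Proof.
have [M [b [K bK] HM]] := program_machine minimiser_wf.
have [K' bK'] : poly_bounded (fun N => K * (size_bound N + 2) ^ K).
  by have := poly_bounded_size_bound => ?; poly_tac.
(* [K'] belongs to the base [N + 2]. As [N] is positive, [N + 2 <= (N + 1) ^ 2]; this doubles the
   exponent, and the factor has to equal the exponent. *)
exists M, (2 * K') => m A hA.
have [T /sres_plus HT] := hd_of_history_deterministic (normalise_hd hA).
have [H [B1 B2 B3]] := minimal_automaton (normalise_hd hA).
exists (mkB H); split=> //.
- by move=> w; rewrite B2; apply: accepts_normalise.
- by move=> B' h E; apply: B3 => // w; rewrite E; apply: iff_sym; apply: accepts_normalise.
rewrite -(run_minimiser H) => [|t /negbTE /= -> //|]; last first.
  by move=> s; apply: (b0E (ord0 : 'I_(nC (plus (normalise A)))) HT).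
rewrite encode_normalise; apply: HM; first exact: encode_symbols.
set N := nQ A + m + nC A; apply: leq_trans (bK _) _.
apply: (@leq_trans (K * (size_bound N + 2) ^ K)).
  rewrite leq_mul2l; apply/orP; right; case: (K) => // K1; rewrite leq_exp2r //.
  by rewrite -addn2 leq_add2r encode_size_le.
apply: leq_trans (bK' N) _; rewrite leq_mul ?leq_pmull // expnM.
have N1 : 0 < N by rewrite /N; have := ltn_ord (qinit A); lia.
case: K' {bK'} => // K'; rewrite leq_exp2r // -mulnn; nia.
Qed.
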